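(* Let $q\geq5$ be a prime power with $q\equiv2\pmod 3$, $m=(q+1)/3$. Let $P=P_{(a,b)}\in\mathcal X_3(\mathbb F_{q^2})\setminus\mathcal O$ with $\alpha(P)^2-\alpha(P)+1\neq0$, and let $i$ be the $\mathcal P$-order of $\alpha(P)$. If $i\le m-2$, then $$H(P)=\langle q,\ q+1,\ (q-1)+j(q-2),\ (q-1)+i(q-2)-1\ \mid\ j=0,\ldots,i-1\rangle.$$ If $i=m-1$, then $$H(P)=\langle q,\ q+1,\ (q-1)+j(q-2)\ \mid\ j=0,\ldots,m-2\rangle.$$
   Context: Let $q$ be a prime power with $q\equiv 2\pmod 3$, $m=(q+1)/3$. Let $\mathcal X_3$ be the nonsingular projective model (defined over $\mathbb F_{q^2}$) of the plane curve $y^{q+1}+x^{2m}+x^m=0$. Let $\mathcal O_0$ be the $m$ points centered at the singular point $(0,0)$ (zeros of $x$) and $\mathcal O_\infty$ the $m$ points over the point at infinity (poles of $x$); every other point has affine coordinates $(a,b)$, $a\ne0$, and is denoted $P_{(a,b)}$. Let $\mathcal O_m=\{P_{(a,0)}: a^m+1=0\}$, $\mathcal O=\mathcal O_0\cup\mathcal O_\infty\cup\mathcal O_m$, and for $P=P_{(a,b)}\notin\mathcal O$ let $\alpha(P)=a^m/(1+a^m)$. Fix a primitive cube root of unity $\zeta_3\in\mathbb F_{q^2}$ and for $i\in\mathbb Z$ let $\mathcal P_i(s)=\frac{(s+\zeta_3)^{3i}-(s+\zeta_3^2)^{3i}}{3(\zeta_3-\zeta_3^2)s(s-1)}$ (a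 polynomial for $i\ge1$). For $\alpha\in\overline{\mathbb F}_{q^2}\setminus\{0,1,-\zeta_3,-\zeta_3^2\}$, the $\mathcal P$-order of $\alpha$ is the smallest positive integer $i$ with $\mathcal P_{i+1}(\alpha)=0$ (such $i$ always exists). $H(P)$ is the Weierstrass semigroup at $P$ (integers $n\ge0$ such that some function has pole divisor exactly $nP$); $\langle\cdot\rangle$ is the semigroup generated by the listed integers. *)

(* Defs.v *)
From HB Require Import structures.
From mathcomp Require Import all_boot all_order all_algebra all_field.
Set Implicit Arguments. Unset Strict Implicit. Unset Printing Implicit Defensive.
Import Order.TTheory GRing.Theory Num.Theory.
Local Open Scope ring_scope.

Definition m_of (q : nat) : nat := (q.+1 %/ 3)%N.

(* P_i(s) = ((s+z)^{3i} - (s+z^2)^{3i}) / (3 (z - z^2) s (s-1)),  z a primitive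
   cube root of unity (evaluated as a rational expression; only used at s <> 0,1). *)
Definition calP (F : fieldType) (z : F) (i : nat) (s : F) : F :=
  ((s + z) ^+ (3 * i) - (s + z ^+ 2) ^+ (3 * i)) /
  (3%:R * (z - z ^+ 2) * s * (s - 1)).

Definition is_calP_order (F : fieldType) (z al : F) (i : nat) : Prop :=
  [/\ (0 < i)%N, calP z i.+1 al = 0 &
      forall j : nat, (0 < j)%N -> (j < i)%N -> calP z j.+1 al != 0].

Definition eval2 (F L : fieldType) (iota : {rmorphism F -> L})
    (p : {poly {poly F}}) (x y : L) : L :=
  (map_poly (fun c : {poly F} => (map_poly iota c).[x]) p).[y].

Definition is_function_field_X3 (F L : fieldType) (iota : {rmorphism F -> L})
    (q : nat) (x y : L) : Prop :=
  [/\ y ^+ q.+1 + x ^+ (2 * m_of q) + x ^+ (m_of q) = 0,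
      forall p : {poly F}, p != 0 -> (map_poly iota p).[x] != 0 &
      forall z : L, exists A B : {poly {poly F}},
        eval2 iota B x y != 0 /\ z = eval2 iota A x y / eval2 iota B x y].

(* normalized discrete valuation of L trivial on the constants: a place of L/F
   (values on nonzero elements only; the value at 0 is irrelevant) *)
Definition is_place (F L : fieldType) (iota : {rmorphism F -> L})
    (v : L -> int) : Prop :=
  [/\ forall a b : L, a != 0 -> b != 0 -> v (a * b) = v a + v b,
      forall a b : L, a != 0 -> b != 0 -> a + b != 0 ->
        Num.min (v a) (v b) <= v (a + b),
      forall c : F, c != 0 -> v (iota c) = 0 &
      exists t : L, t != 0 /\ v t = 1].

Definition same_place (L : fieldType) (v w : L -> int) : Prop :=
  forall z : L, z != 0 -> v z = w z.

Definition in_weierstrass (F L : fieldType) (iota : {rmorphism F -> L})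
    (v : L -> int) (n : nat) : Prop :=
  exists f : L, [/\ f != 0, v f = - (n%:Z) &
    forall w : L -> int, is_place iota w -> ~ same_place w v -> 0 <= w f].

Definition in_semigroup (s : seq nat) (n : nat) : Prop :=
  exists c : seq nat, size c = size s /\
    n = (\sum_(k < size s) nth 0%N c k * nth 0%N s k)%N.

(* Main.v *)
(** With [x = u^3] and [y = u t] the curve is the quotient of the Fermat (Hermitian) curve
    [u^(q+1) + t^(q+1) + 1 = 0] by the order-3 map [(u, t) -> (zeta u, zeta^2 t)].  The tangent
    line at a rational point above [P] meets the Fermat curve only there, with multiplicity
    [q + 1], so its norm [N] has divisor [(q+1) P - E], where [E] is the pole divisor of [x].
    Hence [n <= k (q+1)] is in [H(P)] iff some function in [L(k E)] has a zero of order
    [k (q+1) - n] at [P].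

    Existence: let [l0, l1, l2] be the conjugates of the tangent form, [l0] vanishing at [P].
    Modulo [l0], the forms of degree [3k] invariant under cyclic permutation are the binary
    forms in [l1, l2] whose two extreme coefficients agree, and [l1 / l2] is, up to a
    translation by its value [s0], a local parameter.  So [(S - s0 T)^(3k-1) (S - s1 T)] with a
    suitable [s1] gives a zero of order [3k - 1], or [3k] when [s1 = s0], that is when
    [(- s0)^(3k) = 1], which says that [calP k] vanishes at [alpha].

    Completeness: Zorn's lemma provides enough places to see that a function regular away from
    the poles of [x] is integral over [F[x]].  Averaging over the Kummer group [y -> e y], its
    components in the powers of [y] are integral too, which bounds [dim L(m E)] by
    [3 m (m + 1) / 2]; the generated semigroup already has that many elements up to
    [m (q + 1)]. *)

From HB Require Import structures.
From mathcomp Require Import all_boot all_order all_algebra all_field cyclic.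
From mathcomp Require Import boolp classical_sets.
From mathcomp Require Import ring zify.
Require Import Defs.
Set Implicit Arguments. Unset Strict Implicit. Unset Printing Implicit Defensive.
Import Order.TTheory GRing.Theory Num.Theory.
Local Open Scope ring_scope.

(** * Valuation rings avoiding an element *)

Section ValuationRings.
Variable K : fieldType.
Implicit Types (A R : K -> Prop) (z h : K).

(** Places are arbitrary valuations over the finite field [F], rational or not, so regularity has to
    be controlled at all of them at once. Upper bounds come from polynomial coordinates, lower
    bounds from explicit forms. They meet at 3m(m+1)/2, which is 3m^2 + 1 - g for the genus g =
    (3m^2 - 3m + 2)/2; from 2g = (m-1)(q+1) + 2 on, every integer is produced directly.

    The Fermat cover requires a cube root of [x], possibly outside [L]. Orders upstairs are compared
    by divisibility in a valuation ring dominating the one below. The Fermat point above P is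
    rational because a^m is fixed by Frobenius, which makes a a cube; rationality is what gives its
    tangent contact of order q + 1.

    The split between orders 3k - 1 and 3k has this origin: putting a0 = 0 in a form invariant under
    a0 -> a1 -> a2 leaves equal coefficients on the pure powers of a1 and a2, a single linear
    condition. Full contact (S - s0 T)^(3k) satisfies it only if (- s0)^(3k) = 1; otherwise one of
    the 3k roots is spent on the condition. *)

Definition is_subring A :=
  [/\ A 1, forall s t, A s -> A t -> A (s - t) & forall s t, A s -> A t -> A (s * t)].

Definition adjoin A z : K -> Prop :=
  fun w => exists p : {poly K}, (forall i, A p`_i) /\ w = p.[z].

Definition is_valuation_ring A := is_subring A /\ forall z, A z \/ A z^-1.

Section SubringTheory.
Variables (A : K -> Prop) (sA : is_subring A).

Lemma subr_1 : A 1. Proof. by case: sA. Qed.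
Lemma subr_B s t : A s -> A t -> A (s - t). Proof. by case: sA => _ + _; apply. Qed.
Lemma subr_M s t : A s -> A t -> A (s * t). Proof. by case: sA => _ _; apply. Qed.
Lemma subr_0 : A 0. Proof. by rewrite -(subrr 1); apply: subr_B subr_1 subr_1. Qed.
Lemma subr_N s : A s -> A (- s).
Proof. by move=> As; rewrite -sub0r; apply: subr_B subr_0 As. Qed.
Lemma subr_D s t : A s -> A t -> A (s + t).
Proof. by move=> As At; rewrite -[t]opprK; apply/subr_B/subr_N. Qed.
Lemma subr_X s n : A s -> A (s ^+ n).
Proof.
by move=> As; elim: n => [|n IH]; [exact: subr_1|rewrite exprS; apply: subr_M].
Qed.
Lemma subr_sum (I : Type) (r : seq I) (P : pred I) (f : I -> K) :
  (forall i, P i -> A (f i)) -> A (\sum_(i <- r | P i) f i).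
Proof. by move=> Af; apply: big_ind Af; [exact: subr_0|exact: subr_D]. Qed.
Lemma subr_nat n : A n%:R.
Proof. by elim: n => [|n IH]; [exact: subr_0|rewrite -natr1; apply/subr_D/subr_1]. Qed.

Lemma sub_adjoin z w : A w -> adjoin A z w.
Proof.
move=> Aw; exists w%:P; split; last by rewrite hornerC.
by move=> i; rewrite coefC; case: eqP => // _; exact: subr_0.
Qed.

Lemma mem_adjoin z : adjoin A z z.
Proof.
exists 'X; split; last by rewrite hornerX.
by move=> i; rewrite coefX; apply: subr_nat.
Qed.

Lemma adjoin_subring z : is_subring (adjoin A z).
Proof.
split; first exact/sub_adjoin/subr_1.
  move=> _ _ [p [Ap ->]] [r [Ar ->]]; exists (p - r); split; last by rewrite hornerD hornerN.
  by move=> i; rewrite coefB; apply: subr_B.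
move=> _ _ [p [Ap ->]] [r [Ar ->]]; exists (p * r); split; last by rewrite hornerM.
by move=> i; rewrite coefM; apply: subr_sum => j _; apply: subr_M.
Qed.

End SubringTheory.

(* Krull's argument: a subring maximal among those containing [h^-1] but not [h] is a
   valuation ring. *)
Section MaximalAvoiding.
Variables (A : K -> Prop) (h : K).
Hypotheses (sA : is_subring A) (AVh : A h^-1) (nAh : ~ A h).
Hypothesis maxA : forall z, ~ A z -> adjoin A z h.

Let nzh : h != 0.
Proof. by apply/eqP => h0; apply: nAh; rewrite h0; exact: subr_0. Qed.

(** Otherwise maximality writes [h] as a polynomial in the inverse of s = 1 - h^-1 b. Clearing
    denominators puts h s^n in [A], and s^n is 1 modulo h^-1 A, so [h] itself would be in [A]. Thus
    h^-1 lies in the Jacobson radical. *)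
Lemma avoiding_unit b : A b -> A (1 - h^-1 * b)^-1.
Proof.
move=> Ab; set s := 1 - _; have As : A s by apply: subr_B => //; [exact: subr_1|exact: subr_M].
have [s0|nzs] := eqVneq s 0; first by rewrite s0 invr0; exact: subr_0.
apply: contrapT => /maxA[p [Ap hE]].
have powE r : exists2 c, A c & s ^+ r = 1 - h^-1 * c.
  elim: r => [|r [c Ac IH]]; first by exists 0; [exact: subr_0|rewrite mulr0 subr0].
  exists (c + b - h^-1 * b * c); last by rewrite exprS IH /s; ring.
  by apply: subr_B => //; [exact: subr_D|do !apply: subr_M].
have : A (h * s ^+ (size p)).
  rewrite {1}hE horner_coef mulr_suml; apply: subr_sum => // i _.
  rewrite -mulrA; apply: subr_M => //.
  have -> : s ^+ size p = s ^+ i * s ^+ (size p - i) by rewrite -exprD subnKC // ltnW.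
  by rewrite exprVn mulKf ?expf_neq0 //; exact: subr_X.
have [c Ac ->] := powE (size p); rewrite mulrBr mulr1 mulrA divff // mul1r => Ahc.
by apply: nAh; rewrite -[h](subrK c); apply: subr_D.
Qed.

(** The constant term of [r] yields the unit 1 - h^-1 r_0. Multiplied by a power of z, the relation
    in z^-1 therefore expresses z^(n+1) through lower powers of z with coefficients in [A], which
    removes the leading term of [p]. *)
Lemma avoiding_reduce z (p r : {poly K}) : z != 0 ->
  (forall i, A p`_i) -> (forall i, A r`_i) -> h = p.[z] -> h = r.[z^-1] ->
  (size r <= size p)%N -> exists p1 : {poly K},
   [/\ forall i, A p1`_i, h = p1.[z] & (size p1 < size p)%N].
Proof.
move=> nzz Ap Ar hp hr rp.
have szp : (1 < size p)%N.
  rewrite ltnNge; apply/negP => /size1_polyC pE.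
  by apply: nAh; rewrite hp pE hornerC.
case def_n: (size p) szp => [|[|n]] // _.
pose e := (1 - h^-1 * r`_0)^-1.
have Ae : A e by apply: avoiding_unit.
have nz1 : 1 - h^-1 * r`_0 != 0.
  rewrite subr_eq0; apply/eqP => E; apply: nAh; move: (Ar 0%N).
  by rewrite -[r`_0]mul1r -(divff nzh) -mulrA -E mulr1.
have key : z ^+ n.+1 = \sum_(j < n.+1) (h^-1 * e * r`_(n.+1 - j)) * z ^+ j.
  have : h * (1 - h^-1 * r`_0) = \sum_(j < n.+1) r`_j.+1 * z^-1 ^+ j.+1.
    rewrite mulrBr mulr1 mulrA divff // mul1r {1}hr (@horner_coef_wide _ n.+2); last first.
      by rewrite -def_n.
    by rewrite big_ord_recl /= expr0 mulr1 addrC addKr.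
  move=> E; have -> : z ^+ n.+1 = h^-1 * e * (z ^+ n.+1 * (h * (1 - h^-1 * r`_0))).
    rewrite /e; rewrite [z ^+ _ * _]mulrC mulrA -!mulrA [_^-1 * (h * _)]mulrCA !mulrA mulVf //
      mul1r.
    by rewrite mulVf // mul1r.
  rewrite {}E mulr_sumr mulr_sumr (reindex_inj rev_ord_inj) /=; apply: eq_bigr => j _.
  have jn : (j <= n)%N by rewrite -ltnS.
  rewrite subSS -subSn //.
  have -> : z ^+ n.+1 = z ^+ j * z ^+ (n.+1 - j) by rewrite -exprD subnKC // leqW.
  rewrite exprVn -!mulrA; congr (_ * (_ * _)).
  by rewrite [X in _ * X]mulrCA divff ?expf_neq0 // mulr1 mulrC.
pose p1 := \poly_(j < n.+1) (p`_j + p`_n.+1 * (h^-1 * e * r`_(n.+1 - j))).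
exists p1; split; last by rewrite ltnS; exact: size_poly.
  move=> i; rewrite coef_poly; case: ifP => _; last exact: subr_0.
  by apply: subr_D => //; do !apply: subr_M.
rewrite hp horner_coef def_n big_ord_recr /= key mulr_sumr -big_split /=.
rewrite (@horner_coef_wide _ n.+1); last exact: size_poly.
by apply: eq_bigr => j _; rewrite coef_poly ltn_ord mulrDl !mulrA.
Qed.

(** If z and z^-1 were both outside [A], then [h] would be a polynomial in each. The longer of the
    two can always be shortened: an infinite descent on the total size. *)
Lemma avoiding_valuation : is_valuation_ring A.
Proof.
split=> // z; apply: contrapT => /not_orP[nAz nAVz].
have nzz : z != 0 by apply/eqP => z0; apply: nAz; rewrite z0; exact: subr_0.
suff: forall n (p r : {poly K}), (size p + size r < n)%N ->
   (forall i, A p`_i) -> (forall i, A r`_i) -> h = p.[z] -> h = r.[z^-1] -> False.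
  have [p [Ap hp]] := maxA nAz; have [r [Ar hr]] := maxA nAVz.
  by move/(_ _ p r (ltnSn _)); apply.
elim=> // n IH p r; rewrite ltnS => szpr Ap Ar hp hr.
have [rp|/ltnW pr] := leqP (size r) (size p).
  have [p1 [Ap1 hp1 szp1]] := avoiding_reduce nzz Ap Ar hp hr rp.
  apply: (IH p1 r) => //; lia.
have [||r1 [Ar1 hr1 szr1]] := avoiding_reduce _ Ar Ap hr _ pr; rewrite ?invrK ?invr_eq0 //.
apply: (IH p r1) => //; lia.
Qed.

End MaximalAvoiding.

(** For nonzero [h], membership in R[h^-1] is an integral equation in disguise, so this is the
    statement that a non-integral element is missed by some valuation ring. *)
Theorem valuation_ring_avoiding R h : is_subring R -> ~ adjoin R h^-1 h ->
  exists A, [/\ is_valuation_ring A, forall z, R z -> A z & ~ A h].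
Proof.
move=> sR nRh.
pose good (A : set K) := [/\ is_subring A, forall z, adjoin R h^-1 z -> A z & ~ A h].
pose P (A : set K) := good A \/ A = set0%classic.
have [F FP totF|A [PA maxA]] := @Zorn_bigcup K P.
  have [[B FB gB]|noB] := pselect (exists2 B, F B & good B); last first.
    right; apply/seteqP; split=> // z [B FB Bz].
    have [gB|B0] := FP B FB; last by rewrite B0 in Bz.
    by case: noB; exists B.
  left; have gd C z : F C -> C z -> good C.
    by move=> FC Cz; case: (FP C FC) => // C0; rewrite C0 in Cz.
  have op (f : K -> K -> K) : (forall C, good C -> forall s t, C s -> C t -> C (f s t)) ->
      forall s t, (\bigcup_(X in F) X)%classic s -> (\bigcup_(X in F) X)%classic t ->
      (\bigcup_(X in F) X)%classic (f s t).
    move=> fP s t [C FC Cs] [D FD Dt].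
    have [CD|DC] := totF C D FC FD.
      by exists D => //; apply: fP => //; [exact: gd Dt|exact: CD].
    by exists C => //; apply: fP => //; [exact: gd Cs|exact: DC].
  case: (gB) => sB RB nBh; split.
  - split; first by exists B => //; exact: subr_1.
    + exact: (op (fun s t => s - t) (fun C '(And3 sC _ _) => @subr_B C sC)).
    + exact: (op (fun s t => s * t) (fun C '(And3 sC _ _) => @subr_M C sC)).
  - by move=> z Rz; exists B => //; exact: RB.
  - by move=> [C FC Ch]; have [_ _ /(_ Ch)] := gd C h FC Ch.
have gA : good A.
  case: PA => // A0; case: (maxA (adjoin R h^-1)).
    rewrite A0; split; first by move=> z [].
    by move=> /(_ 1 (sub_adjoin sR _ (subr_1 sR))) [].
  by left; split=> //; exact: adjoin_subring.
case: gA => sA RA nAh; exists A; split=> //; last by move=> z Rz; exact/RA/sub_adjoin.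
apply: (@avoiding_valuation A h) => //; first exact/RA/mem_adjoin.
move=> z nAz; apply: contrapT => nAzh; apply: (maxA (adjoin A z)); last first.
  by left; split=> //; [exact: adjoin_subring|move=> w /RA; exact: sub_adjoin].
split; first by move=> s As; exact: sub_adjoin.
by move=> /(_ z) H; apply/nAz/H/mem_adjoin.
Qed.

End ValuationRings.

(** * Places from valuation rings *)

Section ValuationRingTheory.
Variables (K : fieldType) (A : K -> Prop).
Hypothesis vA : is_valuation_ring A.
Let sA : is_subring A := proj1 vA.

(** The nonunits. Zero is listed apart because its inverse is 0, an element of [A]; membership in
    [A] follows from the valuation property. *)
Definition max_ideal z := z = 0 \/ ~ A z^-1.

Lemma max_ideal_mem z : max_ideal z -> A z.
Proof. by case=> [->|]; [exact: subr_0|case: (proj2 vA z)]. Qed.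

Lemma max_ideal0 : max_ideal 0. Proof. by left. Qed.

Lemma max_ideal1 : ~ max_ideal 1.
Proof. by case=> [/eqP|]; rewrite ?oner_eq0 // invr1; apply; exact: subr_1. Qed.

Lemma not_max_ideal z : ~ max_ideal z -> z != 0 /\ A z^-1.
Proof.
by move=> /not_orP[/eqP nz /contrapT AVz].
Qed.

Lemma max_idealMl s t : A s -> max_ideal t -> max_ideal (s * t).
Proof.
move=> As [->|nAVt]; first by left; rewrite mulr0.
have [->|nzs] := eqVneq s 0; first by left; rewrite mul0r.
right; apply: contra_not nAVt => AV.
by rewrite -[t^-1](mulVKf nzs) -invfM; exact: subr_M.
Qed.

Lemma max_idealMr s t : max_ideal s -> A t -> max_ideal (s * t).
Proof. by move=> ms At; rewrite mulrC; exact: max_idealMl. Qed.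

Lemma max_idealN s : max_ideal s -> max_ideal (- s).
Proof. by case=> [->|nA]; [left; rewrite oppr0|right; rewrite invrN => /(subr_N sA);
  rewrite opprK]. Qed.

Lemma max_idealD s t : max_ideal s -> max_ideal t -> max_ideal (s + t).
Proof.
wlog Ats : s t / A (t / s) => [wl|] ms mt.
  have [|] := proj2 vA (t / s) => [H|]; first exact: wl.
  by rewrite invf_div addrC => H; exact: wl.
have [s0|nzs] := eqVneq s 0; first by rewrite s0 add0r.
suff -> : s + t = (1 + t / s) * s.
  by apply: max_idealMl => //; apply: subr_D => //; exact: subr_1.
by rewrite mulrDl mul1r divfK.
Qed.

Lemma max_idealB s t : max_ideal s -> max_ideal t -> max_ideal (s - t).
Proof. by move=> ms /max_idealN; exact: max_idealD. Qed.

Lemma valuation_ring_pow z n : (0 < n)%N -> A (z ^+ n) -> A z.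
Proof.
case: n => // n _ Azn; have [//|AVz] := proj2 vA z.
have [->|nzz] := eqVneq z 0; first exact: subr_0.
suff -> : z = z ^+ n.+1 * z^-1 ^+ n by apply: subr_M => //; exact: subr_X.
by rewrite exprVn exprS mulfK // expf_neq0.
Qed.

Lemma max_ideal_prime s t : A s -> A t -> max_ideal (s * t) -> max_ideal s \/ max_ideal t.
Proof.
move=> As At mst; apply: contrapT => /not_orP[/not_max_ideal[nzs AVs] /not_max_ideal[nzt AVt]].
apply: max_ideal1; suff -> : 1 = s^-1 * t^-1 * (s * t).
  by apply: max_idealMl => //; exact: subr_M.
by rewrite mulrACA !mulVf // mul1r.
Qed.

Lemma max_ideal_pow z n : A z -> max_ideal (z ^+ n) -> max_ideal z.
Proof.
move=> Az; elim: n => [/max_ideal1//|n IH]; rewrite exprS => /max_ideal_prime[] //.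
exact: subr_X.
Qed.

(** Equality of values without a value group. As division by 0 gives 0, [same_val 0 t] holds for
    every [t], whence the nonvanishing conditions that accompany this relation. *)
Definition same_val s t := A (s / t) /\ A (t / s).

Lemma same_val_sym s t : same_val s t -> same_val t s. Proof. by case. Qed.

Lemma same_val_refl s : same_val s s.
Proof.
by rewrite /same_val; have [->|nz] := eqVneq s 0;
  rewrite ?mul0r ?divff //; split; by [exact: subr_0|exact: subr_1].
Qed.

Lemma same_val_trans s t r : t != 0 -> same_val s t -> same_val t r -> same_val s r.
Proof.
move=> nzt [Ast Ats] [Atr Art]; split.
  by rewrite -[s](divfK nzt) -mulrA; exact: subr_M.
by rewrite -[r](divfK nzt) -mulrA; exact: subr_M.
Qed.

Lemma same_valM s t s' t' : same_val s t -> same_val s' t' -> same_val (s * s') (t * t').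
Proof. by case=> ? ? [? ?]; split; rewrite invfM mulrACA; exact: subr_M. Qed.

Lemma same_valV s t : same_val s t -> same_val s^-1 t^-1.
Proof. by case=> ? ?; split; rewrite invrK mulrC. Qed.

Lemma same_val1 s : s != 0 -> A s -> ~ max_ideal s -> same_val s 1.
Proof. by move=> nz As /not_max_ideal[_ AV]; split; rewrite ?divr1 ?mul1r. Qed.

Lemma same_val_add s t : s != 0 -> max_ideal (t / s) -> s + t != 0 /\ same_val (s + t) s.
Proof.
move=> nzs mts; have E : s + t = (1 + t / s) * s by rewrite mulrDl mul1r divfK.
have nm : ~ max_ideal (1 + t / s).
  by move=> /max_idealB/(_ mts); rewrite addrK; exact: max_ideal1.
have [nz AV] := not_max_ideal nm.
have A1 : A (1 + t / s) by apply: subr_D => //; [exact: subr_1|exact: max_ideal_mem].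
split; first by rewrite E mulf_neq0.
rewrite {1}E -[X in same_val _ X]mul1r; apply: same_valM (same_val_refl s).
exact: same_val1.
Qed.

Lemma val_trichotomy s t : s != 0 -> t != 0 ->
  [\/ same_val s t, max_ideal (s / t) | max_ideal (t / s)].
Proof.
move=> nzs nzt; have [mst|nst] := pselect (max_ideal (s / t)); first by apply: Or32.
have [mts|nts] := pselect (max_ideal (t / s)); first by apply: Or33.
apply: Or31; have [_] := not_max_ideal nst; have [_] := not_max_ideal nts.
by rewrite !invf_div.
Qed.

(** Terms of pairwise distinct values cannot cancel, since the sum takes the value of one of them.
    The filter [P] serves to discard zero terms, which have no value. *)
Lemma sum_distinct_val n (P : pred nat) (z : nat -> K) :
  (forall j, (j < n)%N -> P j -> z j != 0) ->
  (forall j k, (j < k < n)%N -> P j -> P k -> ~ same_val (z j) (z k)) ->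
  forall j, (j < n)%N -> P j ->
  \sum_(0 <= j < n | P j) z j != 0 /\
  exists2 j0, (j0 < n)%N && P j0 & same_val (\sum_(0 <= j < n | P j) z j) (z j0).
Proof.
elim: n => // n IH nz ds j jn Pj.
have nz' k : (k < n)%N -> P k -> z k != 0 by move=> kn; apply: nz; exact: ltnW.
have ds' k l : (k < l < n)%N -> P k -> P l -> ~ same_val (z k) (z l).
  by move=> /andP[kl ln]; apply: ds; rewrite kl ltnW.
pose S := \sum_(0 <= j < n | P j) z j.
have -> : \sum_(0 <= j < n.+1 | P j) z j = if P n then S + z n else S.
  by rewrite big_mkcond big_nat_recr //= -big_mkcond; case: ifP => // _; rewrite addr0.
case: ifPn => [Pn|nPn]; last first.
  have jn' : (j < n)%N.
    by rewrite ltn_neqAle -ltnS jn andbT; apply: contraNneq nPn => <-.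
  have [nzS [k /andP[kn Pk] sk]] := IH nz' ds' j jn' Pj.
  by split=> //; exists k => //; rewrite ltnW.
have [[k /andP[kn Pk]]|none] := pselect (exists k, (k < n)%N && P k); last first.
  have -> : S = 0.
    rewrite /S big_nat_cond big_pred0 // => k.
    by apply/negP => /andP[/andP[_ kn] Pk]; apply: none; exists k; rewrite kn Pk.
  rewrite add0r; split; first exact: nz.
  by exists n; [rewrite ltnSn|exact: same_val_refl].
have {IH}[nzS [l /andP[ln Pl] sl]] := IH nz' ds' k kn Pk.
have nzn : z n != 0 by apply: nz.
have [s1|m1|m1] := val_trichotomy nzS nzn.
- have sln : same_val (z l) (z n) by apply: same_val_trans nzS _ s1; exact: same_val_sym.
  by case: (ds l n) => //; rewrite ln ltnSn.
- have [] := same_val_add nzn m1; rewrite addrC => ? ?; split=> //.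
  by exists n => //; rewrite ltnSn.
- have [? s2] := same_val_add nzS m1; split=> //.
  by exists l; [rewrite ltnW|exact: same_val_trans nzS s2 sl].
Qed.

Lemma max_idealX z n : max_ideal z -> (0 < n)%N -> max_ideal (z ^+ n).
Proof.
case: n => // n mz _; rewrite exprS; apply: max_idealMr => //.
exact/(subr_X sA)/max_ideal_mem.
Qed.

Section Constants.
Variables (F : fieldType) (emb : {rmorphism F -> K}).
Hypothesis AF : forall c, A (emb c).

Lemma valuation_ring_horner p u : A u -> A (map_poly emb p).[u].
Proof.
move=> Au; rewrite horner_coef; apply: subr_sum => // j _; rewrite coef_map /=.
by apply: subr_M => //; exact: subr_X.
Qed.

Lemma horner_congr p u c : A u -> max_ideal (u - emb c) ->
  max_ideal ((map_poly emb p).[u] - emb p.[c]).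
Proof.
move=> Au muc; have /factor_theorem[r pE] : root (p - p.[c]%:P) c.
  by rewrite /root hornerD hornerN hornerC subrr.
have -> : (map_poly emb p).[u] - emb p.[c] = (map_poly emb r).[u] * (u - emb c).
  transitivity (map_poly emb (p - p.[c]%:P)).[u].
    by rewrite rmorphB /= map_polyC hornerD hornerN hornerC.
  by rewrite pE rmorphM rmorphB /= map_polyX map_polyC hornerM hornerXsubC.
by apply: max_idealMl => //; exact: valuation_ring_horner.
Qed.

Lemma const_max_ideal c : max_ideal (emb c) -> c = 0.
Proof.
move=> mc; apply/eqP; apply: contra_notT max_ideal1 => nzc.
by rewrite -(divff (_ : emb c != 0)) ?fmorph_eq0 // -fmorphV; exact: max_idealMr.
Qed.

(** After the exact power of X is split off from [p], the cofactor has a nonzero constant term and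
    becomes a unit at [u]. *)
Lemma horner_max_ideal p u : u != 0 -> max_ideal u -> p != 0 ->
  exists k, same_val (map_poly emb p).[u] (u ^+ k) /\ (map_poly emb p).[u] != 0.
Proof.
move=> nzu mu nzp; have Au := max_ideal_mem mu.
have [k [r /implyP/(_ nzp) nr ->]] := multiplicity_XsubC p 0.
rewrite rmorphM rmorphXn /= rmorphB /= map_polyX map_polyC /= rmorph0 subr0.
rewrite hornerM hornerXn; exists k.
have nm : ~ max_ideal (map_poly emb r).[u].
  have := @horner_congr r u 0 Au; rewrite rmorph0 subr0 => /(_ mu) mr mr'.
  have : max_ideal (emb r.[0]).
    by rewrite -[emb _](subKr (map_poly emb r).[u]); exact: max_idealB.
  by move=> /const_max_ideal r0; move: nr; rewrite /root r0 eqxx.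
have [nz _] := not_max_ideal nm.
split; last by rewrite mulf_neq0 // expf_neq0.
rewrite -[X in same_val _ X]mul1r; apply: same_valM; last exact: same_val_refl.
by apply: same_val1 => //; exact: valuation_ring_horner.
Qed.

End Constants.
End ValuationRingTheory.

(** * Discreteness of valuation rings in extensions of transcendence degree one *)

Section Discreteness.
Variables (F L : fieldType) (emb : {rmorphism F -> L}).

(* [L] has finite degree over [F(u)]: any [n] elements are dependent over [F[u]]. *)
Definition finite_over (u : L) := exists n, forall z : nat -> L, exists c : nat -> {poly F},
  (exists2 j, (j < n)%N & c j != 0) /\ \sum_(0 <= j < n) (map_poly emb (c j)).[u] * z j = 0.

Variables (A : L -> Prop) (h : L).
Hypotheses (vA : is_valuation_ring A) (AF : forall c, A (emb c)) (nAh : ~ A h).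
Hypothesis finL : forall u, finite_over u.
Let sA : is_subring A := proj1 vA.
Local Notation max := (max_ideal A).
Local Notation sv := (same_val A).

(** Without a least positive value there is a sequence [Z] of elements of strictly decreasing
    positive values, all below the value of u = h^-1. Polynomials in u have the values of powers of
    u, so the terms c_k(u) Z_k have distinct values and cannot satisfy a linear relation, against
    finite degree over F(u). *)
Lemma exists_uniformizer : exists t, [/\ t != 0, max t & forall z, max z -> A (z / t)].
Proof.
apply: contrapT => none.
pose u := h^-1.
have nzh : h != 0 by apply/eqP => h0; apply: nAh; rewrite h0; exact: subr_0.
have nzu : u != 0 by rewrite invr_eq0.
have mu : max u by right; rewrite invrK.
have /choice[g gP] : forall t, exists z, t != 0 -> max t ->
    [/\ z != 0, max z & max (t / z)].
  move=> t; have [[nzt mt]|nt] := pselect (t != 0 /\ max t); last first.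
    by exists 0 => ? ?; case: nt.
  apply: contrapT => noz; apply: none; exists t; split=> // z mz.
  apply: contrapT => nAzt; apply: noz; exists z => _ _; split=> //.
    by apply/eqP => z0; apply: nAzt; rewrite z0 mul0r; exact: subr_0.
  by right; rewrite invf_div.
pose Z j := iter j g u.
have ZP j : Z j != 0 /\ max (Z j).
  by elim: j => [//|j [nz m]]; have [] := gP _ nz m.
have Zlt j k : (j < k)%N -> max (Z j / Z k).
  elim: k => // k IH; rewrite ltnS leq_eqVlt => /predU1P[->|/IH mjk].
    by have [nz m] := ZP k; have [] := gP _ nz m.
  have [nz m] := ZP k; have [nz' m' mk] := gP _ nz m.
  rewrite -[Z j](divfK nz) -mulrA; apply: max_idealMl => //.
  exact: max_ideal_mem.
have [n /(_ (fun j => Z j.+1))[c [[j jn nzcj] sum0]]] := finL u.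
have cP k : c k != 0 -> exists e, sv ((map_poly emb (c k)).[u]) (u ^+ e) /\
    (map_poly emb (c k)).[u] != 0 by exact: (@horner_max_ideal _ _ vA _ emb).
have := @sum_distinct_val _ _ vA n (fun k => c k != 0)
  (fun k => (map_poly emb (c k)).[u] * Z k.+1) _ _ j jn nzcj.
case.
- move=> k kn /cP[e [_ nz]]; apply: mulf_neq0 => //; exact: (proj1 (ZP _)).
- move=> k l /andP[kl ln] /cP[e [sk nzk]] /cP[f [sl nzl]] skl.
  have [nZk mZk] := ZP k.+1; have [nZl mZl] := ZP l.+1.
  have {sk sl} : sv (u ^+ e * Z k.+1) (u ^+ f * Z l.+1).
    apply: (@same_val_trans _ _ vA _ ((map_poly emb (c k)).[u] * Z k.+1)).
    - exact: mulf_neq0.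
    - by apply: same_valM => //; [exact: same_val_sym|exact: same_val_refl].
    apply: (same_val_trans vA _ skl); first exact: mulf_neq0.
    by apply: same_valM => //; exact: same_val_refl.
  have [fe|ef] := leqP f e.
    have m1 : max (u ^+ e * Z k.+1 / (u ^+ f * Z l.+1)).
      rewrite invfM mulrACA; apply: max_idealMl => //; last exact: Zlt.
      rewrite -(subnK fe) exprD mulfK ?expf_neq0 //.
      exact/(subr_X sA)/(max_ideal_mem vA).
    case=> _; case: m1 => [/eqP|]; last by rewrite invf_div.
    by rewrite !mulf_eq0 !invr_eq0 !mulf_eq0 !expf_eq0 (negPf nzu) (negPf nZk) (negPf nZl) !andbF.
  have m1 : max (u ^+ f * Z l.+1 / (u ^+ e * Z k.+1)).
    have -> : u ^+ f * Z l.+1 / (u ^+ e * Z k.+1) = u ^+ (f - e).-1 * (u / Z k.+1) * Z l.+1.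
      have -> : u ^+ f = u ^+ (f - e).-1 * u * u ^+ e.
        by rewrite -exprSr -exprD; congr (_ ^+ _); lia.
      by field; rewrite nZk expf_neq0.
    apply: max_idealMl => //; apply: subr_M => //; first exact/(subr_X sA)/(max_ideal_mem vA).
    exact: (max_ideal_mem vA (Zlt 0%N _ _)).
  case=> + _; case: m1 => [/eqP|]; last by rewrite invf_div.
  by rewrite !mulf_eq0 !invr_eq0 !mulf_eq0 !expf_eq0 (negPf nzu) (negPf nZk) (negPf nZl) !andbF.
move=> + _; apply/negP; rewrite negbK big_mkcond -[X in _ == X]sum0; apply/eqP.
by apply: eq_bigr => k _; case: eqP => [->|//]; rewrite rmorph0 horner0 mul0r.
Qed.

(** The value of z is the exponent n for which z and t^n differ by a unit, t being a uniformizer. *)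
Theorem valuation_ring_place : exists w : L -> int, is_place emb w /\
  forall z, z != 0 -> (A z <-> 0 <= w z).
Proof.
have [t [nzt mt tmin]] := exists_uniformizer.
have At := max_ideal_mem vA mt.
have nAVt : ~ A t^-1 by case: mt => // t0; rewrite t0 eqxx in nzt.
(* Take a relation sum c_j(t) z^j = 0. Its lowest nonzero coefficient c_k(t) is divisible by z and
   has the value of a power of t, so z is not divisible by all powers of t. *)
have arch z : z != 0 -> A z -> exists k, ~ A (z / t ^+ k).
  move=> nzz Az; have [n /(_ (fun j => z ^+ j))[c [[j jn nzcj] sum0]]] := finL t.
  have ex : exists j, (j < n)%N && (c j != 0) by exists j; rewrite jn.
  case: (ex_minnP ex) => k /andP[kn nzck] kmin {j jn nzcj ex}.
  have [e [[Ae _] _]] := @horner_max_ideal _ _ vA _ emb AF _ _ nzt mt nzck.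
  have [e' [[_ Ae'] _]] := @horner_max_ideal _ _ vA _ emb AF _ _ nzt mt nzck.
  exists e'.+1 => Azt; apply: nAVt.
  have : A (t ^+ e' / z).
    have -> : t ^+ e' / z = t ^+ e' / (map_poly emb (c k)).[t] *
        - \sum_(k.+1 <= j < n) (map_poly emb (c j)).[t] * z ^+ (j - k.+1).
      have [_ [_ nzc]] := @horner_max_ideal _ _ vA _ emb AF _ _ nzt mt nzck.
      have -> : - \sum_(k.+1 <= j < n) (map_poly emb (c j)).[t] * z ^+ (j - k.+1) =
          (map_poly emb (c k)).[t] / z.
        apply/eqP; rewrite eq_sym -addr_eq0.
        rewrite -(mulrI_eq0 _ (@mulfI _ (z ^+ k.+1) _)) ?expf_neq0 //.
        rewrite -[X in _ == X]sum0 (big_cat_nat (leq0n k) (ltnW kn)) /=.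
        have -> : \sum_(0 <= j < k) (map_poly emb (c j)).[t] * z ^+ j = 0.
          rewrite big_nat big1 // => j /andP[_ jk]; have [->|nz] := eqVneq (c j) 0.
            by rewrite rmorph0 horner0 mul0r.
          have := kmin j; rewrite (ltn_trans jk kn) nz => /(_ isT).
          by rewrite leqNgt jk.
        rewrite add0r.
        rewrite (big_ltn kn) mulrDr mulr_sumr; apply/eqP; congr (_ + _).
          by rewrite exprS; field.
        rewrite !big_nat; apply: eq_bigr => j /andP[kj _].
        by rewrite mulrCA -exprD subnKC.
      by field; rewrite nzz nzc.
    apply: subr_M => //; apply: subr_N => //; apply: subr_sum => // j _.
    by apply: subr_M; [|exact: valuation_ring_horner|exact: subr_X].
  move=> /(subr_M sA)/(_ Azt).
  suff -> : t ^+ e' / z * (z / t ^+ e'.+1) = t^-1 by [].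
  by rewrite exprS; field; rewrite nzt nzz expf_neq0.
have ordA z : z != 0 -> A z -> exists k : nat, sv z (t ^+ k).
  move=> nzz Az; case: (ex_minnP (P := fun k => ~~ `[< A (z / t ^+ k) >])).
    by have [k nk] := arch z nzz Az; exists k; apply/asboolPn.
  case=> [|k]; first by rewrite divr1 => /asboolPn.
  move=> /asboolPn nAk kmin; exists k.
  have Ak : A (z / t ^+ k).
    by apply: contrapT => /asboolPn/kmin; rewrite ltnn.
  split=> //; apply: contrapT => nA; apply: nAk.
  rewrite exprSr invfM mulrA; apply: tmin; right; by rewrite invf_div.
have /choice[w wP] : forall z, exists n : int, z != 0 -> sv z (t ^ n).
  move=> z; have [->|nzz] := eqVneq z 0; first by exists 0.
  have [Az|AVz] := proj2 vA z; first by have [k] := ordA z nzz Az; exists k%:Z.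
  have nzVz : z^-1 != 0 by rewrite invr_eq0.
  have [k sk] := ordA z^-1 nzVz AVz.
  by exists (- k%:Z) => _; rewrite -[z]invrK -exprnN; exact: same_valV.
have texp_ge0 (n : int) : A (t ^ n) -> 0 <= n.
  case: n => // n; rewrite NegzE => AtN; exfalso; apply: nAVt.
  have -> : t^-1 = t ^ (- n.+1%:Z) * t ^+ n.
    by rewrite -exprnN exprS invfM -mulrA mulVf ?mulr1 // expf_neq0.
  by apply: subr_M => //; exact: subr_X.
have nztn (n : int) : t ^ n != 0 by rewrite expfz_neq0.
have uniq n m : sv (t ^ n) (t ^ m) -> n = m.
  have divE a b : t ^ a / t ^ b = t ^ (a - b) by rewrite invr_expz -expfzDr.
  rewrite /same_val !divE => -[/texp_ge0 + /texp_ge0].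
  by rewrite !subr_ge0 => mn nm; apply/le_anti; rewrite mn nm.
have wM a b : a != 0 -> b != 0 -> w (a * b) = w a + w b.
  move=> nza nzb; apply: uniq; rewrite expfzDr //.
  apply: (same_val_trans vA (mulf_neq0 nza nzb)).
    by apply: same_val_sym; apply: wP; exact: mulf_neq0.
  by apply: same_valM => //; exact: wP.
have wA z : z != 0 -> (A z <-> 0 <= w z).
  move=> nzz; have [Azt Atz] := wP z nzz; split=> [Az|].
    by apply: texp_ge0; rewrite -(divfK nzz (t ^ w z)); exact: subr_M.
  case: (w z) Azt => // n Azt _.
  by rewrite -(divfK (nztn n) z); apply: subr_M => //; exact: subr_X.
exists w; split=> //; split=> //.
- move=> a b; wlog ab : a b / w a <= w b => [wl|] nza nzb nzab.
    have /orP[H|H] := le_total (w a) (w b); first exact: wl.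
    by rewrite minC addrC; apply: wl; rewrite // addrC.
  rewrite (min_idPl ab) -[a + b](divfK nza) wM ?mulf_neq0 ?invr_eq0 // lerDr.
  apply/wA; rewrite ?mulf_neq0 ?invr_eq0 // mulrDl divff //.
  apply: subr_D => //; first exact: subr_1.
  apply/wA; rewrite ?mulf_neq0 ?invr_eq0 //.
  by rewrite -(lerD2r (w a)) add0r -wM ?mulf_neq0 ?invr_eq0 // divfK.
- move=> c nzc; apply: uniq; rewrite expr0z.
  apply: (@same_val_trans _ _ vA _ (emb c)); rewrite ?fmorph_eq0 //.
    by apply: same_val_sym; apply: wP; rewrite fmorph_eq0.
  by split; rewrite ?divr1 ?mul1r -?fmorphV.
- exists t; split=> //; apply: uniq; rewrite expr1z.
  by apply: same_val_sym; apply: wP.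
Qed.

End Discreteness.

(** * The function field as a finite extension of F(x) *)

Lemma linear_dependence (F : fieldType) (I J : finType) (M : I -> J -> F) :
  (#|J| < #|I|)%N -> exists c : I -> F,
    (exists i, c i != 0) /\ forall j, \sum_i c i * M i j = 0.
Proof.
move=> JI; pose B := \matrix_(i < #|I|, j < #|J|) M (enum_val i) (enum_val j).
have : kermx B != 0.
  by rewrite kermx_eq0 -row_leq_rank -ltnNge (leq_ltn_trans (rank_leq_col B)).
move=> /rowV0Pn[v /sub_kermxP vB] /rV0Pn[k nzvk].
exists (fun i => v 0 (enum_rank i)); split.
  by exists (enum_val k); rewrite enum_valK.
move=> j; move/rowP: vB => /(_ (enum_rank j)); rewrite !mxE => vBj.
rewrite -[RHS]vBj (reindex_onto (@enum_val I predT) enum_rank); last first.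
  by move=> i _; exact: enum_rankK.
apply: eq_big => i; rewrite ?enum_valK ?eqxx // => _.
by rewrite mxE enum_rankK.
Qed.

Lemma size_mul_pred (F : fieldType) (p r : {poly F}) :
  (size (p * r)%R <= (size p + size r).-1)%N.
Proof. exact: size_polyMleq. Qed.

Section FunctionField.
Variables (q : nat) (F : fieldType) (L : fieldType) (emb : {rmorphism F -> L}) (x y : L).
Local Notation m := (m_of q).

Definition eval_at (p : {poly F}) : L := (map_poly emb p).[x].
Local Notation at_x := eval_at.
HB.instance Definition _ := GRing.RMorphism.copy eval_at (horner_eval x \o map_poly emb).

Lemma at_xC c : at_x c%:P = emb c. Proof. by rewrite /eval_at map_polyC hornerC. Qed.
Lemma at_xX : at_x 'X = x. Proof. by rewrite /eval_at map_polyX hornerX. Qed.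
Lemma at_xXn n : at_x 'X^n = x ^+ n. Proof. by rewrite rmorphXn /= at_xX. Qed.

Hypothesis q3 : (q %% 3 = 2)%N.
Hypothesis HX : is_function_field_X3 emb q x y.

Lemma m_of3 : q.+1 = (3 * m)%N.
Proof. by rewrite /m_of; lia. Qed.

Lemma m_of_gt0 : (0 < m)%N.
Proof. by rewrite /m_of; lia. Qed.

Lemma at_x_eq0 p : (at_x p == 0) = (p == 0).
Proof.
apply/idP/eqP => [|->]; last by rewrite rmorph0.
by case: HX => _ tr _; apply: contraTeq => /tr.
Qed.

Lemma at_x_inj : injective at_x.
Proof. by move=> p r /eqP; rewrite -subr_eq0 -rmorphB at_x_eq0 subr_eq0 => /eqP. Qed.

Definition curve_poly : {poly F} := 'X^(2 * m) + 'X^m.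

Lemma y_exp : y ^+ q.+1 = - at_x curve_poly.
Proof.
case: HX => E _ _; rewrite rmorphD /= !at_xXn.
by apply/eqP; rewrite -addr_eq0 addrA E.
Qed.

Lemma size_curve_poly : (size curve_poly <= (2 * m).+1)%N.
Proof. by rewrite (leq_trans (size_polyD _ _)) // !size_polyXn geq_max leqnn /= ltnS; lia. Qed.

(** A filtration of F[x, y] by the degree in x, strictly below [D], with exponents of y reduced to
    at most q by the curve equation. Products raise [D] by a controlled amount, which makes counting
    of dimensions possible. *)
Definition y_bounded (D : nat) (z : L) := exists g : nat -> {poly F},
  (forall j, (size (g j) <= D)%N) /\ z = \sum_(0 <= j < q.+1) at_x (g j) * y ^+ j.

Lemma y_boundedW D E z : (D <= E)%N -> y_bounded D z -> y_bounded E z.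
Proof. by move=> DE [g [gD ->]]; exists g; split=> // j; exact: leq_trans (gD j) DE. Qed.

Lemma y_bounded0 D : y_bounded D 0.
Proof.
exists (fun=> 0); split=> [j|]; first by rewrite size_poly0.
by rewrite big1 // => j _; rewrite rmorph0 mul0r.
Qed.

Lemma y_boundedD D z w : y_bounded D z -> y_bounded D w -> y_bounded D (z + w).
Proof.
move=> [g [gD ->]] [f [fD ->]]; exists (fun j => g j + f j); split=> [j|].
  by rewrite (leq_trans (size_polyD _ _)) // geq_max gD fD.
by rewrite -big_split; apply: eq_bigr => j _; rewrite rmorphD mulrDl.
Qed.

Lemma y_bounded_sum D (f : nat -> L) n :
  (forall j, (j < n)%N -> y_bounded D (f j)) -> y_bounded D (\sum_(0 <= j < n) f j).
Proof.
elim: n => [|n IH] fD; first by rewrite big_geq //; exact: y_bounded0.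
rewrite big_nat_recr //=; apply: y_boundedD; last exact: fD.
by apply: IH => j jn; apply: fD; exact: leqW.
Qed.

Lemma y_bounded_at_x D (p : {poly F}) z : y_bounded D z -> y_bounded (D + (size p).-1) (at_x p * z).
Proof.
move=> [g [gD ->]]; exists (fun j => p * g j); split=> [j|].
  by rewrite (leq_trans (size_mul_pred _ _)) //; have := gD j; lia.
by rewrite mulr_sumr; apply: eq_bigr => j _; rewrite rmorphM mulrA.
Qed.

Lemma y_boundedMy D z : y_bounded D z -> y_bounded (D + 2 * m) (z * y).
Proof.
move=> [g [gD ->]].
exists (fun j => if j is j'.+1 then g j' else - (curve_poly * g q)); split=> [[|j]|].
- rewrite size_polyN (leq_trans (size_mul_pred _ _)) //.
  by have := gD q; have := size_curve_poly; lia.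
- by rewrite (leq_trans (gD _)) // leq_addr.
rewrite mulr_suml big_nat_recr //= [RHS]big_nat_recl //= addrC; congr (_ + _).
  by rewrite -mulrA -exprSr y_exp rmorphN rmorphM /= mulr1; ring.
by apply: eq_bigr => j _; rewrite -mulrA -exprSr.
Qed.

Lemma y_boundedMyX D z k : y_bounded D z -> y_bounded (D + 2 * m * k) (z * y ^+ k).
Proof.
move=> zD; elim: k => [|k IH]; first by rewrite muln0 addn0 mulr1.
by rewrite exprSr mulrA mulnSr addnA; exact: y_boundedMy.
Qed.

Lemma y_boundedM D E z w : y_bounded D z -> y_bounded E w ->
  y_bounded (D + E + 2 * m * q) (z * w).
Proof.
move=> zD [g [gE ->]]; rewrite mulr_sumr; apply: y_bounded_sum => j jq.
rewrite mulrCA mulrA -[at_x _ * _ * _]mulrA.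
have := y_bounded_at_x (g j) (y_boundedMyX j zD); rewrite mulrA.
by apply: y_boundedW; have := gE j; nia.
Qed.

Lemma y_bounded1 : y_bounded 1 1.
Proof.
exists (fun j => (j == 0%N)%:R); split=> [[|j]|]; rewrite ?size_poly1 ?size_poly0 //.
rewrite big_nat_recl //= big1 ?addr0 ?rmorph1 ?mulr1 // => j _.
by rewrite rmorph0 mul0r.
Qed.

Lemma y_bounded_pow D z k : y_bounded D z -> y_bounded (k * (D + 2 * m * q) + 1) (z ^+ k).
Proof.
move=> zD; elim: k => [|k IH]; first exact: y_bounded1.
by rewrite exprSr; apply: y_boundedW (y_boundedM IH zD); lia.
Qed.

Lemma eval2E p : eval2 emb p x y = (map_poly at_x p).[y]. Proof. by []. Qed.

Lemma eval2_bounded p : exists D, y_bounded D (eval2 emb p x y).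
Proof.
rewrite eval2E; elim/poly_ind: p => [|p c [D IH]].
  by exists 0%N; rewrite rmorph0 horner0; exact: y_bounded0.
exists (D + 2 * m + size c).+1.
rewrite rmorphD rmorphM /= map_polyX map_polyC /= hornerMXaddC; apply: y_boundedD.
  by apply: y_boundedW (y_boundedMy IH); lia.
by rewrite -[at_x c]mulr1; apply: y_boundedW (y_bounded_at_x c y_bounded1);
  rewrite add1n ltnS (leq_trans (leq_pred _)) ?leq_addl.
Qed.

Lemma field_of_fractions z :
  exists E D, [/\ E != 0, y_bounded D E & y_bounded D (E * z)].
Proof.
have [_ _ /(_ z)[A [B [nzB ->]]]] := HX.
have [a Aa] := eval2_bounded A; have [b Bb] := eval2_bounded B.
exists (eval2 emb B x y), (a + b)%N; split=> //; first by apply: y_boundedW Bb; exact: leq_addl.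
by rewrite mulrC divfK //; apply: y_boundedW Aa; exact: leq_addr.
Qed.

Lemma common_denominator (z : nat -> L) N :
  exists E D, [/\ E != 0, y_bounded D E & forall j, (j < N)%N -> y_bounded D (E * z j)].
Proof.
elim: N => [|N [E [D [nzE ED zD]]]].
  by exists 1, 1%N; split=> //; [exact: oner_neq0|exact: y_bounded1].
have [E' [D' [nzE' ED' zD']]] := field_of_fractions (z N).
exists (E * E'), (D + D' + 2 * m * q)%N; split; first exact: mulf_neq0.
  exact: y_boundedM.
move=> j; rewrite ltnS leq_eqVlt => /predU1P[->|jN].
  by rewrite -mulrA; exact: y_boundedM.
by rewrite mulrAC; apply: y_boundedM; [exact: zD|].
Qed.

(** A Siegel-type count. The (M+1) N elements U u^k z_i lie in a space of dimension (q+1)(M c + c');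
    with M = (q+1) c' this is M (q+1) c + M, less than (M+1) N as soon as N exceeds (q+1) c. *)
Lemma bounded_dependence u c N (z : nat -> L) : (q.+1 * c < N)%N ->
  (exists c', forall M, exists U, U != 0 /\ forall k i, (k <= M)%N -> (i < N)%N ->
     y_bounded (M * c + c') (U * u ^+ k * z i)) ->
  exists d : nat -> {poly F}, (exists2 j, (j < N)%N & d j != 0) /\
    \sum_(0 <= j < N) (map_poly emb (d j)).[u] * z j = 0.
Proof.
move=> cN [c' H]; have [U [nzU zU]] := H (q.+1 * c')%N.
set M := (q.+1 * c')%N in zU; set D := (M * c + c')%N in zU.
have /choice[g gP] : forall ki : 'I_M.+1 * 'I_N, exists g : nat -> {poly F},
    (forall j, (size (g j) <= D)%N) /\
    U * u ^+ ki.1 * z ki.2 = \sum_(0 <= j < q.+1) at_x (g j) * y ^+ j.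
  by move=> [k i]; apply: zU; [exact: (ltn_ord k)|exact: ltn_ord].
pose W (ki : 'I_M.+1 * 'I_N) (jd : 'I_q.+1 * 'I_D) : F := (g ki jd.1)`_jd.2.
have IJ : (#|{: 'I_q.+1 * 'I_D}| < #|{: 'I_M.+1 * 'I_N}|)%N.
  rewrite !card_prod !card_ord.
  have -> : (q.+1 * D = M * (q.+1 * c) + M)%N by rewrite /D mulnDr mulnCA.
  apply: leq_trans (_ : M.+1 * (q.+1 * c).+1 <= _)%N; last by rewrite leq_mul2l cN.
  move: (q.+1 * c)%N M {zU D g gP W} => e M; rewrite mulSn mulnS; lia.
have [v [[[k0 i0] nzv] vP]] := linear_dependence W IJ.
pose d j := \poly_(k < M.+1)
   (if insub k is Some k' then if insub j is Some j' then v (k', j') else 0 else 0 : F).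
have dE (k : 'I_M.+1) (i : 'I_N) : (d i)`_k = v (k, i).
  by rewrite /d coef_poly ltn_ord !valK.
exists d; split.
  exists i0 => //; apply: contraNneq nzv => d0.
  by rewrite -(dE k0 i0) d0 coef0.
apply: (mulfI nzU); rewrite mulr0.
transitivity (\sum_(ki : 'I_M.+1 * 'I_N) emb (v ki) * (U * u ^+ ki.1 * z ki.2)).
  transitivity (\sum_(k < M.+1) \sum_(i < N) emb (v (k, i)) * (U * u ^+ k * z i)); last first.
    by rewrite pair_bigA; apply: eq_bigr => -[k i] _.
  rewrite big_mkord mulr_sumr exchange_big /=; apply: eq_bigr => i _.
  rewrite (@horner_coef_wide _ M.+1); last first.
    by rewrite size_map_poly; exact: size_poly.
  rewrite mulr_suml mulr_sumr; apply: eq_bigr => k _.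
  by rewrite coef_map /= dE; ring.
under eq_bigr => ki _ do rewrite (proj2 (gP ki)) big_mkord mulr_sumr.
rewrite exchange_big /= big1 // => j _.
under eq_bigr => ki _ do rewrite mulrA -at_xC -rmorphM.
rewrite -mulr_suml -rmorph_sum /=.
suff -> : \sum_ki (v ki)%:P * g ki j = 0 by rewrite rmorph0 mul0r.
apply/polyP => e; rewrite coef0 coef_sum.
under eq_bigr => ki _ do rewrite coefCM.
have [eD|De] := ltnP e D; first exact: (vP (j, Ordinal eD)).
by rewrite big1 // => ki _; rewrite nth_default ?mulr0 // (leq_trans (proj1 (gP ki) _)).
Qed.

(** A^M clears the denominators of all u^k with k <= M, as A^(M-k) (A u)^k; the resulting bound
    grows linearly in M, with a slope that does not depend on [z]. *)
Lemma finite_over_all u : finite_over emb u.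
Proof.
have [A [D [nzA AD uD]]] := field_of_fractions u.
pose c := (D + 2 * m * q)%N.
exists (q.+1 * (c + c)).+1 => z; apply: bounded_dependence (ltnSn _) _.
have [E [D' [nzE ED zD]]] := common_denominator z (q.+1 * (c + c)).+1.
exists (D' + 2 + 4 * m * q)%N => M; exists (A ^+ M * E); split.
  by rewrite mulf_neq0 // expf_neq0.
move=> k i kM iN; have -> : A ^+ M * E * u ^+ k * z i = A ^+ (M - k) * (A * u) ^+ k * (E * z i).
  by rewrite -{1}(subnK kM) exprD exprMn; ring.
have := y_boundedM (y_boundedM (y_bounded_pow (M - k) AD) (y_bounded_pow k uD)) (zD i iN).
apply: y_boundedW; rewrite /c; nia.
Qed.

(** Multiplication by x costs a single degree, so the slope is 1 and the count gives degree at most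
    q + 1 over F(x). This sharp value is what allows 1, y, ..., y^q to become a basis. *)
Lemma dependence_over_x (z : nat -> L) :
  exists d : nat -> {poly F}, (exists2 j, (j < q.+2)%N & d j != 0) /\
    \sum_(0 <= j < q.+2) at_x (d j) * z j = 0.
Proof.
apply: (@bounded_dependence x 1); first by rewrite muln1.
have [E [D [nzE ED zD]]] := common_denominator z q.+2.
exists D => M; exists E; split=> // k i kM iq.
have := y_bounded_at_x 'X^k (zD i iq); rewrite at_xXn mulrCA mulrA size_polyXn /=.
by apply: y_boundedW; lia.
Qed.

End FunctionField.

(** * Values at a place and the associated valuation ring *)

Section Places.
Variables (F L : fieldType) (emb : {rmorphism F -> L}) (w : L -> int).
Hypothesis pw : is_place emb w.

Lemma placeM a b : a != 0 -> b != 0 -> w (a * b) = w a + w b.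
Proof. by case: pw => + _ _ _; apply. Qed.

Lemma place_const c : c != 0 -> w (emb c) = 0.
Proof. by case: pw => _ _ + _; apply. Qed.

Lemma place1 : w 1 = 0.
Proof. by rewrite -(rmorph1 emb) place_const // oner_neq0. Qed.

Lemma placeN a : w (- a) = w a.
Proof.
have [->|nza] := eqVneq a 0; first by rewrite oppr0.
rewrite -mulN1r placeM ?oppr_eq0 ?oner_neq0 //.
by rewrite -(rmorph1 emb) -rmorphN place_const ?add0r // oppr_eq0 oner_neq0.
Qed.

Lemma placeV a : a != 0 -> w a^-1 = - w a.
Proof.
move=> nza; apply/eqP; rewrite -addr_eq0 -placeM ?invr_eq0 //.
by rewrite mulVf // place1.
Qed.

Lemma placeX a n : a != 0 -> w (a ^+ n) = w a *+ n.
Proof.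
move=> nza; elim: n => [|n IH]; first by rewrite expr0 place1.
by rewrite exprS placeM ?expf_neq0 // IH mulrS.
Qed.

Lemma place_div a b : a != 0 -> b != 0 -> w (a / b) = w a - w b.
Proof. by move=> nza nzb; rewrite placeM ?invr_eq0 // placeV. Qed.

Definition place_ring z := z = 0 \/ 0 <= w z.

Lemma place_ringE z : z != 0 -> place_ring z -> 0 <= w z.
Proof. by move=> nz [/eqP|//]; rewrite (negPf nz). Qed.

Lemma place_valuation_ring : is_valuation_ring place_ring.
Proof.
have D s t : place_ring s -> place_ring t -> place_ring (s + t).
  case=> [->|ws]; rewrite ?add0r // => -[->|wt]; first by rewrite addr0; right.
  have [->|nz] := eqVneq (s + t) 0; first by left.
  have [->|nzs] := eqVneq s 0; first by rewrite add0r; right.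
  have [->|nzt] := eqVneq t 0; first by rewrite addr0; right.
  right; case: pw => _ /(_ s t nzs nzt nz) + _ _; apply: le_trans.
  by rewrite le_min ws wt.
split; first split.
- by right; rewrite place1.
- move=> s t As At; apply: D => //; case: At => [->|wt]; first by left; rewrite oppr0.
  by right; rewrite placeN.
- move=> s t [->|ws]; first by left; rewrite mul0r.
  case=> [->|wt]; first by left; rewrite mulr0.
  have [->|nzs] := eqVneq s 0; first by left; rewrite mul0r.
  have [->|nzt] := eqVneq t 0; first by left; rewrite mulr0.
  by right; rewrite placeM // addr_ge0.
move=> z; have [->|nz] := eqVneq z 0; first by left; left.
by rewrite /place_ring placeV // oppr_ge0; case/orP: (le_total 0 (w z)); auto.
Qed.

Lemma place_ring_const c : place_ring (emb c).
Proof.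
have [->|nz] := eqVneq c 0; first by left; rewrite rmorph0.
by right; rewrite place_const.
Qed.

Lemma place_max_idealP z : z != 0 -> (max_ideal place_ring z <-> 0 < w z).
Proof.
move=> nz; rewrite /max_ideal /place_ring; split=> [[/eqP|]|w0].
- by rewrite (negPf nz).
- by move/not_orP=> [_]; rewrite placeV // oppr_ge0 => /negP; rewrite -ltNge.
- right; case=> [/eqP|]; first by rewrite invr_eq0 (negPf nz).
  by rewrite placeV // oppr_ge0 leNgt w0.
Qed.

Lemma place_same_val s t : s != 0 -> t != 0 -> (same_val place_ring s t <-> w s = w t).
Proof.
move=> nzs nzt; rewrite /same_val /place_ring !place_div //; split.
  case=> -[/eqP|st]; first by rewrite mulf_eq0 invr_eq0 (negPf nzs) (negPf nzt).
  case=> [/eqP|ts]; first by rewrite mulf_eq0 invr_eq0 (negPf nzs) (negPf nzt).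
  by apply/le_anti; rewrite -subr_ge0 ts -subr_ge0 st.
by move=> ->; rewrite subrr; split; right.
Qed.

Lemma place_sum_neq0 n (P : pred nat) (z : nat -> L) :
  (forall j, (j < n)%N -> P j -> z j != 0) ->
  (forall j k, (j < k < n)%N -> P j -> P k -> w (z j) != w (z k)) ->
  forall j, (j < n)%N -> P j -> \sum_(0 <= j < n | P j) z j != 0.
Proof.
move=> nz dw j jn Pj.
have [] // := sum_distinct_val place_valuation_ring nz _ jn Pj.
move=> k l /andP[kl ln] Pk Pl /(place_same_val (nz _ (ltn_trans kl ln) Pk) (nz _ ln Pl))/eqP.
by apply/negP/dw; rewrite ?kl.
Qed.

End Places.

(** * Arithmetic of the field with q^2 elements *)

Section FiniteFieldFacts.
Variables (q : nat) (F : finFieldType).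
Hypothesis hq : exists p k : nat, [/\ prime p, (0 < k)%N & q = (p ^ k)%N].
Hypothesis q3 : (q %% 3 = 2)%N.
Hypothesis cardF : #|F| = (q ^ 2)%N.
Local Notation m := (m_of q).

Lemma pchar_exp : exists2 p, p \in [pchar F] & exists2 k, (0 < k)%N & q = (p ^ k)%N.
Proof.
have [p [k [pp k0 qE]]] := hq; exists p; last by exists k.
by apply: (@card_finPcharP F p (k * 2)) => //; rewrite cardF qE expnM.
Qed.

Lemma q_natr0 : q%:R = 0 :> F.
Proof.
have [p cp [[|k] // _ ->]] := pchar_exp.
by rewrite natrX (pcharf0 cp) expr0n.
Qed.

Lemma natr_q1 : q.+1%:R = 1 :> F. Proof. by rewrite -natr1 q_natr0 add0r. Qed.

Lemma natr_3m : 3%:R * m%:R = 1 :> F. Proof. by rewrite -natrM -(m_of3 q3) natr_q1. Qed.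

Lemma natr_m_neq0 : m%:R != 0 :> F.
Proof. by apply/eqP => m0; move/eqP: natr_3m; rewrite m0 mulr0 eq_sym oner_eq0. Qed.

Lemma natr_3_neq0 : 3%:R != 0 :> F.
Proof. by apply/eqP => t0; move/eqP: natr_3m; rewrite t0 mul0r eq_sym oner_eq0. Qed.

Lemma exprDq (K : fieldType) (e : {rmorphism F -> K}) (s t : K) :
  (s + t) ^+ q = s ^+ q + t ^+ q.
Proof.
have [p cp [k _ ->]] := pchar_exp.
apply: exprDn_pchar; rewrite pnatX; apply/orP; left; rewrite pnatE ?(pcharf_prime cp) //.
by rewrite (rmorph_pchar e cp).
Qed.

Lemma exprBq (K : fieldType) (e : {rmorphism F -> K}) (s t : K) :
  (s - t) ^+ q = s ^+ q - t ^+ q.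
Proof. by apply/eqP; rewrite eq_sym subr_eq -(exprDq e) subrK. Qed.

Lemma expf_q2 (c : F) : c ^+ q ^+ q = c.
Proof. by rewrite -exprM -[RHS]expf_card cardF. Qed.

Lemma primitive_element : exists g : F, (q ^ 2).-1.-primitive_root g.
Proof.
have q0 : (2 <= q)%N by lia.
have N0 : (0 < (q ^ 2).-1)%N by nia.
pose rs := [seq c <- enum F | c != 0].
have rs1 : all (q ^ 2).-1.-unity_root rs.
  apply/allP => c; rewrite mem_filter => /andP[nzc _]; apply/unity_rootP.
  apply: (mulfI nzc); rewrite -exprS prednK ?mulr1; last by nia.
  by rewrite -cardF expf_card.
have urs : uniq rs by rewrite filter_uniq // enum_uniq.
have szrs : ((q ^ 2).-1 <= size rs)%N.
  rewrite size_filter -cardF cardE -(count_predC (pred1 (0 : F))) count_uniq_mem ?enum_uniq //.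
  by rewrite mem_enum.
by have /hasP[g _ gP] := has_prim_root N0 rs1 urs szrs; exists g.
Qed.

Lemma root_of_unity_q1 : exists e : F, q.+1.-primitive_root e.
Proof.
have [g gP] := primitive_element; exists (g ^+ ((q ^ 2).-1 %/ q.+1)).
by apply: dvdn_prim_root => //; apply/dvdnP; exists q.-1; nia.
Qed.

(** Such a [c] is the abscissa of a point with y = 0, where y is totally ramified over x. In
    characteristic 2 the element 1 works; otherwise q = 2p + 1 and q^2 - 1 = 2m (3p), so g^(3p) has
    order 2m. *)
Lemma exists_root_m : exists c : F, c ^+ m = -1.
Proof.
have [g gP] := primitive_element.
have q0 : (2 <= q)%N by lia.
have [[p pE]|[p pE]] : (exists p, q = p.*2) \/ (exists p, q = p.*2.+1).
  by rewrite -(odd_double_half q); case: (odd q); [right|left]; exists q./2.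
- exists 1; rewrite expr1n; apply/eqP; rewrite -addr_eq0 -(natrD _ 1 1).
  have [p' cp [k k0 qE]] := pchar_exp.
  have : (2 %| q)%N by rewrite pE -muln2 dvdn_mull.
  by rewrite qE Euclid_dvdX // k0 andbT dvdn_prime2 ?(pcharf_prime cp) // => /eqP E2;
    rewrite -(pcharf0 cp) -E2.
have E : (q ^ 2).-1 = (m * (3 * p) * 2)%N.
  by have := m_of3 q3; nia.
exists (g ^+ (3 * p)); rewrite -exprM mulnC; set c := g ^+ _.
have : c ^+ 2 == 1 by rewrite -exprM -E (prim_expr_order gP).
rewrite sqrf_eq1 => /orP[|/eqP//]; rewrite -(prim_order_dvd gP) E => /dvdn_leq.
have : (0 < m * (3 * p))%N by rewrite !muln_gt0 /=; have := m_of3 q3; lia.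
by move: (m * _)%N => e; lia.
Qed.

End FiniteFieldFacts.

(** * Integral elements over F[x] *)

Section NormalForm.
Variables (q : nat) (F : finFieldType) (L : fieldType) (emb : {rmorphism F -> L}) (x y : L).
Local Notation m := (m_of q).
Local Notation at_x := (eval_at emb x).
Hypothesis hq : exists p k : nat, [/\ prime p, (0 < k)%N & q = (p ^ k)%N].
Hypothesis q3 : (q %% 3 = 2)%N.
Hypothesis cardF : #|F| = (q ^ 2)%N.
Hypothesis HX : is_function_field_X3 emb q x y.

Let m3 := m_of3 q3.

Let m_gt0 : (0 < m)%N := m_of_gt0 q3.

Lemma x_neq0 : x != 0.
Proof. by rewrite -(at_xX emb x) (at_x_eq0 HX) polyX_eq0. Qed.

Lemma x_sub_neq0 c : x - emb c != 0.
Proof.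
rewrite -(at_xX emb x) -(at_xC emb x) -rmorphB (at_x_eq0 HX).
by rewrite polyXsubC_eq0.
Qed.

Lemma y_neq0 : y != 0.
Proof.
apply/eqP => y0; have := y_exp HX; rewrite y0 expr0n /= => /eqP.
rewrite eq_sym oppr_eq0 (at_x_eq0 HX) => /eqP /(congr1 (fun p : {poly F} => p`_(2 * m))).
rewrite coefD !coefXn eqxx coef0;
  have -> : (2 * m == m)%N = false by rewrite mul2n -addnn -{3}[m]addn0 eqn_add2l gtn_eqF.
by rewrite addr0 => /eqP; rewrite oner_eq0.
Qed.

Lemma at_x_subring : is_subring (fun z => exists p, z = at_x p).
Proof.
split.
- by exists 1; rewrite rmorph1.
- by move=> _ _ [p ->] [r ->]; exists (p - r); rewrite rmorphB.
- by move=> _ _ [p ->] [r ->]; exists (p * r); rewrite rmorphM.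
Qed.

Lemma size_map_at_x (p : {poly {poly F}}) : (size (map_poly at_x p) <= size p)%N.
Proof. exact: size_poly. Qed.

Lemma integral_of_adjoin (h : L) : h != 0 ->
  adjoin (fun z => exists p, z = at_x p) h^-1 h -> integralOver at_x h.
Proof.
move=> nzh [P [/choice[r rP] hE]].
pose n := size P.
pose Q : {poly {poly F}} := 'X^(n.+1) - \poly_(k < n.+1) r (n - k)%N.
exists Q.
  rewrite monicE /Q lead_coefDl ?lead_coefXn // size_polyN size_polyXn ltnS.
  exact: size_poly.
apply/rootP; rewrite /Q rmorphB /= map_polyXn hornerD hornerN hornerXn.
apply/eqP; rewrite subr_eq0; apply/eqP.
rewrite (@horner_coef_wide _ n.+1); last exact: leq_trans (size_map_at_x _) (size_poly _ _).
rewrite exprSr {2}hE (@horner_coef_wide _ n.+1) // mulr_sumr.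
rewrite (reindex_inj rev_ord_inj) /=; apply: eq_bigr => k _.
have kn : (k <= n)%N by rewrite -ltnS.
rewrite coef_map /= coef_poly ltn_ord subSS rP mulrCA; congr (_ * _).
have -> : h ^+ n = h ^+ k * h ^+ (n - k) by rewrite -exprD subnKC.
by rewrite exprVn mulfK // expf_neq0.
Qed.

(* Otherwise [h] is not in [F[x][h^-1]], and a valuation ring containing [F[x]] but not [h]
   is a place where [x] is regular and [h] is not. *)
Lemma integral_of_places h :
  (forall w, is_place emb w -> 0 <= w x -> 0 <= w h) -> integralOver at_x h.
Proof.
move=> hP; have [->|nzh] := eqVneq h 0; first exact: integral0.
apply: contrapT => nint.
have [|A [vA RA nAh]] := valuation_ring_avoiding at_x_subring (h := h).
  by move=> /(integral_of_adjoin nzh).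
have AF c : A (emb c) by apply: RA; exists c%:P; rewrite at_xC.
have [w [pw wP]] := valuation_ring_place vA AF nAh (finite_over_all q3 HX).
apply: nAh; apply/wP => //; apply: hP => //; apply/wP; first exact: x_neq0.
by apply: RA; exists 'X; rewrite at_xX.
Qed.

(** For h = (x - c)^-1 the ring F[x][h^-1] is F[x] itself, where x - c has no inverse; a valuation
    ring avoiding h is thus available. *)
Lemma place_at_root c : exists w, is_place emb w /\ 0 < w (x - emb c).
Proof.
have XcE : x - emb c = at_x ('X - c%:P) by rewrite rmorphB /= at_xX at_xC.
have nzxc := x_sub_neq0 c.
have [|A [vA RA nAh]] := valuation_ring_avoiding at_x_subring (h := (x - emb c)^-1).
  rewrite invrK => -[P [/choice[r rP] hE]].
  pose R := \sum_(i < size P) r i * ('X - c%:P) ^+ i.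
  have {hE rP} hE : (x - emb c)^-1 = at_x R.
    rewrite hE horner_coef rmorph_sum; apply: eq_bigr => i _.
    by rewrite rP rmorphM rmorphXn /= -XcE.
  have /eqP : at_x (R * ('X - c%:P)) = at_x 1 by rewrite rmorphM /= -XcE -hE mulVf // rmorph1.
  rewrite (inj_eq (at_x_inj HX)) => /eqP/(congr1 (fun p => p.[c])).
  by rewrite hornerM hornerXsubC subrr mulr0 hornerC => /esym/eqP; rewrite oner_eq0.
have AF d : A (emb d) by apply: RA; exists d%:P; rewrite at_xC.
have [w [pw wP]] := valuation_ring_place vA AF nAh (finite_over_all q3 HX).
exists w; split=> //; rewrite ltNge -oppr_ge0 -(placeV pw) //.
by apply/negP => /(wP _ (invr_neq0 nzxc)).
Qed.

Lemma place_at_x w c (g : {poly F}) : is_place emb w -> 0 < w (x - emb c) ->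
  ~~ root g c -> w (at_x g) = 0.
Proof.
move=> pw wxc ngc; have vA := place_valuation_ring pw.
have nzxc := x_sub_neq0 c.
have mxc : max_ideal (place_ring w) (x - emb c).
  exact/(place_max_idealP pw nzxc).
have Ax : place_ring w x.
  rewrite -[x](subrK (emb c)); apply: (subr_D (proj1 vA)); first exact: max_ideal_mem.
  exact: place_ring_const pw _.
have nzg : at_x g != 0 by rewrite (at_x_eq0 HX); apply: contraNneq ngc => ->; exact: root0.
have Ag : place_ring w (at_x g) by apply: valuation_ring_horner Ax => // d;
  exact: place_ring_const pw _.
have gc := horner_congr vA (place_ring_const pw) g Ax mxc.
apply/eqP; rewrite eq_le (place_ringE nzg Ag) andbT leNgt.
apply/negP => /(place_max_idealP pw nzg) mg.
have : max_ideal (place_ring w) (emb g.[c]).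
  by rewrite -[emb _](subKr (at_x g)); apply: max_idealB.
by move/(const_max_ideal vA (place_ring_const pw)) => /eqP; apply/negP.
Qed.

(** At a place above a root c of X^m + 1, a simple root because m is invertible in [F], the value of
    x - c is q + 1 times that of y. The nonzero terms then have values in distinct classes modulo
    (q+1) w(y) and cannot cancel. *)
Lemma y_independent (g : nat -> {poly F}) :
  \sum_(0 <= j < q.+1) at_x (g j) * y ^+ j = 0 -> forall j, (j < q.+1)%N -> g j = 0.
Proof.
move=> sum0 j jq; apply/eqP; apply: contraT => nzgj.
have [c cm] := exists_root_m hq q3 cardF.
have [w [pw wc]] := place_at_root c.
have nzc : c != 0.
  by apply/eqP => c0; move/eqP: cm; rewrite c0 expr0n (gtn_eqF m_gt0) eq_sym oppr_eq0 oner_eq0.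
have nzxc := x_sub_neq0 c.
have wg (f : {poly F}) : f != 0 -> exists k, w (at_x f) = w (x - emb c) *+ k.
  move=> nzf; have [k [r /implyP/(_ nzf) nr ->]] := multiplicity_XsubC f c.
  have nzr : r != 0 by apply: contraNneq nr => ->; exact: root0.
  exists k; rewrite rmorphM rmorphXn rmorphB /= at_xX at_xC (placeM pw) ?(at_x_eq0 HX)
    ?expf_neq0 //.
  by rewrite (place_at_x pw wc nr) add0r (placeX pw).
have wy : w y *+ q.+1 = w (x - emb c).
  rewrite -(placeX pw) ?y_neq0 // (y_exp HX) (placeN pw).
  have /factor_theorem[r rE] : root ('X^m + 1 : {poly F}) c.
    by rewrite /root hornerD hornerXn hornerC cm addNr.
  have nr : ~~ root ('X^m * r) c.
    rewrite /root hornerM hornerXn cm mulN1r oppr_eq0.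
    have : ('X^m + 1 : {poly F})^`().[c] != 0.
      rewrite derivD derivXn derivC addr0 hornerMn hornerXn -mulr_natr.
      by rewrite mulf_neq0 ?expf_neq0 // (natr_m_neq0 hq q3 cardF).
    by rewrite rE derivM hornerD !hornerM derivXsubC hornerC hornerXsubC subrr mulr0 add0r mulr1.
  have -> : curve_poly q F = 'X^m * r * ('X - c%:P).
    by rewrite -mulrA -rE /curve_poly mulrDr mulr1 -exprD addnn mul2n.
  have nzr : 'X^m * r != 0 by apply: contraNneq nr => ->; exact: root0.
  rewrite rmorphM rmorphB /= at_xX at_xC (placeM pw) ?(at_x_eq0 HX) //.
  by rewrite (place_at_x pw wc nr) add0r.
have wy0 : 0 < w y.
  by rewrite -(pmulrn_lgt0 _ (ltn0Sn q)) wy.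
have nz k : g k != 0 -> at_x (g k) * y ^+ k != 0.
  by move=> nzk; rewrite mulf_neq0 ?(at_x_eq0 HX) // expf_neq0 // y_neq0.
have := @place_sum_neq0 _ _ _ _ pw q.+1 (fun k => g k != 0) (fun k => at_x (g k) * y ^+ k)
  (fun k _ => @nz k) _ j jq nzgj.
rewrite big_mkcond (eq_bigr (fun k => at_x (g k) * y ^+ k)); last first.
  by move=> k _; case: eqP => [->|//]; rewrite rmorph0 mul0r.
rewrite sum0 eqxx; apply=> k l /andP[kl lq] nzk nzl.
have [a aE] := wg _ nzk; have [b bE] := wg _ nzl.
rewrite !(placeM pw) ?(at_x_eq0 HX) ?expf_neq0 ?y_neq0 // aE bE -wy !(placeX pw) ?y_neq0 //.
rewrite -!mulrnA -!mulrnDr; apply/eqP => /mulrIn.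
rewrite gt_eqF // => /(_ isT) /(congr1 (modn^~ q.+1)).
rewrite ![(q.+1 * _)%N]mulnC !modnMDl !modn_small // ?(ltn_trans kl) // => E.
by rewrite E ltnn in kl.
Qed.

Lemma rational_representation z : exists (d : {poly F}) (g : nat -> {poly F}), d != 0 /\
  z = (\sum_(0 <= j < q.+1) at_x (g j) * y ^+ j) / at_x d.
Proof.
have [d [[j jq nzdj] sum0]] :=
  dependence_over_x q3 HX (fun j => if (j < q.+1)%N then y ^+ j else z).
move: sum0; rewrite big_nat_recr //= ltnn => sum0.
have {}sum0 : \sum_(0 <= j < q.+1) at_x (d j) * y ^+ j + at_x (d q.+1) * z = 0.
  rewrite -[RHS]sum0; congr (_ + _); rewrite !big_nat.
  by apply: eq_bigr => k /andP[_ ->].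
have nzd : d q.+1 != 0.
  apply/eqP => d0; move: sum0; rewrite d0 rmorph0 mul0r addr0 => /y_independent H.
  move: jq nzdj; rewrite ltnS leq_eqVlt => /predU1P[->|/H ->]; last by rewrite eqxx.
  by rewrite d0 eqxx.
exists (d q.+1), (fun j => - d j); split=> //.
apply: (mulIf (x := at_x (d q.+1))); first by rewrite (at_x_eq0 HX).
rewrite divfK ?(at_x_eq0 HX) // mulrC.
under eq_bigr do rewrite rmorphN mulNr.
by apply/eqP; rewrite sumrN -addr_eq0 addrC sum0.
Qed.

(* The substitution [y -> e y] fixes the equation of the curve, so it preserves every
   polynomial relation satisfied by [y]. *)
Lemma integral_conjugate (g : nat -> {poly F}) (d : {poly F}) e : d != 0 -> e ^+ q.+1 = 1 ->
  integralOver at_x ((\sum_(0 <= j < q.+1) at_x (g j) * y ^+ j) / at_x d) ->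
  integralOver at_x ((\sum_(0 <= j < q.+1) at_x (g j) * (e * y) ^+ j) / at_x d).
Proof.
move=> nzd e1 [Q mQ Q0]; exists Q => //.
have nzD : at_x d != 0 by rewrite (at_x_eq0 HX).
pose n := size Q; pose G : {poly {poly F}} := \poly_(j < q.+1) g j.
(* [B] is Q(G/d) cleared of denominators by d^n. Vanishing at y, it is divisible by the monic
   equation [P0] of y, which vanishes at e y as well. *)
pose B : {poly {poly F}} := \sum_(i < n) (Q`_i * d ^+ (n - i))%:P * G ^+ i.
have GE Y : (map_poly at_x G).[Y] = \sum_(0 <= j < q.+1) at_x (g j) * Y ^+ j.
  rewrite (@horner_coef_wide _ q.+1); last exact: leq_trans (size_map_at_x _) (size_poly _ _).
  rewrite big_mkord; apply: eq_bigr => j _.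
  by rewrite coef_map /= coef_poly ltn_ord.
have BE Y : (map_poly at_x B).[Y] = at_x d ^+ n *
    (map_poly at_x Q).[(\sum_(0 <= j < q.+1) at_x (g j) * Y ^+ j) / at_x d].
  rewrite (horner_coef_wide _ (size_map_at_x Q)).
  rewrite rmorph_sum horner_sum mulr_sumr; apply: eq_bigr => i _.
  rewrite rmorphM rmorphXn /= map_polyC hornerM hornerC horner_exp GE coef_map /=.
  rewrite rmorphM rmorphXn expr_div_n /=.
  have -> : at_x d ^+ n = at_x d ^+ i * at_x d ^+ (n - i).
    by rewrite -exprD subnKC // ltnW.
  by field; rewrite expf_neq0.
pose P0 : {poly {poly F}} := 'X^(q.+1) + (curve_poly q F)%:P.
have szC : (size ((curve_poly q F)%:P : {poly {poly F}}) < size ('X^(q.+1) : {poly {poly F}}))%N.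
  by rewrite size_polyXn size_polyC; case: eqP.
have szP0 : size P0 = q.+2 by rewrite size_polyDl // size_polyXn.
have mP0 : P0 \is monic by rewrite monicE lead_coefDl ?lead_coefXn.
have P0E Y : (map_poly at_x P0).[Y] = Y ^+ q.+1 + at_x (curve_poly q F).
  by rewrite rmorphD /= map_polyXn map_polyC hornerD hornerXn hornerC.
have BP0 := Pdiv.RingMonic.rdivp_eq mP0 B; set T := Pdiv.Ring.rmodp B P0 in BP0.
have szT : (size T <= q.+1)%N.
  by rewrite -ltnS -szP0 Pdiv.Ring.ltn_rmodp monic_neq0.
have /eqP By : (map_poly at_x B).[y] == 0 by rewrite BE (rootP Q0) mulr0.
have T0 : T = 0.
  move: By; rewrite BP0 rmorphD rmorphM /= hornerD hornerM P0E (y_exp HX) addNr mulr0 add0r.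
  rewrite (@horner_coef_wide _ q.+1); last exact: leq_trans (size_map_at_x _) szT.
  move=> Ty; apply/polyP => j; rewrite coef0.
  have [jq|qj] := ltnP j q.+1; last by rewrite nth_default // (leq_trans szT).
  apply: (@y_independent (fun j => T`_j)) jq.
  by rewrite big_mkord -[RHS]Ty; apply: eq_bigr => k _; rewrite coef_map.
have : (map_poly at_x B).[e * y] = 0.
  rewrite BP0 T0 addr0 rmorphM /= hornerM P0E exprMn e1 mul1r (y_exp HX) addNr.
  by rewrite mulr0.
by rewrite BE => /eqP; rewrite mulf_eq0 expf_eq0 (negPf nzD) andbF.
Qed.

Lemma integral_sum (f : nat -> L) n :
  (forall j, (j < n)%N -> integralOver at_x (f j)) ->
  integralOver at_x (\sum_(0 <= j < n) f j).
Proof.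
elim: n => [|n IH] fP; first by rewrite big_geq //; exact: integral0.
rewrite big_nat_recr //=; apply: integral_add; last exact: fP.
by apply: IH => j jn; apply: fP; exact: leqW.
Qed.

Lemma integral_component (g : nat -> {poly F}) (d : {poly F}) j : d != 0 -> (j < q.+1)%N ->
  integralOver at_x ((\sum_(0 <= j < q.+1) at_x (g j) * y ^+ j) / at_x d) ->
  integralOver at_x (at_x (g j) * y ^+ j / at_x d).
Proof.
move=> nzd jq int_h; have [e0 e0P] := root_of_unity_q1 q3 cardF.
pose e := emb e0; have eP : q.+1.-primitive_root e by rewrite fmorph_primitive_root.
have nze : e != 0 by rewrite (prim_root_eq0 eP).
pose S r := (\sum_(0 <= k < q.+1) at_x (g k) * (e ^+ r * y) ^+ k) / at_x d.
have int_S r : integralOver at_x (S r).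
  by apply: integral_conjugate => //; rewrite exprAC (prim_expr_order eP) expr1n.
have -> : at_x (g j) * y ^+ j / at_x d = \sum_(0 <= r < q.+1) at_x (e0 ^- (r * j))%:P * S r.
  transitivity (\sum_(0 <= k < q.+1) at_x (g k) * y ^+ k / at_x d *
      \sum_(0 <= r < q.+1) (e ^- j * e ^+ k) ^+ r); last first.
    under eq_bigr do rewrite mulr_sumr.
    rewrite exchange_big /=; apply: eq_bigr => r _.
    rewrite /S mulr_suml mulr_sumr; apply: eq_bigr => k _.
    rewrite at_xC fmorphV rmorphXn /= -/e !exprMn exprVn -!exprM.
    by rewrite [(k * r)%N]mulnC [(j * r)%N]mulnC; ring.
  rewrite (bigD1_seq j) ?mem_index_iota ?iota_uniq //= [X in _ + X]big1_seq ?addr0; last first.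
    move=> k /andP[kj]; rewrite mem_index_iota => /andP[_ kq].
    have ne1 : e ^- j * e ^+ k - 1 != 0.
      rewrite subr_eq0; apply: contra kj => /eqP E.
      have : e ^+ k == e ^+ j by rewrite -[e ^+ k](mulVKf (expf_neq0 j nze)) E mulr1.
      by rewrite (eq_prim_root_expr eP) !modn_small.
    suff -> : \sum_(0 <= r < q.+1) (e ^- j * e ^+ k) ^+ r = 0 by rewrite mulr0.
    apply: (mulfI ne1); rewrite mulr0 big_mkord -subrX1 exprMn exprVn -!exprM.
    by rewrite ![(_ * q.+1)%N]mulnC !exprM (prim_expr_order eP) !expr1n invr1 mulr1 subrr.
  (* The q + 1 equal terms add up to the component itself, since q + 1 = 1 in [F]. *)
  rewrite mulVf ?expf_neq0 //; under eq_bigr do rewrite expr1n.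
  rewrite big_mkord sumr_const card_ord -(rmorph_nat emb) (natr_q1 hq cardF).
  by rewrite rmorph1 mulr1.
by apply: integral_sum => r _; apply: integral_mul => //; exact: integral_id.
Qed.

(** The rational root argument: F[x] is integrally closed. *)
Lemma dvdp_of_integral (r s : {poly F}) : s != 0 ->
  integralOver at_x (at_x r / at_x s) -> s %| r.
Proof.
move=> nzs [Q mQ /rootP Q0].
have nzS : at_x s != 0 by rewrite (at_x_eq0 HX).
pose e := gcdp r s.
have nze : e != 0 by rewrite gcdp_eq0 (negPf nzs) andbF.
have [r1 rE] : exists r1, r = r1 * e by exists (r %/ e); rewrite divpK ?dvdp_gcdl.
have [s1 sE] : exists s1, s = s1 * e by exists (s %/ e); rewrite divpK ?dvdp_gcdr.
have nzs1 : s1 != 0 by apply: contraNneq nzs => s0; rewrite sE s0 mul0r.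
have co : coprimep s1 r1.
  rewrite coprimep_sym; have := @coprimep_div_gcd _ r s; rewrite nzs orbT => /(_ isT).
  by rewrite -/e {1}rE {1}sE !mulpK.
have nzS1 : at_x s1 != 0 by rewrite (at_x_eq0 HX).
have {}Q0 : (map_poly at_x Q).[at_x r1 / at_x s1] = 0.
  rewrite -[RHS]Q0 rE sE !rmorphM; congr (_.[_]).
  by rewrite -mulf_div divff ?mulr1 // (at_x_eq0 HX).
rewrite sE rE dvdp_mul2r //.
have [n szQ] : exists n, size Q = n.+1.
  by exists (size Q).-1; rewrite prednK // size_poly_gt0 monic_neq0.
have Qn : Q`_n = 1 by move/monicP: mQ; rewrite /lead_coef szQ.
have : s1 %| r1 ^+ n.
  move: Q0; rewrite (@horner_coef_wide _ n.+1); last by rewrite -szQ; exact: size_map_at_x.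
  rewrite big_ord_recr /= coef_map /= Qn rmorph1 mul1r => Q0.
  have : at_x (r1 ^+ n) = at_x (s1 * - \sum_(i < n) Q`_i * r1 ^+ i * s1 ^+ (n - i).-1).
    rewrite rmorphM rmorphN rmorph_sum rmorphXn /=.
    apply: (mulIf (x := (at_x s1 ^+ n)^-1)); first by rewrite invr_eq0 expf_neq0.
    rewrite -expr_div_n; apply/eqP; rewrite mulrN mulNr -addr_eq0 addrC -[X in _ == X]Q0.
    apply/eqP; congr (_ + _); rewrite mulr_sumr mulr_suml; apply: eq_bigr => i _.
    rewrite coef_map !rmorphM !rmorphXn /= expr_div_n.
    have -> : at_x s1 ^+ n = at_x s1 ^+ i * (at_x s1 * at_x s1 ^+ (n - i).-1).
      by rewrite -exprS -exprD; congr (_ ^+ _); have := ltn_ord i; lia.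
    by field; rewrite !expf_neq0.
  by move/(at_x_inj HX) => ->; exact: dvdp_mulr.
have := coprimep_expr n co; rewrite coprimep_sym => /coprimepP/(_ s1) + s1r.
move=> /(_ s1r (dvdpp _)); rewrite -size_poly_eq1 => s1u.
by move: s1u; rewrite size_poly_eq1 => /eqp_dvdl ->; exact: dvd1p.
Qed.

Lemma coprime_Xm1 : coprimep ('X^m + 1 : {poly F}) 'X.
Proof.
by rewrite coprimepX /root hornerD hornerXn hornerC expr0n (gtn_eqF m_gt0) add0r oner_eq0.
Qed.

Lemma separable_Xm1 : separable_poly ('X^m + 1 : {poly F}).
Proof.
rewrite unlock derivD derivXn derivC addr0 -scaler_nat coprimepZr ?(natr_m_neq0 hq q3 cardF) //.
exact/coprimep_expr/coprime_Xm1.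
Qed.

(** Once the common factor with g is removed, d^(q+1) divides X^(mj) (X^m + 1)^j. A factor shared
    with the separable X^m + 1 would need q + 1 <= j, so d is a power X^s up to a constant, and 3ms
    <= mj gives s <= j/3. *)
Lemma dvdp_curve_root (d g : {poly F}) j : (j < q.+1)%N -> d != 0 ->
  d ^+ q.+1 %| g ^+ q.+1 * curve_poly q F ^+ j -> d %| g * 'X^(j %/ 3).
Proof.
move=> jq nzd; pose e := gcdp g d.
have nze : e != 0 by rewrite gcdp_eq0 (negPf nzd) andbF.
have [g1 gE] : exists g1, g = g1 * e by exists (g %/ e); rewrite divpK ?dvdp_gcdl.
have [d1 dE] : exists d1, d = d1 * e by exists (d %/ e); rewrite divpK ?dvdp_gcdr.
have nzd1 : d1 != 0 by apply: contraNneq nzd => d0; rewrite dE d0 mul0r.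
have co : coprimep d1 g1.
  rewrite coprimep_sym; have := @coprimep_div_gcd _ g d; rewrite nzd orbT => /(_ isT).
  by rewrite -/e {1}gE {1}dE !mulpK.
rewrite {1 2}gE {1 2}dE !exprMn mulrAC dvdp_mul2r ?expf_neq0 // mulrAC dvdp_mul2r //.
rewrite Gauss_dvdpr ?coprimep_expl ?coprimep_expr // => dv.
apply: dvdp_mull.
have curveE : curve_poly q F = 'X^m * ('X^m + 1).
  by rewrite mulrDr mulr1 -exprD addnn -mul2n.
have co1 : coprimep d1 ('X^m + 1).
  rewrite /coprimep; set f := gcdp _ _; apply: contraT => szf.
  have /dvdpP[f1 fE] : f %| 'X^m + 1 by exact: dvdp_gcdr.
  have cof : coprimep f f1.
    by apply: (separable_coprime separable_Xm1); rewrite mulrC -fE.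
  have nzf : f != 0 by rewrite gcdp_eq0 (negPf nzd1).
  have coX : coprimep f 'X.
    exact: coprimep_dvdr (dvdp_gcdr _ _) coprime_Xm1.
  have : f ^+ q.+1 %| curve_poly q F ^+ j.
    exact: dvdp_trans (dvdp_exp2r _ (dvdp_gcdl _ _)) dv.
  rewrite curveE exprMn Gauss_dvdpr; last by rewrite coprimep_expl ?coprimep_expr.
  rewrite fE exprMn Gauss_dvdpr; last by rewrite coprimep_expl ?coprimep_expr.
  rewrite dvdp_Pexp2l; first by rewrite leqNgt jq.
  by rewrite ltn_neqAle eq_sym szf size_poly_gt0.
move: dv; rewrite curveE exprMn Gauss_dvdpl; last by rewrite coprimep_expl ?coprimep_expr.
rewrite m3 exprM ['X^m ^+ j]exprAC dvdp_pexp2r // => dv3.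
have : d1 %| ('X - 0%:P) ^+ j.
  by rewrite subr0; apply: dvdp_trans dv3; rewrite exprS dvdp_mulr.
case/dvdp_exp_XsubCP => s _; rewrite subr0 => d1E; rewrite (eqp_dvdl _ d1E).
move: dv3; rewrite (eqp_dvdl _ (eqp_exp 3 d1E)) -exprM dvdp_Pexp2l ?size_polyX // => s3.
by rewrite dvdp_exp2l // leq_divRL.
Qed.

(* The exponent [j %/ 3] comes from [w x <= 3 * w y] at the places where [x] vanishes. *)
Lemma normal_form h : integralOver at_x h -> exists r : nat -> {poly F},
  h = \sum_(0 <= j < q.+1) at_x (r j) * y ^+ j / x ^+ (j %/ 3).
Proof.
have [d [g [nzd ->]]] := rational_representation h => int_h.
have nzD : at_x d != 0 by rewrite (at_x_eq0 HX).
have /choice[r rP] : forall j, exists r, (j < q.+1)%N -> g j * 'X^(j %/ 3) = r * d.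
  move=> j; case: (ltnP j q.+1) => jq; last by exists 0.
  have /dvdpP[r rE] : d %| g j * 'X^(j %/ 3); last by exists r.
  (* The (q+1)-th power of a component is integral and free of y, because y^(q+1) is a polynomial in
     x. *)
  apply: dvdp_curve_root => //; apply: dvdp_of_integral; first exact: expf_neq0.
  rewrite rmorphM !rmorphXn /=.
  have -> : at_x (g j) ^+ q.+1 * at_x (curve_poly q F) ^+ j / at_x d ^+ q.+1 =
     at_x ((-1) ^+ j) * (at_x (g j) * y ^+ j / at_x d) ^+ q.+1.
    rewrite rmorphXn rmorphN rmorph1 /= expr_div_n exprMn [y ^+ j ^+ _]exprAC (y_exp HX).
    rewrite [(- at_x _) ^+ j]exprNn; set s := (-1) ^+ j.
    have ss : s * s = 1 by rewrite -exprMn mulrNN mulr1 expr1n.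
    by rewrite -[LHS]mul1r -ss -!mulrA; congr (_ * _); rewrite mulrCA.
  apply: integral_mul; first exact: integral_id.
  elim: q.+1 => [|k IH]; first exact: integral1.
  by rewrite exprS; apply: integral_mul => //; exact: integral_component.
exists r; rewrite mulr_suml !big_nat; apply: eq_bigr => j /andP[_ jq].
have := congr1 at_x (rP j jq); rewrite !rmorphM /= at_xXn => E.
have nzx := expf_neq0 (j %/ 3) x_neq0.
have -> : at_x (g j) = at_x (r j) * at_x d / x ^+ (j %/ 3) by rewrite -E mulfK.
by field; rewrite nzx.
Qed.

End NormalForm.

(** * The Riemann-Roch spaces of the pole divisor of x *)

Section Inversion.
Variables (q : nat) (F : finFieldType) (L : fieldType) (emb : {rmorphism F -> L}) (x y : L).
Local Notation m := (m_of q).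
Local Notation at_x := (eval_at emb x).
Hypothesis hq : exists p k : nat, [/\ prime p, (0 < k)%N & q = (p ^ k)%N].
Hypothesis q3 : (q %% 3 = 2)%N.
Hypothesis cardF : #|F| = (q ^ 2)%N.
Hypothesis HX : is_function_field_X3 emb q x y.

Let m3 := m_of3 q3.
Let nzx : x != 0 := x_neq0 HX.

Lemma at_x_inv (p : {poly F}) n : (size p <= n.+1)%N ->
  x ^+ n * eval_at emb x^-1 p = at_x (\poly_(k < n.+1) p`_(n - k)).
Proof.
move=> pn; rewrite /eval_at (@horner_coef_wide _ n.+1) ?size_map_poly //.
rewrite (@horner_coef_wide _ n.+1) ?size_map_poly ?size_poly // mulr_sumr.
rewrite (reindex_inj rev_ord_inj) /=; apply: eq_bigr => k _.
have kn : (k <= n)%N by rewrite -ltnS.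
rewrite !coef_map /= coef_poly ltn_ord subSS mulrCA; congr (_ * _).
have -> : x ^+ n = x ^+ k * x ^+ (n - k) by rewrite -exprD subnKC.
by rewrite exprVn mulfK // expf_neq0.
Qed.

Lemma eval2_inv (A : {poly {poly F}}) : exists N A',
  x ^- N * eval2 emb A x y = eval2 emb A' x^-1 (y / x).
Proof.
rewrite eval2E; elim/poly_ind: A => [|A c [N [A' IH]]].
  by exists 0%N, 0; rewrite eval2E !rmorph0 !horner0 mulr0.
pose n := size c.
have cE : x ^- n * at_x c = eval_at emb x^-1 (\poly_(k < n.+1) c`_(n - k)).
  rewrite -exprVn /eval_at (@horner_coef_wide _ n.+1) ?size_map_poly //.
  rewrite (@horner_coef_wide _ n.+1) ?size_map_poly ?size_poly // mulr_sumr.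
  rewrite (reindex_inj rev_ord_inj) /=; apply: eq_bigr => k _.
  have kn : (k <= n)%N by rewrite -ltnS.
  rewrite !coef_map /= coef_poly ltn_ord subSS mulrCA; congr (_ * _).
  have -> : x^-1 ^+ n = x^-1 ^+ k * x^-1 ^+ (n - k) by rewrite -exprD subnKC.
  by rewrite [x^-1 ^+ (n - k)]exprVn -mulrA mulVf ?mulr1 // expf_neq0.
exists (N.+1 + n)%N, (A' * ('X^n)%:P * 'X + (\poly_(k < n.+1) c`_(n - k) * 'X^(N.+1))%:P).
rewrite eval2E !rmorphD !rmorphM /= !map_polyX !map_polyC !hornerMXaddC /=.
rewrite hornerD !hornerM !hornerC hornerX -[(map_poly _ A').[_]]eval2E -IH -cE !at_xXn !exprVn
  !exprD !exprS.
by field; rewrite nzx !expf_neq0.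
Qed.

(** Since x^(q+1) = (x^m)^3, the pair (1/x, y/x) satisfies the equation of the curve. This symmetry
    exchanges the zeros and the poles of x, so statements on places where x is regular also cover
    the others. *)
Lemma function_field_inv : is_function_field_X3 emb q x^-1 (y / x).
Proof.
split.
- have e3 : x ^+ q.+1 = (x ^+ m) ^+ 3 by rewrite -exprM mulnC m3.
  have e2 : x ^+ (2 * m) = (x ^+ m) ^+ 2 by rewrite -exprM mulnC.
  case: HX => E _ _; apply: (mulfI (expf_neq0 q.+1 nzx)); rewrite mulr0 -[RHS]E.
  rewrite expr_div_n !exprVn e3 e2; set a := x ^+ m; set b := y ^+ q.+1.
  by field; rewrite expf_neq0.
- move=> p nzp; apply: contraNneq nzp => p0; pose n := size p.
  have := @at_x_inv p n (leqnSn _); rewrite {1}/eval_at p0 mulr0 => /esym/eqP.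
  rewrite (at_x_eq0 HX) => /eqP r0; apply/eqP/polyP => j; rewrite coef0.
  have [jn|nj] := ltnP j n; last by rewrite nth_default.
  have := congr1 (fun r : {poly F} => r`_(n - j)) r0; rewrite coef_poly coef0.
  by rewrite ltnS leq_subr subKn // ltnW.
- move=> z; have [_ _ /(_ z)[A [B [nzB ->]]]] := HX.
  have [N [A' EA]] := eval2_inv A; have [M [B' EB]] := eval2_inv B.
  exists (A' * ('X^M)%:P), (B' * ('X^N)%:P).
  rewrite !eval2E !rmorphM /= !map_polyC !hornerM !hornerC -!eval2E -EA -EB /= !at_xXn !exprVn.
  split; first by rewrite !mulf_neq0 // invr_eq0 expf_neq0.
  by field; rewrite nzB !expf_neq0.
Qed.

End Inversion.

Section Bounded.
Variables (q : nat) (F : finFieldType) (L : fieldType) (emb : {rmorphism F -> L}) (x y : L).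
Local Notation m := (m_of q).
Local Notation at_x := (eval_at emb x).
Hypothesis hq : exists p k : nat, [/\ prime p, (0 < k)%N & q = (p ^ k)%N].
Hypothesis q3 : (q %% 3 = 2)%N.
Hypothesis cardF : #|F| = (q ^ 2)%N.
Hypothesis HX : is_function_field_X3 emb q x y.

(** The normal form of h / x^k in the coordinates 1/x and y/x has j-th term p_j(1/x) y^j x^(j/3 -
    j), with the quotient j/3 rounded down. Comparison with the j-th term r_j y^j / x^(j/3) of h
    bounds the degree of r_j by k + 2 (j/3) - j. *)
Lemma normal_form_bounded h k :
  (forall w, is_place emb w -> 0 <= w x -> 0 <= w h) ->
  (forall w, is_place emb w -> w x <= 0 -> 0 <= w (h / x ^+ k)) ->
  exists r : nat -> {poly F},
    (forall j, (j < q.+1)%N -> (size (r j) <= k.+1 + 2 * (j %/ 3) - j)%N) /\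
    h = \sum_(0 <= j < q.+1) at_x (r j) * y ^+ j / x ^+ (j %/ 3).
Proof.
move=> hfin hinf; have nzx := x_neq0 HX.
have HX' := function_field_inv q3 HX.
have [r rE] := normal_form hq q3 cardF HX (integral_of_places q3 HX hfin).
have hinf' w : is_place emb w -> 0 <= w x^-1 -> 0 <= w (h / x ^+ k).
  by move=> pw; rewrite (placeV pw) // oppr_ge0; exact: hinf.
have [p pE] := normal_form hq q3 cardF HX' (integral_of_places q3 HX' hinf').
exists r; split=> // j jq.
pose D := (\sum_(0 <= i < q.+1) size (p i))%N.
have pD i : (i < q.+1)%N -> (size (p i) <= D.+1)%N.
  move=> iq; apply: leqW.
  by rewrite /D (bigD1_seq i) ?mem_index_iota ?iota_uniq //= leq_addr.
(* Large enough for every exponent of x in the comparison to be a natural number. *)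
pose E := (D + q)%N.
pose c i : {poly F} := r i * 'X^(E - i %/ 3) -
  'X^(E + k + i %/ 3 - i - D) * \poly_(l < D.+1) (p i)`_(D - l).
have c0 : c j = 0.
  apply: (y_independent hq q3 cardF HX) jq.
  have -> : \sum_(0 <= i < q.+1) at_x (c i) * y ^+ i =
      \sum_(0 <= i < q.+1) (x ^+ E * (at_x (r i) * y ^+ i / x ^+ (i %/ 3)) -
      x ^+ (E + k) * (eval_at emb x^-1 (p i) * (y / x) ^+ i / x^-1 ^+ (i %/ 3))).
    rewrite !big_nat; apply: eq_bigr => i /andP[_ iq].
    rewrite /c rmorphB !rmorphM /= !at_xXn -(at_x_inv HX (pD i iq)) mulrBl; congr (_ - _).
      have -> : x ^+ E = x ^+ (E - i %/ 3) * x ^+ (i %/ 3).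
        by rewrite -exprD subnK // /E; lia.
      by field; rewrite expf_neq0.
    have -> : x ^+ (E + k + i %/ 3 - i - D) * (x ^+ D * eval_at emb x^-1 (p i)) =
        x ^+ (E + k + i %/ 3 - i) * eval_at emb x^-1 (p i).
      by rewrite mulrA -exprD subnK // /E; lia.
    have -> : x ^+ (E + k + i %/ 3 - i) = x ^+ (E + k) * x ^+ (i %/ 3) / x ^+ i.
      by rewrite -exprD -{2}(subnK (_ : i <= E + k + i %/ 3)%N) ?exprD ?mulfK ?expf_neq0 // /E; lia.
    by rewrite expr_div_n exprVn invrK; field; rewrite expf_neq0.
  rewrite sumrB -!mulr_sumr -rE -pE exprD.
  by field; rewrite expf_neq0.
have [->|nzr] := eqVneq (r j) 0; first by rewrite size_poly0.
move/eqP: c0; rewrite subr_eq0 => /eqP/(congr1 (fun s : {poly F} => size s)).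
rewrite size_mulXn // => szE.
have := size_mul_pred 'X^(E + k + j %/ 3 - j - D) (\poly_(l < D.+1) (p j)`_(D - l)).
rewrite -szE size_polyXn; have := size_poly D.+1 (fun l => (p j)`_(D - l)).
rewrite /E; move: (size (\poly_(l < _) _)) (size (r j)) => a b; lia.
Qed.

End Bounded.

Section DimensionBound.
Variables (q : nat) (F : finFieldType) (L : fieldType) (emb : {rmorphism F -> L}) (x y : L).
Local Notation m := (m_of q).
Local Notation at_x := (eval_at emb x).
Hypothesis hq : exists p k : nat, [/\ prime p, (0 < k)%N & q = (p ^ k)%N].
Hypothesis q3 : (q %% 3 = 2)%N.
Hypothesis cardF : #|F| = (q ^ 2)%N.
Hypothesis HX : is_function_field_X3 emb q x y.

(* Membership in the Riemann-Roch space of [k] times the pole divisor of [x]. *)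
Definition regular_form k (h : L) :=
  (forall w, is_place emb w -> 0 <= w x -> place_ring w h) /\
  (forall w, is_place emb w -> w x <= 0 -> place_ring w (h / x ^+ k)).

(** Three consecutive [j] share the quotient j/3, and n <= m keeps the truncated subtraction exact.
    At n = m the sum equals 3m(m+1)/2. *)
Lemma sum_dims n : (n <= m)%N ->
  (2 * \sum_(0 <= j < 3 * n) (m.+1 + 2 * (j %/ 3) - j) + 3 * n * n = 3 * n * (2 * m) + 3 * n)%N.
Proof.
elim: n => [|n IH] nm; first by rewrite muln0 big_geq.
have {IH}IH := IH (ltnW nm).
have E3 : (3 * n.+1 = (3 * n).+3)%N by lia.
rewrite [in X in (2 * X + _)%N]E3 !big_nat_recr //=.
have -> : ((3 * n) %/ 3 = n)%N by rewrite mulKn.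
have -> : ((3 * n).+1 %/ 3 = n)%N by lia.
have -> : ((3 * n).+2 %/ 3 = n)%N by lia.
move: IH; move: (\sum_(_ <= _ < _) _)%N => S; nia.
Qed.

(** Functions with distinct orders at one place are independent over [F], while normal forms have
    3m(m+1)/2 coefficients, indexed by [J]. *)
Lemma regular_form_orders (v : L -> int) (f : nat -> L) N : is_place emb v ->
  (forall i, (i < N)%N -> f i != 0 /\ regular_form m (f i)) ->
  (forall i j, (i < j < N)%N -> v (f i) != v (f j)) ->
  (2 * N <= 3 * m * m.+1)%N.
Proof.
move=> pv fP dv; rewrite leqNgt; apply/negP => ltN.
pose B (j : 'I_q.+1) := (m.+1 + 2 * (j %/ 3) - j)%N.
pose J := {j : 'I_q.+1 & 'I_(B j)}.
have cardJ : (2 * #|{: J}| = 3 * m * m.+1)%N.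
  rewrite card_tagged sumnE big_map big_enum /=.
  under eq_bigr => j _ do rewrite card_ord.
  have := sum_dims (leqnn m); rewrite -(m_of3 q3) big_mkord.
  set S := (\sum_(i < q.+1) _)%N.
  by clearbody S; rewrite (m_of3 q3); nia.
have /choice[r rP] : forall i, exists r : nat -> {poly F}, (i < N)%N ->
    (forall j, (j < q.+1)%N -> (size (r j) <= m.+1 + 2 * (j %/ 3) - j)%N) /\
    f i = \sum_(0 <= j < q.+1) at_x (r j) * y ^+ j / x ^+ (j %/ 3).
  move=> i; case: (ltnP i N) => iN; last by exists (fun=> 0).
  have [nzfi [h1 h2]] := fP i iN.
  have [|w pw wx|r rP] := @normal_form_bounded _ _ _ _ _ _ hq q3 cardF HX (f i) m; last by exists r.
    by move=> w pw wx; apply: place_ringE => //; exact: h1.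
  apply: place_ringE; last exact: h2.
  by rewrite mulf_neq0 ?invr_eq0 ?expf_neq0 ?(x_neq0 HX).
have JN : (#|{: J}| < #|'I_N|)%N by rewrite card_ord -(ltn_pmul2l (ltn0Sn 1)) cardJ.
have [c [[i0 nzc] cP]] :=
  linear_dependence (fun (i : 'I_N) (j : J) => (r i (tag j))`_(tagged j)) JN.
pose c' (i : nat) : F := oapp c 0 (insub i).
have c'E (i : 'I_N) : c' i = c i by rewrite /c' valK.
have nzf i : (i < N)%N -> f i != 0 by case/fP.
have nzc' : c' i0 != 0 by rewrite c'E.
have /negP[] : \sum_(0 <= i < N | c' i != 0) emb (c' i) * f i != 0.
  apply: (place_sum_neq0 pv) (ltn_ord i0) nzc' => [i iN nz|i j /andP[ij jN] nzi nzj].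
    by rewrite mulf_neq0 ?fmorph_eq0 ?nzf.
  rewrite !(placeM pv) ?fmorph_eq0 ?nzf ?(ltn_trans ij) // !(place_const pv) // !add0r.
  by apply: dv; rewrite ij.
rewrite big_mkcond (eq_bigr (fun i => emb (c' i) * f i)); last first.
  by move=> i _; case: eqP => [->|//]; rewrite rmorph0 mul0r.
apply/eqP; rewrite big_mkord.
under eq_bigr => i _ do rewrite c'E (proj2 (rP i (ltn_ord i))) big_mkord mulr_sumr.
rewrite exchange_big /= big1 // => j _.
have -> : \sum_(i < N) emb (c i) * (at_x (r i j) * y ^+ j / x ^+ (j %/ 3)) =
    at_x (\sum_(i < N) (c i)%:P * r i j) * (y ^+ j / x ^+ (j %/ 3)).
  rewrite rmorph_sum mulr_suml; apply: eq_bigr => i _.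
  by rewrite rmorphM /= at_xC !mulrA.
suff -> : \sum_(i < N) (c i)%:P * r i j = 0 by rewrite rmorph0 mul0r.
apply/polyP => e; rewrite coef0 coef_sum.
under eq_bigr do rewrite coefCM.
have [eB|Be] := ltnP e (B j); first exact: (cP (Tagged (fun j => 'I_(B j)) (Ordinal eB))).
rewrite big1 // => i _; rewrite nth_default ?mulr0 // (leq_trans _ Be) //.
by have [+ _] := rP i (ltn_ord i); apply.
Qed.

End DimensionBound.

(** * Uniqueness of the place centred at a smooth affine point *)

Section CentredPlaces.
Variables (q : nat) (F : finFieldType) (L : fieldType) (emb : {rmorphism F -> L}) (x y : L).
Variables (a b : F).
Local Notation m := (m_of q).
Local Notation at_x := (eval_at emb x).
Hypothesis hq : exists p k : nat, [/\ prime p, (0 < k)%N & q = (p ^ k)%N].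
Hypothesis q3 : (q %% 3 = 2)%N.
Hypothesis cardF : #|F| = (q ^ 2)%N.
Hypothesis HX : is_function_field_X3 emb q x y.
Hypothesis Hab : b ^+ q.+1 + a ^+ (2 * m) + a ^+ m = 0.
Hypothesis nzb : b != 0.

Definition centred (w : L -> int) :=
  [/\ is_place emb w, 0 < w (x - emb a) & 0 < w (y - emb b)].

Let nzxa := x_sub_neq0 HX a.

Lemma centred_x w : centred w -> max_ideal (place_ring w) (x - emb a).
Proof. by case=> pw wx _; apply/(place_max_idealP pw nzxa). Qed.

Lemma centred_y w : centred w -> max_ideal (place_ring w) (y - emb b).
Proof.
case=> pw _ wy; have [->|nz] := eqVneq (y - emb b) 0; first exact: max_ideal0.
exact/(place_max_idealP pw nz).
Qed.

Lemma centred_mem w z c : is_place emb w -> max_ideal (place_ring w) (z - emb c) ->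
  place_ring w z.
Proof.
move=> pw mz; have vA := place_valuation_ring pw.
rewrite -[z](subrK (emb c)); apply: (subr_D (proj1 vA)); first exact: max_ideal_mem.
exact: place_ring_const pw _.
Qed.

Lemma centred_horner w (p : {poly L}) z : is_place emb w ->
  (forall i, place_ring w p`_i) -> place_ring w z -> place_ring w p.[z].
Proof.
move=> pw Ap Az; have sA := proj1 (place_valuation_ring pw).
rewrite horner_coef; apply: (subr_sum sA) => i _.
by apply: (subr_M sA) => //; exact: subr_X.
Qed.

Lemma centred_congr w (A : {poly {poly F}}) : centred w ->
  place_ring w (eval2 emb A x y) /\
  max_ideal (place_ring w) (eval2 emb A x y - emb A.[b%:P].[a]).
Proof.
move=> cw; have [pw _ _] := cw; have vA := place_valuation_ring pw.
have Ax : place_ring w x := centred_mem pw (centred_x cw).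
have Ay : place_ring w y := centred_mem pw (centred_y cw).
have Aev (B : {poly {poly F}}) : place_ring w (eval2 emb B x y).
  rewrite eval2E; apply: centred_horner => // i; rewrite coef_map /=.
  apply: centred_horner => // j; rewrite coef_map; exact: place_ring_const.
split=> //.
have /factor_theorem[A1 AE] : root (A - A.[b%:P]%:P) b%:P.
  by rewrite /root hornerD hornerN hornerC subrr.
have -> : eval2 emb A x y - emb A.[b%:P].[a] =
    eval2 emb A1 x y * (y - emb b) + (at_x A.[b%:P] - emb A.[b%:P].[a]).
  have -> : eval2 emb A1 x y * (y - emb b) = eval2 emb (A - A.[b%:P]%:P) x y.
    by rewrite AE !eval2E rmorphM rmorphB /= map_polyX map_polyC hornerM hornerXsubC /= at_xC.
  by rewrite !eval2E rmorphB /= map_polyC hornerD hornerN hornerC /=; ring.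
apply: max_idealD => //; first by apply: max_idealMl => //; exact: centred_y.
by apply: horner_congr => //; [exact: place_ring_const|exact: centred_x].
Qed.

Lemma centred_unit w (A : {poly {poly F}}) : centred w -> A.[b%:P].[a] != 0 ->
  eval2 emb A x y != 0 /\ w (eval2 emb A x y) = 0.
Proof.
move=> cw nz; have [pw _ _] := cw; have vA := place_valuation_ring pw.
have [AA mA] := centred_congr A cw.
have nm : ~ max_ideal (place_ring w) (eval2 emb A x y).
  move=> /(max_idealB vA)/(_ mA); rewrite subKr => /(const_max_ideal vA (place_ring_const pw)).
  exact/eqP.
have [nzA _] := not_max_ideal nm; split=> //.
apply/eqP; rewrite eq_le (place_ringE nzA AA) andbT leNgt.
by apply/negP => /(place_max_idealP pw nzA).
Qed.

(* [x - a] divides, up to a unit, every function vanishing at the smooth point [(a, b)]. *)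
Lemma centred_divide (A : {poly {poly F}}) : A.[b%:P].[a] = 0 ->
  exists A' D : {poly {poly F}}, D.[b%:P].[a] != 0 /\
    eval2 emb A x y * eval2 emb D x y = (x - emb a) * eval2 emb A' x y.
Proof.
move=> A0.
have /factor_theorem[A1 AE] : root (A - A.[b%:P]%:P) b%:P.
  by rewrite /root hornerD hornerN hornerC subrr.
have /factor_theorem[c1 cE] : root A.[b%:P] a by exact/rootP.
(* On the curve D(y) (y - b) = - C(x) (x - a), with [D] and [C] the cofactors obtained here and
   below. The value of [D] at b is (q+1) b^q = b^q, which is nonzero. *)
have /factor_theorem[D DE] : root ('X^(q.+1) - (b ^+ q.+1)%:P%:P : {poly {poly F}}) b%:P.
  by rewrite /root hornerD hornerN hornerXn hornerC polyC_exp subrr.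
have /factor_theorem[C CE] : root (curve_poly q F + (b ^+ q.+1)%:P) a.
  by rewrite /root !hornerD !hornerXn hornerC addrC addrA Hab.
exists (c1%:P * D - A1 * C%:P), D; split.
  have : ('X^(q.+1) - (b ^+ q.+1)%:P%:P : {poly {poly F}})^`().[b%:P] = D.[b%:P].
    by rewrite DE derivM hornerD !hornerM derivXsubC hornerC hornerXsubC subrr mulr0 add0r mulr1.
  rewrite derivB derivXn derivC subr0 hornerMn hornerXn /= => <-.
  rewrite -polyC_exp -mulr_natr -polyC_natr -polyCM hornerC.
  by rewrite (natr_q1 hq cardF) mulr1 expf_neq0.
have e1 : eval2 emb A x y = eval2 emb A1 x y * (y - emb b) + at_x c1 * (x - emb a).
  rewrite -[A in LHS](subrK A.[b%:P]%:P) AE !eval2E rmorphD rmorphM rmorphB /=.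
  rewrite map_polyX !map_polyC hornerD hornerM hornerXsubC hornerC /= at_xC cE.
  by rewrite rmorphM rmorphB /= at_xX at_xC.
have e2 : eval2 emb D x y * (y - emb b) = - at_x C * (x - emb a).
  have := congr1 (fun B => eval2 emb B x y) DE.
  rewrite !eval2E rmorphM !rmorphB /= map_polyX map_polyXn !map_polyC hornerM hornerXsubC.
  rewrite hornerD hornerN hornerXn hornerC /= !at_xC => <-.
  have := congr1 at_x CE; rewrite rmorphM rmorphB rmorphD /= !at_xC at_xX (y_exp HX).
  by rewrite mulNr => <-; ring.
rewrite e1 [eval2 emb (_ - _) x y]eval2E rmorphB !rmorphM /= !map_polyC hornerD hornerN
  !hornerM !hornerC /= -!eval2E.
rewrite mulrDl -mulrA [(y - _) * _]mulrC e2; ring.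
Qed.

Section UniqueCentre.
Variable v : L -> int.
Hypothesis cv : centred v.

(** Division by x - a is repeated while the function vanishes at (a, b). The value at [v] bounds the
    number of divisions, but the exponent found is the same for every centred place, which is the
    point of the order of quantifiers. *)
Lemma centred_value_poly (A : {poly {poly F}}) : eval2 emb A x y != 0 ->
  exists k : nat, forall w, centred w -> w (eval2 emb A x y) = w (x - emb a) *+ k.
Proof.
have [pv vx _] := cv.
have [n ltn] : exists n : nat, v (eval2 emb A x y) < n%:Z.
  by exists `|v (eval2 emb A x y)|.+1; lia.
elim: n A ltn => [|n IH] A ltn nzA.
  have [AA _] := centred_congr A cv.
  by have := place_ringE nzA AA; rewrite leNgt ltn.
have [A0|nz] := eqVneq A.[b%:P].[a] 0; last first.
  by exists 0%N => w cw; rewrite mulr0n; have [] := centred_unit cw nz.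
have [A' [D [nzD E]]] := centred_divide A0.
have [nzd vD] := centred_unit cv nzD.
have nzA' : eval2 emb A' x y != 0.
  apply/eqP => A'0; move/eqP: E; rewrite A'0 mulr0.
  by rewrite mulf_eq0 (negPf nzA) (negPf nzd).
have wE w : centred w -> w (eval2 emb A x y) = w (x - emb a) + w (eval2 emb A' x y).
  move=> cw; have [pw _ _] := cw; have [_ wD] := centred_unit cw nzD.
  by rewrite -(placeM pw) // -E (placeM pw) // wD addr0.
have [||k kP] := IH A' => //; first by have := wE _ cv; lia.
by exists k.+1 => w cw; rewrite (wE w cw) (kP w cw) mulrS.
Qed.

Lemma centred_value z : z != 0 ->
  exists k : int, forall w, centred w -> w z = w (x - emb a) * k.
Proof.
move=> nzz; have [_ _ /(_ z)[A [B [nzB zE]]]] := HX.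
have nzA : eval2 emb A x y != 0.
  by apply: contraNneq nzz => A0; rewrite zE A0 mul0r.
have [k kP] := centred_value_poly nzA; have [l lP] := centred_value_poly nzB.
exists (k%:Z - l%:Z) => w cw; have [pw _ _] := cw.
by rewrite zE (place_div pw) // (kP _ cw) (lP _ cw) !pmulrn !mulrzz mulrBr.
Qed.

(** All values at [w] are multiples of that of x - a, and 1 is a value. *)
Lemma centred_uniformizer w : centred w -> w (x - emb a) = 1.
Proof.
move=> cw; have [pw wx _] := cw; have [_ _ _ [t [nzt wt]]] := pw.
have [k /(_ w cw)] := centred_value nzt; rewrite wt => E.
have : (w (x - emb a) %| 1)%Z by apply/dvdzP; exists k; rewrite mulrC.
by rewrite dvdz1; lia.
Qed.

Lemma centred_unique w : centred w -> same_place w v.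
Proof.
move=> cw z nzz; have [k kP] := centred_value nzz.
by rewrite (kP w cw) (kP v cv) !centred_uniformizer.
Qed.

End UniqueCentre.
End CentredPlaces.

(** * The Fermat cover and its tangent lines *)

(** Either [x] is already a cube, or the cubic X^3 - x has no root and is therefore irreducible. *)
Lemma cube_root_extension (L : fieldType) (x : L) :
  exists (K : fieldType) (e : {rmorphism L -> K}) (u : K), u ^+ 3 = e x.
Proof.
have [[u ux]|nou] := pselect (exists u : L, u ^+ 3 = x).
  by exists L, idfun, u.
have sz : size ('X^3 - x%:P : {poly L}) = 4%N.
  by rewrite size_polyDl ?size_polyXn // size_polyN (leq_ltn_trans (size_polyC_leq1 _)).
have irr : irreducible_poly ('X^3 - x%:P : {poly L}).
  apply: cubic_irreducible; first by rewrite sz.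
  move=> u; apply/negP => /rootP; rewrite hornerD hornerN hornerXn hornerC => /eqP.
  by rewrite subr_eq0 => /eqP ux; apply: nou; exists u.
have [K _ [u /rootP ru _]] := irredp_FAdjoin irr.
exists K, (GRing.in_alg K : {rmorphism L -> K}), u.
move: ru; rewrite rmorphB /= map_polyXn map_polyC hornerD hornerN hornerXn hornerC.
by move/eqP; rewrite subr_eq0 => /eqP.
Qed.

Section ExtendPlace.
Variables (F L K : fieldType) (emb : {rmorphism F -> L}) (e : {rmorphism L -> K}).
Variables (w : L -> int).
Hypothesis pw : is_place emb w.
Let sA := proj1 (place_valuation_ring pw).

(** The inverse of a uniformizer is avoided by some valuation ring containing the image of the ring
    of [w]; that ring dominates it. *)
Lemma extend_place : exists A : K -> Prop, [/\ is_valuation_ring A,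
  forall z, place_ring w z -> A (e z) &
  forall z, max_ideal (place_ring w) z -> max_ideal A (e z)].
Proof.
have [_ _ _ [t [nzt wt]]] := pw.
pose R z := exists2 z', place_ring w z' & z = e z'.
have sR : is_subring R.
  split.
  - by exists 1; [exact: subr_1|rewrite rmorph1].
  - by move=> _ _ [s As ->] [s' As' ->]; exists (s - s'); [exact: subr_B|rewrite rmorphB].
  - by move=> _ _ [s As ->] [s' As' ->]; exists (s * s'); [exact: subr_M|rewrite rmorphM].
have [|A [vA RA nA]] := valuation_ring_avoiding sR (h := (e t)^-1).
  rewrite invrK => -[p [Rp E]].
  have [s As sE] : R p.[e t].
    rewrite horner_coef; apply: (subr_sum sR) => i _; apply: (subr_M sR) => //.
    apply: (subr_X sR); exists t => //; right; by rewrite wt.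
  move: E; rewrite sE -fmorphV => /fmorph_inj E; move: As; rewrite -E => /place_ringE.
  by rewrite invr_eq0 (placeV pw) // wt => /(_ nzt).
have Ae z : place_ring w z -> A (e z) by move=> Az; apply: RA; exists z.
exists A; split=> // z mz.
rewrite -[z](divfK nzt) rmorphM; apply: (max_idealMl vA); last by right.
have [->|nzz] := eqVneq z 0; first by rewrite mul0r; apply: Ae; left.
apply: Ae; right; rewrite (place_div pw) // wt subr_ge0 -gtz0_ge1.
exact/(place_max_idealP pw nzz).
Qed.

End ExtendPlace.

Section TangentLine.
Variables (q : nat) (F : finFieldType) (K : fieldType) (i : {rmorphism F -> K}).
Hypothesis hq : exists p k : nat, [/\ prime p, (0 < k)%N & q = (p ^ k)%N].
Hypothesis q3 : (q %% 3 = 2)%N.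
Hypothesis cardF : #|F| = (q ^ 2)%N.
Variables (u0 t0 : F).
Hypothesis H0 : u0 ^+ q.+1 + t0 ^+ q.+1 + 1 = 0.
Hypothesis nzt0 : t0 != 0.

Definition tangent (u t : K) := 1 + i (u0 ^+ q) * u + i (t0 ^+ q) * t.

(** The quotient of (u - u0)^(q+1) by the tangent form on the curve, written so that at the point
    every term visibly vanishes except the nonzero constant t0^(q+1). *)
Definition cofactor_form (u t : K) :=
  let l := tangent u t in let X := u - i u0 in
  l ^+ q - i u0 * X ^+ q - i (u0 ^+ q) * X * l ^+ q.-1 + i (t0 ^+ q.+1) * (1 + l ^+ q.-1).

Let q_gt1 : (1 < q)%N. Proof. by lia. Qed.

Lemma tangentE u t :
  tangent u t = i (u0 ^+ q) * (u - i u0) + i (t0 ^+ q) * (t - i t0).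
Proof.
have E : i (u0 ^+ q) * i u0 + i (t0 ^+ q) * i t0 + 1 = 0.
  by rewrite -!rmorphM -!exprSr -rmorphD -[1](rmorph1 i) -rmorphD H0 rmorph0.
rewrite /tangent -[RHS]addr0 -E; ring.
Qed.

(* With Frobenius [z -> z^q] the Hermitian equation becomes bilinear, and the tangent line
   at a rational point [(u0, t0)] has contact of order [q + 1] there and no other zero. *)
Lemma tangent_contact u t : u ^+ q.+1 + t ^+ q.+1 + 1 = 0 ->
  (u - i u0) ^+ q.+1 = tangent u t * cofactor_form u t.
Proof.
move=> H; set l := tangent u t; set X := u - i u0; pose Y := t - i t0.
have lE : l = i (u0 ^+ q) * X + i (t0 ^+ q) * Y by exact: tangentE.
have lqE : l ^+ q = i u0 * X ^+ q + i t0 * Y ^+ q.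
  by rewrite lE (exprDq hq cardF i) !exprMn -!rmorphXn !(expf_q2 cardF).
have XqE : X ^+ q = u ^+ q - i (u0 ^+ q) by rewrite /X (exprBq hq cardF i) rmorphXn.
have YqE : Y ^+ q = t ^+ q - i (t0 ^+ q) by rewrite /Y (exprBq hq cardF i) rmorphXn.
have E0 : i (u0 ^+ q) * i u0 + i (t0 ^+ q) * i t0 + 1 = 0.
  by rewrite -!rmorphM -!exprSr -rmorphD -[1](rmorph1 i) -rmorphD H0 rmorph0.
have E : u ^+ q * u + t ^+ q * t + 1 = 0 by rewrite -!exprSr.
(* Polarization: the Hermitian form at the difference of two points of the curve reduces to its
   cross terms. *)
have XY : X ^+ q * X + Y ^+ q * Y = - (l + l ^+ q).
  rewrite lqE lE XqE YqE /X /Y; apply/eqP; rewrite -subr_eq0; apply/eqP.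
  transitivity (u ^+ q * u + t ^+ q * t + 1 - (i (u0 ^+ q) * i u0 + i (t0 ^+ q) * i t0 + 1)).
    ring.
  by rewrite E E0 subrr.
rewrite /cofactor_form -/l -/X exprSr [i (t0 ^+ q.+1)]rmorphXn exprSr -rmorphXn /=.
have lq : l * l ^+ q.-1 = l ^+ q by rewrite -exprS prednK // ltnW.
(* The two factors are t0^q Y and t0 Y^q; their product involves Y^(q+1), which [XY] eliminates. *)
have P : (l - i (u0 ^+ q) * X) * (l ^+ q - i u0 * X ^+ q) =
    i (t0 ^+ q) * i t0 * (- (l + l ^+ q) - X ^+ q * X).
  by rewrite -XY lqE {1}lE; ring.
transitivity (X ^+ q * X + ((l - i (u0 ^+ q) * X) * (l ^+ q - i u0 * X ^+ q) -
    i (t0 ^+ q) * i t0 * (- (l + l ^+ q) - X ^+ q * X))); first by rewrite P subrr addr0.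
transitivity (l * l ^+ q - i u0 * X ^+ q * l - i (u0 ^+ q) * X * (l * l ^+ q.-1) +
   i (t0 ^+ q) * i t0 * (l + l * l ^+ q.-1)); last by ring.
rewrite lq; apply/eqP; rewrite -subr_eq0; apply/eqP.
transitivity (X ^+ q * X * (i (u0 ^+ q) * i u0 + i (t0 ^+ q) * i t0 + 1)); first ring.
by rewrite E0 mulr0.
Qed.

Variable A : K -> Prop.
Hypotheses (vA : is_valuation_ring A) (AF : forall c, A (i c)).
Let sA := proj1 vA.

Lemma tangent_mem u t : A u -> A t -> A (tangent u t).
Proof.
move=> Au At; apply: (subr_D sA); last exact: subr_M.
by apply: (subr_D sA); [exact: subr_1|exact: subr_M].
Qed.

Lemma tangent_zero u t : u ^+ q.+1 + t ^+ q.+1 + 1 = 0 -> A u -> A t ->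
  max_ideal A (tangent u t) -> max_ideal A (u - i u0) /\ max_ideal A (t - i t0).
Proof.
move=> H Au At ml; have Al := tangent_mem Au At.
have AX : A (u - i u0) by apply: subr_B.
have mX : max_ideal A (u - i u0).
  apply: (@max_ideal_pow _ _ vA _ q.+1) => //; rewrite (tangent_contact H).
  apply: max_idealMr => //; rewrite /cofactor_form.
  have AXn n : A ((u - i u0) ^+ n) by exact: subr_X.
  have Aln n : A (tangent u t ^+ n) by exact: subr_X.
  have Aterm : A (i (u0 ^+ q) * (u - i u0) * tangent u t ^+ q.-1).
    by apply: subr_M => //; exact: subr_M.
  apply: subr_D => //; first by do 2!apply: subr_B => //; exact: subr_M.
  by apply: subr_M => //; apply: subr_D => //; exact: subr_1.
split=> //; have -> : t - i t0 = i ((t0 ^+ q)^-1) * (tangent u t - i (u0 ^+ q) * (u - i u0)).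
  rewrite tangentE [X in _ * (X - _)]addrC addrK mulrA -rmorphM mulVf ?expf_neq0 // rmorph1
    mul1r //.
by apply: max_idealMl => //; apply: max_idealB => //; exact: max_idealMl.
Qed.

Lemma tangent_order u t : u ^+ q.+1 + t ^+ q.+1 + 1 = 0 -> u - i u0 != 0 ->
  max_ideal A (u - i u0) -> max_ideal A (t - i t0) ->
  tangent u t != 0 /\ same_val A (tangent u t) ((u - i u0) ^+ q.+1).
Proof.
move=> H nzX mX mY.
have ml : max_ideal A (tangent u t).
  by rewrite tangentE; apply: max_idealD => //; exact: max_idealMl.
have Al := max_ideal_mem vA ml.
have mC : max_ideal A (cofactor_form u t - i (t0 ^+ q.+1)).
  set l := tangent u t in ml Al *; set X := u - i u0 in mX *.
  have -> : cofactor_form u t - i (t0 ^+ q.+1) =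
     l ^+ q - i u0 * X ^+ q - i (u0 ^+ q) * X * l ^+ q.-1 + i (t0 ^+ q.+1) * l ^+ q.-1.
    by rewrite /cofactor_form -/l -/X; ring.
  apply: max_idealD => //; last by apply: max_idealMl => //; apply: max_idealX => //; lia.
  apply: max_idealB => //; last first.
    by apply: max_idealMr => //; [exact: max_idealMl|exact: subr_X].
  apply: max_idealB => //; first by apply: max_idealX => //; lia.
  by apply: max_idealMl => //; apply: max_idealX => //; lia.
have nmC : ~ max_ideal A (cofactor_form u t).
  move=> m1; have : max_ideal A (i (t0 ^+ q.+1)).
    by rewrite -[i _](subKr (cofactor_form u t)); exact: max_idealB.
  by move/(const_max_ideal vA AF)/eqP; rewrite expf_eq0 (negPf nzt0) andbF.
have AC : A (cofactor_form u t).
  by rewrite -[cofactor_form u t](subrK (i (t0 ^+ q.+1))); apply: (subr_D sA);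
    [exact: (max_ideal_mem vA mC)|exact: AF].
have [nzC _] := not_max_ideal nmC.
have E := tangent_contact H.
have nzl : tangent u t != 0.
  by apply: contraNneq nzX => l0; rewrite l0 mul0r in E; move/eqP: E; rewrite expf_eq0.
split=> //; rewrite E -[X in same_val _ X _]mulr1; apply: (same_valM vA);
  first exact: (same_val_refl vA).
by apply: same_val_sym; exact: same_val1.
Qed.

End TangentLine.

(** * Orders of cyclic forms in the conjugate tangents *)

Section FormOrders.
Variables (q : nat) (F : finFieldType) (K : fieldType) (i : {rmorphism F -> K}).
Hypothesis hq : exists p k : nat, [/\ prime p, (0 < k)%N & q = (p ^ k)%N].
Hypothesis q3 : (q %% 3 = 2)%N.
Hypothesis cardF : #|F| = (q ^ 2)%N.
Variables (u0 t0 zeta : F).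
Hypothesis H0 : u0 ^+ q.+1 + t0 ^+ q.+1 + 1 = 0.
Hypotheses (nzu0 : u0 != 0) (nzt0 : t0 != 0).
Hypothesis zetaP : 3.-primitive_root zeta.
Variable A : K -> Prop.
Hypotheses (vA : is_valuation_ring A) (AF : forall c, A (i c)).
Let sA := proj1 vA.
Variables (u t : K).
Hypothesis Hut : u ^+ q.+1 + t ^+ q.+1 + 1 = 0.
Hypothesis nzX : u - i u0 != 0.
Hypotheses (mX : max_ideal A (u - i u0)) (mY : max_ideal A (t - i t0)).

Local Notation tg := (tangent q i u0 t0).
Local Notation X := (u - i u0).
Let z := i zeta.
Let l0 := tg u t.
Let l1 := tg (z * u) (z ^+ 2 * t).
Let l2 := tg (z ^+ 2 * u) (z * t).

(** The values of [l1], and next of [l2], at the point (u0, t0). *)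
Definition tangent1 : F := 1 + zeta * u0 ^+ q.+1 + zeta ^+ 2 * t0 ^+ q.+1.
Definition tangent2 : F := 1 + zeta ^+ 2 * u0 ^+ q.+1 + zeta * t0 ^+ q.+1.

Lemma zeta_sum : 1 + zeta + zeta ^+ 2 = 0.
Proof.
have z1 : zeta - 1 != 0.
  by rewrite subr_eq0 -[zeta]expr1 -(prim_order_dvd zetaP).
apply: (mulfI z1); rewrite mulr0.
transitivity (zeta ^+ 3 - 1); first by ring.
by rewrite (prim_expr_order zetaP) subrr.
Qed.

Lemma l1E : l1 = i tangent1 + (z - z ^+ 2) * i (u0 ^+ q) * X + z ^+ 2 * l0.
Proof.
have E0 : i (u0 ^+ q) * i u0 + i (t0 ^+ q) * i t0 + 1 = 0.
  by rewrite -!rmorphM -!exprSr -rmorphD -[1](rmorph1 i) -rmorphD H0 rmorph0.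
apply/eqP; rewrite -subr_eq0; apply/eqP.
transitivity (- z ^+ 2 * (i (u0 ^+ q) * i u0 + i (t0 ^+ q) * i t0 + 1)).
  rewrite /l1 /l0 /tangent /tangent1 !rmorphD !rmorphM !rmorph1 -/z !exprSr !rmorphM -/z /=; ring.
by rewrite E0 mulr0.
Qed.

Lemma l2E : l2 = i tangent2 + (z ^+ 2 - z) * i (u0 ^+ q) * X + z * l0.
Proof.
have E0 : i (u0 ^+ q) * i u0 + i (t0 ^+ q) * i t0 + 1 = 0.
  by rewrite -!rmorphM -!exprSr -rmorphD -[1](rmorph1 i) -rmorphD H0 rmorph0.
apply/eqP; rewrite -subr_eq0; apply/eqP.
transitivity (- z * (i (u0 ^+ q) * i u0 + i (t0 ^+ q) * i t0 + 1)).
  rewrite /l2 /l0 /tangent /tangent2 !rmorphD !rmorphM !rmorph1 -/z !exprSr !rmorphM -/z /=; ring.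
by rewrite E0 mulr0.
Qed.

(** The three conjugate forms add up to 3, and [l0] vanishes at the point. *)
Lemma tangent12 : tangent1 + tangent2 = 3%:R.
Proof.
have -> : tangent1 + tangent2 =
    2%:R + (1 + zeta + zeta ^+ 2) * (u0 ^+ q.+1 + t0 ^+ q.+1) - (u0 ^+ q.+1 + t0 ^+ q.+1 + 1) + 1.
  by rewrite /tangent1 /tangent2; ring.
by rewrite zeta_sum H0 mul0r addr0 subr0 -(natrD _ 2 1).
Qed.

Lemma max_l0 : max_ideal A l0.
Proof. by rewrite /l0 tangentE //; apply: max_idealD => //; exact: max_idealMl. Qed.

Let Az : A z. Proof. exact: AF. Qed.
Let AX : A X. Proof. exact: max_ideal_mem mX. Qed.
Let Al0 : A l0. Proof. exact: max_ideal_mem max_l0. Qed.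

Lemma l1_congr : max_ideal A (l1 - i tangent1).
Proof.
have -> : l1 - i tangent1 = (z - z ^+ 2) * i (u0 ^+ q) * X + z ^+ 2 * l0 by rewrite l1E; ring.
apply: max_idealD => //.
  by apply: max_idealMl => //; apply: subr_M => //; apply: subr_B => //; exact: subr_X.
by apply: max_idealMl; [|exact: subr_X|exact: max_l0].
Qed.

Lemma l2_congr : max_ideal A (l2 - i tangent2).
Proof.
have -> : l2 - i tangent2 = (z ^+ 2 - z) * i (u0 ^+ q) * X + z * l0 by rewrite l2E; ring.
apply: max_idealD => //.
  by apply: max_idealMl => //; apply: subr_M => //; apply: subr_B => //; exact: subr_X.
by apply: max_idealMl; [| |exact: max_l0].
Qed.

Let Al1 : A l1.
Proof. by rewrite -[l1](subrK (i tangent1)); apply: subr_D => //;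
  exact: max_ideal_mem l1_congr. Qed.
Let Al2 : A l2.
Proof. by rewrite -[l2](subrK (i tangent2)); apply: subr_D => //;
  exact: max_ideal_mem l2_congr. Qed.

Lemma unit_of_congr s c : c != 0 -> max_ideal A (s - i c) -> [/\ s != 0,
  same_val A s 1 & ~ max_ideal A s].
Proof.
move=> nzc ms.
have As : A s by rewrite -[s](subrK (i c)); apply: subr_D => //; exact: max_ideal_mem ms.
have nm : ~ max_ideal A s.
  by move=> /(max_idealB vA)/(_ ms); rewrite subKr => /(const_max_ideal vA AF)/eqP; exact/negP.
by have [nz _] := not_max_ideal nm; split=> //; exact: same_val1.
Qed.

Hypotheses (nz1 : tangent1 != 0) (nz2 : tangent2 != 0).

Definition slope : F := tangent1 / tangent2.
Let s0 := slope.

(** The linear term is (zeta - zeta^2) u0^q (1 + s0) X, where 1 + s0 = 3 / [tangent2] is nonzero;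
    the rest is a multiple of [l0], of order q + 1. *)
Lemma contact_slope : l1 - i s0 * l2 != 0 /\ same_val A (l1 - i s0 * l2) X.
Proof.
pose c : F := (zeta - zeta ^+ 2) * u0 ^+ q * (1 + s0).
have nzc : c != 0.
  rewrite /c; have -> : 1 + s0 = 3%:R / tangent2 by rewrite -tangent12 /s0 /slope; field.
  rewrite !mulf_neq0 ?expf_neq0 ?invr_eq0 ?(natr_3_neq0 hq q3 cardF) //.
  by rewrite subr_eq0 -{1}[zeta]expr1 (eq_prim_root_expr zetaP).
have E : l1 - i s0 * l2 = i c * X + (z ^+ 2 - i s0 * z) * l0.
  have -> : i c * X = ((z - z ^+ 2) * i (u0 ^+ q) * X) * (1 + i s0).
    by rewrite /c /z; ring.
  rewrite l1E l2E; have -> : i tangent1 = i s0 * i tangent2.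
    by rewrite -rmorphM /s0 /slope divfK.
  ring.
have nzic : i c != 0 by rewrite fmorph_eq0.
have [nzl sl] := tangent_order hq q3 cardF H0 nzt0 vA AF Hut nzX mX mY.
have m1 : max_ideal A ((z ^+ 2 - i s0 * z) * l0 / (i c * X)).
  have -> : (z ^+ 2 - i s0 * z) * l0 / (i c * X) =
      (z ^+ 2 - i s0 * z) * (i c)^-1 * (l0 / X ^+ q.+1) * X ^+ q.
    have aux (a c' l s p : K) : c' != 0 -> s != 0 -> p != 0 ->
        a * l / (c' * s) = a / c' * (l / (s * p)) * p.
      by move=> nc ns np; field; rewrite nc ns np.
    by rewrite [X ^+ q.+1]exprS; apply: aux => //; exact: expf_neq0.
  apply: max_idealMl => //; last by apply: max_idealX => //; lia.
  apply: subr_M => //; last by case: sl.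
  apply: subr_M => //; last by rewrite -fmorphV.
  by apply: subr_B => //; [exact: subr_X|exact: subr_M].
have [nz s1] := same_val_add vA (mulf_neq0 nzic nzX) m1.
rewrite E; split=> //; apply: (same_val_trans vA _ s1); first exact: mulf_neq0.
rewrite -[X in same_val _ _ X]mul1r; apply: (same_valM vA); last exact: (same_val_refl vA).
by split; rewrite ?divr1 ?mul1r -?fmorphV.
Qed.

Variables (k : nat) (s1 : F).
Hypothesis s1P : (- s0) ^+ k * - s1 = 1.

Definition binary_form (S T : K) := (S - i s0 * T) ^+ k * (S - i s1 * T).

(** By [s1P] both extreme coefficients of [binary_form] are 1, so the cyclic sum counts each pure
    power twice. Subtracting the powers once makes the form restrict to [binary_form a1 a2] at a0 =
    0. *)
Definition cyclic_form (a0 a1 a2 : K) := binary_form a1 a2 + binary_form a2 a0 + binary_form a0 a1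
  - (a0 ^+ k.+1 + a1 ^+ k.+1 + a2 ^+ k.+1).

Lemma expand_linear (a b S T : K) n : A a -> A b -> A S -> A T ->
  exists R, A R /\ (a * S + b * T) ^+ n = (a * S) ^+ n + T * R.
Proof.
move=> Aa Ab AS AT; elim: n => [|n [R [AR IH]]].
  by exists 0; split; [exact: subr_0|rewrite mulr0 addr0].
exists (b * (a * S + b * T) ^+ n + a * S * R); split; last by rewrite !exprS IH; ring.
have AaS : A (a * S) by exact: subr_M.
apply: subr_D => //; last exact: subr_M.
by apply: subr_M => //; apply: subr_X => //; apply: subr_D => //; exact: subr_M.
Qed.

Lemma cyclic_form_mod_l0 : exists R, A R /\
  cyclic_form l0 l1 l2 = binary_form l1 l2 + l0 * R.
Proof.
have A1 : A 1 by exact: subr_1.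
have [R1 [AR1 E1]] := expand_linear k A1 (AF (- s0)) Al2 Al0.
have [R2 [AR2 E2]] := expand_linear k (AF (- s0)) A1 Al1 Al0.
exists (R1 * (l2 - i s1 * l0) - l2 ^+ k * i s1 + R2 * (l0 - i s1 * l1) + (i (- s0) * l1) ^+ k -
  l0 ^+ k).
split.
  have AB (r a b : K) : A r -> A a -> A b -> A (r * (a - i s1 * b)).
    by move=> Ar Aa Ab; apply: subr_M => //; apply: subr_B => //; exact: subr_M.
  have AX' (a : K) n : A a -> A (a ^+ n) by move=> Aa; exact: subr_X.
  have AM (a b : K) : A a -> A b -> A (a * b) := @subr_M _ _ sA a b.
  apply: (subr_B sA); last exact: AX'.
  apply: (subr_D sA); last by apply: AX'; exact: AM.
  apply: (subr_D sA); last exact: AB.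
  by apply: (subr_B sA); [exact: AB|apply: AM => //; exact: AX'].
have e1 : binary_form l2 l0 = ((1 * l2) ^+ k + l0 * R1) * (l2 - i s1 * l0).
  by rewrite -E1 /binary_form rmorphN mulNr mul1r.
have e2 : binary_form l0 l1 = ((i (- s0) * l1) ^+ k + l0 * R2) * (l0 - i s1 * l1).
  by rewrite -E2 /binary_form rmorphN mulNr mul1r [- _ + _]addrC.
have e3 : (i (- s0) * l1) ^+ k * (i s1 * l1) = - l1 ^+ k.+1.
  rewrite exprMn exprSr -rmorphXn mulrACA -rmorphM; have -> : (- s0) ^+ k * s1 = -1.
    by rewrite -[LHS]opprK -mulrN s1P.
  by rewrite rmorphN rmorph1 mulN1r.
rewrite /cyclic_form e1 e2 mul1r !exprSr.
apply/eqP; rewrite -subr_eq0; apply/eqP.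
transitivity (- ((i (- s0) * l1) ^+ k * (i s1 * l1)) - l1 ^+ k * l1); first by ring.
by rewrite e3 -exprSr opprK subrr.
Qed.

(** The multiple of [l0] has order at least q + 1, beyond [n], so the order is that of the binary
    form: k, and one more when the last root s1 equals s0. *)
Lemma cyclic_form_order n : n = (if s1 == s0 then k.+1 else k) -> (n <= q)%N ->
  cyclic_form l0 l1 l2 != 0 /\ same_val A (cyclic_form l0 l1 l2) (X ^+ n).
Proof.
move=> nE nq; have [R [AR ->]] := cyclic_form_mod_l0.
have [nzD sD] := contact_slope.
have pw e : same_val A ((l1 - i s0 * l2) ^+ e) (X ^+ e).
  elim: e => [|e IH]; first exact: (same_val_refl vA).
  by rewrite !exprS; exact: (same_valM vA).
have [nzB sB] : binary_form l1 l2 != 0 /\ same_val A (binary_form l1 l2) (X ^+ n).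
  move: nE; rewrite /binary_form; case: eqP => [-> ->|/eqP ne ->].
    by rewrite -exprSr; split; [exact: expf_neq0|exact: pw].
  have ms : max_ideal A (l1 - i s1 * l2 - i (tangent1 - s1 * tangent2)).
    have -> : l1 - i s1 * l2 - i (tangent1 - s1 * tangent2) =
        (l1 - i tangent1) - i s1 * (l2 - i tangent2) by rewrite rmorphB rmorphM /=; ring.
    apply: max_idealB => //; first exact: l1_congr.
    by apply: max_idealMl => //; exact: l2_congr.
  have nzc : tangent1 - s1 * tangent2 != 0.
    by rewrite subr_eq0; apply: contra ne => /eqP E; rewrite /s0 /slope E mulfK.
  have [nz s11 _] := unit_of_congr nzc ms.
  split; first by rewrite mulf_neq0 // expf_neq0.
  by rewrite -[X ^+ k]mulr1; apply: (same_valM vA).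
have [nzl sl] := tangent_order hq q3 cardF H0 nzt0 vA AF Hut nzX mX mY.
have nzXn : X ^+ n != 0 by exact: expf_neq0.
have m1 : max_ideal A (l0 * R / binary_form l1 l2).
  have -> : l0 * R / binary_form l1 l2 =
      R * (l0 / X ^+ q.+1) * (X ^+ n / binary_form l1 l2) * X ^+ (q.+1 - n).
    have aux (r l b p s : K) : b != 0 -> p != 0 -> s != 0 ->
        l * r / b = r * (l / (p * s)) * (s / b) * p.
      by move=> nb np ns; field; rewrite nb np ns.
    rewrite -{1}(subnK (leqW nq)) exprD; apply: aux => //; exact: expf_neq0.
  apply: max_idealMl => //; last by apply: max_idealX => //; rewrite subn_gt0.
  by apply: subr_M => //; [apply: subr_M => //; case: sl|case: sB].
have [nz s2] := same_val_add vA nzB m1; split=> //.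
exact: (same_val_trans vA nzB s2 sB).
Qed.

End FormOrders.

(** * Descent of cyclic forms *)

Section RegularForms.
Variables (q : nat) (F : finFieldType) (L : fieldType) (emb : {rmorphism F -> L}) (x y : L).
Local Notation m := (m_of q).
Local Notation at_x := (eval_at emb x).
Local Notation regular := (regular_form emb x).
Hypothesis q3 : (q %% 3 = 2)%N.
Hypothesis HX : is_function_field_X3 emb q x y.
Let m3 := m_of3 q3.
Let nzx : x != 0 := x_neq0 HX.
Let nzy : y != 0 := y_neq0 q3 HX.

Let xm1_neq0 : x ^+ m + 1 != 0.
Proof.
rewrite -(at_xXn emb x) -(rmorph1 (eval_at emb x)) -rmorphD (at_x_eq0 HX).
rewrite -size_poly_gt0 size_polyDl ?size_polyXn // size_poly1.
exact: (m_of_gt0 q3).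
Qed.

Lemma place_y w : is_place emb w -> w y *+ q.+1 = w x *+ m + w (x ^+ m + 1).
Proof.
move=> pw; rewrite -(placeX pw) // (y_exp HX) (placeN pw) /curve_poly.
rewrite mul2n -addnn exprD -[X in _ + X]mulr1 -mulrDr rmorphM rmorphD rmorph1 /= at_xXn.
by rewrite (placeM pw) ?expf_neq0 // (placeX pw).
Qed.

Lemma place_y_finite w : is_place emb w -> 0 <= w x -> w x <= w y *+ 3.
Proof.
move=> pw wx; have [vA _] := place_valuation_ring pw.
have w1 : 0 <= w (x ^+ m + 1).
  apply: place_ringE => //; apply: subr_D => //; last by right; rewrite (place1 pw).
  by apply: subr_X => //; right.
by rewrite -(ler_pMn2r (m_of_gt0 q3)) -mulrnA -m3 (place_y pw) lerDl.
Qed.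

Lemma place_y_infinite w : is_place emb w -> w x <= 0 -> w x *+ 2 <= w y *+ 3.
Proof.
move=> pw wx; have [vA _] := place_valuation_ring pw.
have w1 : w x *+ m <= w (x ^+ m + 1).
  rewrite -(placeX pw) // -subr_ge0 -(place_div pw) ?expf_neq0 //.
  apply: place_ringE; first by rewrite mulf_neq0 ?invr_eq0 ?expf_neq0.
  rewrite mulrDl divff ?expf_neq0 // mul1r; apply: subr_D => //.
    by right; rewrite (place1 pw).
  right; rewrite (placeV pw) ?expf_neq0 // (placeX pw) // oppr_ge0.
  by rewrite pmulrn_lle0 // (m_of_gt0 q3).
rewrite -(ler_pMn2r (m_of_gt0 q3)) -[X in _ <= X]mulrnA -m3 (place_y pw).
by rewrite mulrnAC mulr2n lerD2l.
Qed.

Lemma regular_formD k f g : regular k f -> regular k g -> regular k (f + g).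
Proof.
move=> [f1 f2] [g1 g2]; split=> w pw wx; have [sA _] := place_valuation_ring pw.
  by apply: (subr_D sA); [exact: f1|exact: g1].
by rewrite mulrDl; apply: (subr_D sA); [exact: f2|exact: g2].
Qed.

Lemma regular_formZ k c f : regular k f -> regular k (emb c * f).
Proof.
move=> [f1 f2]; split=> w pw wx; have [sA _] := place_valuation_ring pw;
  have Ac := place_ring_const pw c.
  by apply: (subr_M sA) => //; exact: f1.
by rewrite -mulrA; apply: (subr_M sA) => //; exact: f2.
Qed.

(** Where x is regular, w(y) is at least w(x)/3; where 1/x is regular, at least 2 w(x)/3. The
    numerical conditions are the resulting ones, multiplied by 3. *)
Lemma regular_form_monomial k i j e : (3 * j <= 3 * i + e)%N ->
  (3 * i + 2 * e <= 3 * k + 3 * j)%N -> regular k (x ^+ i * y ^+ e / x ^+ j).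
Proof.
move=> h1 h2; split=> w pw wx; right.
  have := place_y_finite pw wx.
  rewrite (place_div pw) ?(placeM pw) ?(placeX pw) ?mulf_neq0 ?expf_neq0 //.
  move: (w x) (w y) wx => a b a0 ab; rewrite !pmulrn !mulrzz in ab *.
  have p1 : 0 <= (b * 3%:Z - a) * e%:Z by apply: mulr_ge0; lia.
  have p2 : 0 <= a * ((3 * i + e)%:Z - (3 * j)%:Z) by apply: mulr_ge0; lia.
  nia.
have := place_y_infinite pw wx.
rewrite !(place_div pw) ?(placeM pw) ?(placeX pw) ?mulf_neq0 ?invr_eq0 ?expf_neq0 //.
move: (w x) (w y) wx => a b a0 ab; rewrite !pmulrn !mulrzz in ab *.
have p1 : 0 <= (b * 3%:Z - a * 2%:Z) * e%:Z by apply: mulr_ge0; lia.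
have p2 : 0 <= - a * ((3 * k + 3 * j)%:Z - (3 * i + 2 * e)%:Z) by apply: mulr_ge0; lia.
nia.
Qed.

End RegularForms.

Section FormFunctions.
Variables (F : finFieldType) (K : fieldType) (i : {rmorphism F -> K}).

(** Polynomial functions of degree at most n over [F], kept as functions so that rotating (u, t) is
    plain application. Monomials and sums suffice as constructors because descent is additive;
    products are derived. *)
Inductive form_fun : nat -> (K -> K -> K) -> Prop :=
| FormMonomial n c d e : (d + e <= n)%N -> form_fun n (fun u t => i c * u ^+ d * t ^+ e)
| FormAdd n f g : form_fun n f -> form_fun n g -> form_fun n (fun u t => f u t + g u t).

Lemma form_funW n k f : (n <= k)%N -> form_fun n f -> form_fun k f.
Proof.
move=> nk ff; elim: ff k nk => {n f}[n c d e den|n f g _ IHf _ IHg] k nk.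
  by apply: FormMonomial; exact: leq_trans den nk.
by apply: FormAdd; [exact: IHf|exact: IHg].
Qed.

Lemma form_fun_ext n f g : (forall u t, f u t = g u t) -> form_fun n f -> form_fun n g.
Proof. by move=> fg; have -> : f = g by apply/funext => u; apply/funext => t. Qed.

Lemma form_fun_const n c : form_fun n (fun _ _ => i c).
Proof.
apply: form_fun_ext (FormMonomial c (_ : 0 + 0 <= n)%N) => // u t.
by rewrite !expr0 !mulr1.
Qed.

Lemma form_funM n k f g : form_fun n f -> form_fun k g ->
  form_fun (n + k) (fun u t => f u t * g u t).
Proof.
move=> ff; elim: ff k g => {n f} [n c d e den|n f1 f2 _ IH1 _ IH2] k g fg; last first.
  apply: form_fun_ext (FormAdd (IH1 _ _ fg) (IH2 _ _ fg)) => u t.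
  by rewrite mulrDl.
elim: fg n den => {k g} [k c' d' e' den'|k g1 g2 _ IH1 _ IH2] n den.
  apply: form_fun_ext (@FormMonomial (n + k) (c * c') (d + d') (e + e') _); last by lia.
  by move=> u t; rewrite rmorphM !exprD; ring.
apply: form_fun_ext (FormAdd (IH1 _ den) (IH2 _ den)) => u t.
by rewrite mulrDr.
Qed.

Lemma form_fun_pow n k f : form_fun n f -> form_fun (n * k) (fun u t => f u t ^+ k).
Proof.
move=> ff; elim: k => [|k IH].
  by apply: form_fun_ext (form_fun_const _ 1) => u t; rewrite rmorph1.
rewrite mulnS; apply: form_fun_ext (form_funM ff IH) => u t.
by rewrite exprS.
Qed.

Lemma form_fun_scale n c f : form_fun n f -> form_fun n (fun u t => i c * f u t).
Proof. move=> ff; exact: (form_funM (form_fun_const 0 c) ff). Qed.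

Lemma form_funB n f g : form_fun n f -> form_fun n g -> form_fun n (fun u t => f u t - g u t).
Proof.
move=> ff /(form_fun_scale (-1)) fg; apply: form_fun_ext (FormAdd ff fg) => u t.
by rewrite rmorphN rmorph1 mulN1r.
Qed.

Lemma form_fun_tangent q u0 t0 c d :
  form_fun 1 (fun u t => tangent q i u0 t0 (i c * u) (i d * t)).
Proof.
have f0 : form_fun 1 (fun _ _ => i 1) := form_fun_const 1 1.
have fu : form_fun 1 (fun u t => i (u0 ^+ q * c) * u ^+ 1 * t ^+ 0) by exact: FormMonomial.
have ft : form_fun 1 (fun u t => i (t0 ^+ q * d) * u ^+ 0 * t ^+ 1) by exact: FormMonomial.
apply: form_fun_ext (FormAdd (FormAdd f0 fu) ft) => u t.
by rewrite /tangent !rmorphM rmorph1 !expr0 !expr1 !mulr1 !mulrA.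
Qed.

End FormFunctions.

Section Descent.
Variables (q : nat) (F : finFieldType) (L K : fieldType).
Variables (emb : {rmorphism F -> L}) (emb' : {rmorphism L -> K}) (x y : L) (u t : K).
Hypothesis q3 : (q %% 3 = 2)%N.
Hypothesis HX : is_function_field_X3 emb q x y.
Hypotheses (ux : u ^+ 3 = emb' x) (uty : u * t = emb' y).
Variable zeta : F.
Hypothesis zetaP : 3.-primitive_root zeta.
Local Notation i := (emb' \o emb).
Local Notation z := (emb' (emb zeta)).
Local Notation regular := (regular_form emb x).

Let nzx : x != 0 := x_neq0 HX.
Let nzy : y != 0 := y_neq0 q3 HX.

Lemma u_neq0 : u != 0.
Proof.
by apply: contraNneq nzx => u0; rewrite -(fmorph_eq0 emb') -ux u0 expr0n.
Qed.

Lemma t_exp3 : t ^+ 3 = emb' (y ^+ 3 / x).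
Proof.
rewrite rmorphM fmorphV rmorphXn /= -ux -uty exprMn mulrAC divff ?mul1r //.
by rewrite expf_neq0 // u_neq0.
Qed.

(* The cyclic sum kills every monomial [u^d t^e] except those with [d + 2 e] divisible by
   [3], which are invariant under [(u, t) -> (zeta u, zeta^2 t)] and so lie in [L]. *)
Lemma cyclic_descent k f : form_fun i (3 * k) f ->
  exists2 g, regular k g &
    emb' g = f u t + f (z * u) (z ^+ 2 * t) + f (z ^+ 2 * u) (z * t).
Proof.
move: {-2}(3 * k)%N (erefl (3 * k)%N) => n nE ff.
elim: ff nE => {n f} [n c d e den|n f g _ IHf _ IHg] nE; last first.
  have [f' rf fE] := IHf nE; have [g' rg gE] := IHg nE.
  exists (f' + g'); first exact: regular_formD.
  by rewrite rmorphD fE gE; ring.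
subst n.
have z3 : z ^+ 3 = 1 by rewrite -!rmorphXn (prim_expr_order zetaP) !rmorph1.
have zs : 1 + z + z ^+ 2 = 0.
  have := congr1 (fun c => emb' (emb c)) (zeta_sum zetaP).
  by rewrite !rmorphD !rmorphXn !rmorph1 !rmorph0.
pose s := (d + 2 * e)%N.
have -> : i c * u ^+ d * t ^+ e + i c * (z * u) ^+ d * (z ^+ 2 * t) ^+ e +
    i c * (z ^+ 2 * u) ^+ d * (z * t) ^+ e =
    i c * (u ^+ d * t ^+ e) * (1 + z ^+ s + z ^+ (2 * d + e)).
  by rewrite !exprMn /s !mul2n -!addnn !exprD; ring.
have zmod a : z ^+ a = z ^+ (a %% 3).
  by rewrite {1}(divn_eq a 3) exprD [(_ * 3)%N]mulnC exprM z3 expr1n mul1r.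
have [s0|ns] := eqVneq (s %% 3)%N 0%N; last first.
  exists 0.
    by split=> w pw wx; left; rewrite ?mul0r.
  rewrite rmorph0 (zmod s) (zmod (2 * d + e)%N).
  have [[-> ->]|[-> ->]] : (s %% 3 = 1 /\ (2 * d + e) %% 3 = 2)%N \/
      (s %% 3 = 2 /\ (2 * d + e) %% 3 = 1)%N by move: ns; rewrite /s; lia.
    by rewrite expr1 zs mulr0.
  by rewrite expr1 addrAC zs mulr0.
have [g rg gE] : exists2 g, regular k g & emb' g = u ^+ d * t ^+ e.
  have [ed|/ltnW de] := leqP e d.
    have dE : d = (3 * ((d - e) %/ 3) + e)%N by move: s0; rewrite /s; lia.
    exists (x ^+ ((d - e) %/ 3) * y ^+ e / x ^+ 0).
      by apply: (regular_form_monomial q3 HX); lia.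
    rewrite expr0 divr1 rmorphM !rmorphXn /= -ux -uty -exprM.
    by rewrite [(u * t) ^+ e]exprMn mulrA -exprD -dE.
  have eE : e = (d + 3 * ((e - d) %/ 3))%N by move: s0; rewrite /s; lia.
  exists (x ^+ 0 * y ^+ e / x ^+ ((e - d) %/ 3)).
    by apply: (regular_form_monomial q3 HX); lia.
  have -> : x ^+ 0 * y ^+ e / x ^+ ((e - d) %/ 3) = y ^+ d * (y ^+ 3 / x) ^+ ((e - d) %/ 3).
    by rewrite expr0 mul1r expr_div_n -exprM mulrA -exprD -eE.
  by rewrite rmorphM !rmorphXn /= -t_exp3 -uty -exprM [(u * t) ^+ d]exprMn -mulrA -exprD -eE.
exists (emb (c * 3%:R) * g); first exact: regular_formZ.
rewrite rmorphM /= gE (zmod s) (zmod (2 * d + e)%N) s0.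
have -> : ((2 * d + e) %% 3 = 0)%N by move: s0; rewrite /s; lia.
by rewrite expr0 !rmorphM !rmorph_nat /=; ring.
Qed.

End Descent.

Section RestrictPlace.
Variables (F L K : fieldType) (emb : {rmorphism F -> L}) (e : {rmorphism L -> K}).
Variables (w : L -> int) (A : K -> Prop).
Hypothesis pw : is_place emb w.
Hypothesis vA : is_valuation_ring A.
Hypothesis Ae : forall z, place_ring w z -> A (e z).
Hypothesis me : forall z, max_ideal (place_ring w) z -> max_ideal A (e z).

Lemma restrict_mem z : A (e z) -> place_ring w z.
Proof.
move=> Az; apply: contrapT => nz.
have nz0 : z != 0 by apply/eqP => z0; apply: nz; left.
have : max_ideal (place_ring w) z^-1 by right; rewrite invrK.
move=> /me [/eqP|]; first by rewrite fmorph_eq0 invr_eq0 (negPf nz0).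
by rewrite fmorphV invrK.
Qed.

Lemma restrict_max z : max_ideal A (e z) -> max_ideal (place_ring w) z.
Proof.
move=> mz; apply: contrapT => /not_max_ideal[nz /Ae]; rewrite fmorphV => AV.
by case: mz => // /eqP; rewrite fmorph_eq0 (negPf nz).
Qed.

Lemma restrict_same_val s r : s != 0 -> r != 0 -> same_val A (e s) (e r) -> w s = w r.
Proof.
move=> nzs nzr [A1 A2]; apply/(place_same_val pw nzs nzr).
by split; apply: restrict_mem; rewrite rmorphM fmorphV.
Qed.

End RestrictPlace.

(** * The norm of the tangent at a rational point *)

Section RationalPoint.
Variables (q : nat) (F : finFieldType) (L : fieldType) (emb : {rmorphism F -> L}) (x y : L).
Variables (a b u0 zeta : F).
Local Notation m := (m_of q).
Hypothesis hq : exists p k : nat, [/\ prime p, (0 < k)%N & q = (p ^ k)%N].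
Hypothesis q3 : (q %% 3 = 2)%N.
Hypothesis cardF : #|F| = (q ^ 2)%N.
Hypothesis HX : is_function_field_X3 emb q x y.
Hypothesis zetaP : 3.-primitive_root zeta.
Hypothesis Hab : b ^+ q.+1 + a ^+ (2 * m) + a ^+ m = 0.
Hypotheses (nza : a != 0) (nzb : b != 0).
Hypothesis u0a : u0 ^+ 3 = a.

Let t0 := b / u0.
Let m3 := m_of3 q3.
Let nzx : x != 0 := x_neq0 HX.
Let nzy : y != 0 := y_neq0 q3 HX.

Lemma nzu0 : u0 != 0.
Proof. by apply: contraNneq nza => u00; rewrite -u0a u00 expr0n. Qed.

Lemma nzt0 : t0 != 0. Proof. by rewrite mulf_neq0 ?invr_eq0 // nzu0. Qed.

Lemma u0_exp : u0 ^+ q.+1 = a ^+ m. Proof. by rewrite m3 exprM u0a. Qed.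

Lemma t0_exp : t0 ^+ q.+1 = - (1 + a ^+ m).
Proof.
rewrite expr_div_n u0_exp.
have nzA : a ^+ m != 0 by exact: expf_neq0.
have -> : b ^+ q.+1 = - (1 + a ^+ m) * a ^+ m.
  apply/eqP; rewrite -subr_eq0; apply/eqP; rewrite -[RHS]Hab.
  by rewrite mulnC exprM; ring.
by rewrite mulfK.
Qed.

Lemma fermat_point : u0 ^+ q.+1 + t0 ^+ q.+1 + 1 = 0.
Proof. by rewrite u0_exp t0_exp; ring. Qed.

(* The norm to [L] of the tangent line to the Fermat curve at [(u0, t0)]. *)
Definition tangent_norm : L :=
  1 + emb (a ^+ q) * x + emb ((b ^+ 3 / a) ^+ q) * (y ^+ 3 / x) - 3%:R * emb (b ^+ q) * y.

Section Cover.
Variables (K : fieldType) (e : {rmorphism L -> K}) (u t : K).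
Hypotheses (ux : u ^+ 3 = e x) (uty : u * t = e y).
Local Notation i := (e \o emb).
Local Notation z := (i zeta).
Local Notation tg := (tangent q i u0 t0).

Lemma fermat_cover : u ^+ q.+1 + t ^+ q.+1 + 1 = 0.
Proof.
rewrite m3 !exprM ux (t_exp3 HX ux uty) -!rmorphXn -[1](rmorph1 e) -!rmorphD.
have -> : x ^+ m + (y ^+ 3 / x) ^+ m + 1 = 0; last by rewrite rmorph0.
rewrite expr_div_n -exprM -m3 (y_exp HX) /curve_poly rmorphD /= !at_xXn.
have nzxm : x ^+ m != 0 by exact: expf_neq0.
have -> : x ^+ (2 * m) = x ^+ m * x ^+ m by rewrite -exprD addnn mul2n.
by field.
Qed.

Let z3 : z ^+ 3 = 1.
Proof. by rewrite -rmorphXn (prim_expr_order zetaP) rmorph1. Qed.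

Lemma rotate_cover c : c ^+ 3 = 1 ->
  [/\ (c * u) ^+ 3 = e x, (c * u) * (c ^+ 2 * t) = e y &
      (c * u) ^+ q.+1 + (c ^+ 2 * t) ^+ q.+1 + 1 = 0].
Proof.
move=> c3; split; first by rewrite exprMn c3 mul1r.
  by rewrite mulrACA -exprS c3 mul1r.
have cq : c ^+ q.+1 = 1 by rewrite m3 exprM c3 expr1n.
by rewrite !exprMn cq !mul1r fermat_cover.
Qed.

(** The factorization of 1 + p^3 + r^3 - 3pr over the cube roots of unity, with p = u0^q u and r =
    t0^q t. Its terms descend to [L] through u^3 = x, t^3 = y^3 / x and u t = y. *)
Lemma tangent_norm_factor :
  e tangent_norm = tg u t * tg (z * u) (z ^+ 2 * t) * tg (z ^+ 2 * u) (z * t).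
Proof.
have zs : 1 + z + z ^+ 2 = 0.
  by have := congr1 i (zeta_sum zetaP); rewrite !rmorphD !rmorphXn !rmorph1 !rmorph0.
pose p := i (u0 ^+ q) * u; pose r := i (t0 ^+ q) * t.
have E : tg u t * tg (z * u) (z ^+ 2 * t) * tg (z ^+ 2 * u) (z * t) =
    1 + p ^+ 3 + r ^+ 3 - 3%:R * (p * r).
  have E1 : tg u t = 1 + p + r by [].
  have E2 : tg (z * u) (z ^+ 2 * t) = 1 + z * p + z ^+ 2 * r by rewrite /tangent /p /r; ring.
  have E3 : tg (z ^+ 2 * u) (z * t) = 1 + z ^+ 2 * p + z * r by rewrite /tangent /p /r; ring.
  have zz : z + z ^+ 2 = -1 by apply/eqP; rewrite -addr_eq0 addrC addrA zs.
  rewrite E1 E2 E3.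
  transitivity ((1 + p + r) * (1 + (z + z ^+ 2) * (p + r) + z ^+ 3 * (p ^+ 2 + r ^+ 2) +
    (z ^+ 3 * z + z ^+ 2) * (p * r))); first by ring.
  by rewrite z3 !mul1r zz; ring.
have pE : p ^+ 3 = e (emb (a ^+ q) * x).
  by rewrite /p exprMn ux rmorphM -[in RHS]u0a -!rmorphXn exprAC.
have rE : r ^+ 3 = e (emb ((b ^+ 3 / a) ^+ q) * (y ^+ 3 / x)).
  rewrite /r exprMn (t_exp3 HX ux uty) [in RHS]rmorphM; congr (_ * _).
  by rewrite -rmorphXn exprAC /t0 expr_div_n u0a.
have prE : p * r = e (emb (b ^+ q) * y).
  rewrite /p /r mulrACA uty rmorphM; congr (_ * _).
  by rewrite -rmorphM -exprMn /t0 mulrC divfK ?nzu0.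
by rewrite E pE rE prE /tangent_norm rmorphB !rmorphD rmorph1 -mulrA [e (3%:R * _)]rmorphM
  rmorph_nat.
Qed.

Let cube_sum s d : s ^+ 3 - d ^+ 3 = (s - d) * (s ^+ 2 + s * d + d ^+ 2) :> K.
Proof. by ring. Qed.

Lemma cover_x : e (x - emb a) = (u - i u0) * (u ^+ 2 + u * i u0 + i u0 ^+ 2).
Proof. by rewrite -cube_sum ux rmorphB -u0a !rmorphXn. Qed.

Lemma cover_y : e (y - emb b) = u * (t - i t0) + i t0 * (u - i u0).
Proof.
have -> : b = u0 * t0 by rewrite /t0 mulrC divfK // nzu0.
by rewrite rmorphB -uty !rmorphM /=; ring.
Qed.

Variable A : K -> Prop.
Hypotheses (vA : is_valuation_ring A) (AF : forall c, A (i c)).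
Let sA := proj1 vA.

Lemma cover_mem : A (e x) -> A u /\ A t.
Proof.
move=> Ax; have Au : A u by apply: (valuation_ring_pow vA (n := 3)) => //; rewrite ux.
split=> //; apply: (valuation_ring_pow vA (n := q.+1)) => //.
have -> : t ^+ q.+1 = - (1 + u ^+ q.+1).
  by apply/eqP; rewrite -subr_eq0; apply/eqP; rewrite -[RHS]fermat_cover; ring.
by apply: subr_N => //; apply: subr_D => //; [exact: subr_1|exact: subr_X].
Qed.

Lemma cover_max : A u -> max_ideal A (u - i u0) -> max_ideal A (t - i t0) ->
  max_ideal A (e (x - emb a)) /\ max_ideal A (e (y - emb b)).
Proof.
move=> Au mX mY; rewrite cover_x cover_y; split.
  apply: (max_idealMr vA) => //; apply: subr_D => //; last by apply: subr_X.
  by apply: subr_D => //; [exact: subr_X|exact: subr_M].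
by apply: max_idealD => //; apply: max_idealMl.
Qed.

(** Cubing is unramified at u0, where the cofactor takes the nonzero value 3 u0^2. Orders at P can
    thus be read off in powers of u - u0. *)
Lemma cover_order : u - i u0 != 0 -> max_ideal A (u - i u0) ->
  same_val A (e (x - emb a)) (u - i u0).
Proof.
move=> nzX mX; rewrite cover_x -[X in same_val _ _ X]mulr1.
apply: (same_valM vA); first exact: (same_val_refl vA).
have nz3 : 3%:R * u0 ^+ 2 != 0.
  by rewrite mulf_neq0 ?expf_neq0 ?nzu0 // (natr_3_neq0 hq q3 cardF).
have [] // := unit_of_congr vA AF nz3 (s := u ^+ 2 + u * i u0 + i u0 ^+ 2).
have -> : u ^+ 2 + u * i u0 + i u0 ^+ 2 - i (3%:R * u0 ^+ 2) = (u + 2%:R * i u0) * (u - i u0).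
  by rewrite rmorphM rmorph_nat rmorphXn; ring.
apply: (max_idealMl vA) => //; apply: (subr_D sA); last by apply: subr_M => //; exact: subr_nat.
by rewrite -[u](subrK (i u0)); apply: (subr_D sA) => //; exact: max_ideal_mem.
Qed.

End Cover.

Lemma place_cover w : is_place emb w -> exists (K : fieldType) (e : {rmorphism L -> K}) (u t : K)
  (A : K -> Prop), [/\ u ^+ 3 = e x, u * t = e y &
  [/\ is_valuation_ring A, forall z, place_ring w z -> A (e z) &
      forall z, max_ideal (place_ring w) z -> max_ideal A (e z)]].
Proof.
move=> pw; have [K [e [u ux]]] := cube_root_extension x.
have [A [vA Ae me]] := extend_place e pw.
exists K, e, u, (e y / u), A; split=> //; rewrite mulrC divfK //.
by apply: contraNneq nzx => u00; rewrite -(fmorph_eq0 e) -ux u00 expr0n.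
Qed.

Lemma y_sub_neq0 : y - emb b != 0.
Proof.
apply/eqP => E; pose g j : {poly F} := if j == 0%N then - b%:P else (j == 1%N)%:R.
have q1 : (1 < q.+1)%N by lia.
have sum0 : \sum_(0 <= j < q.+1) eval_at emb x (g j) * y ^+ j = 0.
  rewrite big_ltn // big_ltn // big_nat big1 => [|[|[|j]] // _]; last first.
    by rewrite /g /= rmorph0 mul0r.
  by rewrite /g /= rmorph1 rmorphN /= at_xC expr0 expr1 mulr1 mul1r addr0 addrC.
have := y_independent hq q3 cardF HX sum0 q1.
by rewrite /g /= => /eqP; rewrite oner_eq0.
Qed.

(** One of the three factors vanishes upstairs. A rotation of (u, t) turns it into the tangent at
    (u0, t0), which vanishes only there, and rotations do not change the point below. *)
Lemma tangent_norm_zero w : is_place emb w -> 0 <= w x ->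
  max_ideal (place_ring w) tangent_norm -> centred emb x y a b w.
Proof.
move=> pw wx mN.
have [K [e [u [t [A [ux uty [vA Ae me]]]]]]] := place_cover pw.
have AF c : A ((e \o emb) c) by apply: Ae; exact: place_ring_const.
have Ax : A (e x) by apply: Ae; right.
have [Au At] := cover_mem ux uty vA Ax.
have z3 : (e \o emb) zeta ^+ 3 = 1 by rewrite -rmorphXn (prim_expr_order zetaP) rmorph1.
have Az : A ((e \o emb) zeta) by exact: AF.
have zero c : A c -> c ^+ 3 = 1 ->
    max_ideal A (tangent q (e \o emb) u0 t0 (c * u) (c ^+ 2 * t)) -> centred emb x y a b w.
  move=> Ac c3 ml; have [ux' uty' H] := rotate_cover ux uty c3.
  have Acu : A (c * u) by apply: subr_M => //; case: vA.
  have Act : A (c ^+ 2 * t) by case: vA => sA _; apply: subr_M => //; exact: subr_X.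
  have [mX mY] := tangent_zero hq q3 cardF fermat_point nzt0 vA AF H Acu Act ml.
  have [mx my] := cover_max ux' uty' vA AF Acu mX mY.
  split=> //.
    by apply/(place_max_idealP pw (x_sub_neq0 HX a)); apply: restrict_max mx.
  by apply/(place_max_idealP pw y_sub_neq0); apply: restrict_max my.
have := me _ mN; rewrite (tangent_norm_factor ux uty).
have Al c d : A c -> A d -> A (tangent q (e \o emb) u0 t0 (c * u) (d * t)).
  by move=> Ac Ad; case: (vA) => sA _; apply: tangent_mem => //; exact: subr_M.
have sA := proj1 vA; have A1 : A 1 by exact: subr_1.
have Az2 : A ((e \o emb) zeta ^+ 2) by exact: subr_X.
have Al0 : A (tangent q (e \o emb) u0 t0 u t) by rewrite -[u]mul1r -[t]mul1r; exact: Al.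
have Al1 := Al _ _ Az Az2; have Al2 := Al _ _ Az2 Az.
move=> /(max_ideal_prime vA (subr_M sA Al0 Al1) Al2) [/(max_ideal_prime vA Al0 Al1)[ml|ml]|].
- by apply: (zero 1) => //; rewrite ?expr1n // !mul1r.
- exact: (zero ((e \o emb) zeta)).
move=> ml; apply: (zero ((e \o emb) zeta ^+ 2)) => //; first by rewrite exprAC z3 expr1n.
have -> : ((e \o emb) zeta ^+ 2) ^+ 2 = (e \o emb) zeta => //.
by rewrite -exprM exprS z3 mulr1.
Qed.

End RationalPoint.

(** * Functions with prescribed order at the point P *)

Section AtPoint.
Variables (q : nat) (F : finFieldType) (L : fieldType) (emb : {rmorphism F -> L}) (x y : L).
Variables (a b u0 zeta : F) (vP : L -> int).
Local Notation m := (m_of q).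
Hypothesis hq : exists p k : nat, [/\ prime p, (0 < k)%N & q = (p ^ k)%N].
Hypothesis q3 : (q %% 3 = 2)%N.
Hypothesis cardF : #|F| = (q ^ 2)%N.
Hypothesis HX : is_function_field_X3 emb q x y.
Hypothesis zetaP : 3.-primitive_root zeta.
Hypothesis Hab : b ^+ q.+1 + a ^+ (2 * m) + a ^+ m = 0.
Hypotheses (nza : a != 0) (nzb : b != 0).
Hypothesis u0a : u0 ^+ 3 = a.
Hypothesis cP : centred emb x y a b vP.
Hypothesis nA : (a ^+ m) ^+ 2 + a ^+ m + 1 != 0.

Let t0 := b / u0.
Let pP : is_place emb vP. Proof. by case: cP. Qed.
Let nzx : x != 0 := x_neq0 HX.
Let H0 : u0 ^+ q.+1 + t0 ^+ q.+1 + 1 = 0 := fermat_point q3 Hab nza u0a.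
Let nzu0' : u0 != 0 := nzu0 nza u0a.
Let nzt0' : t0 != 0 := nzt0 nza nzb u0a.
Local Notation regular := (regular_form emb x).
Local Notation N := (tangent_norm q emb x y a b).
Local Notation s0 := (slope q u0 t0 zeta).

(** With A = a^m the product is 3 (A^2 + A + 1), so [nA] says that the two conjugate tangents miss
    the point (u0, t0). *)
Lemma tangent12_neq0 : tangent1 q u0 t0 zeta != 0 /\ tangent2 q u0 t0 zeta != 0.
Proof.
have E : tangent1 q u0 t0 zeta * tangent2 q u0 t0 zeta =
    3%:R * ((a ^+ m) ^+ 2 + a ^+ m + 1).
  rewrite /tangent1 /tangent2 (u0_exp q3 u0a) (t0_exp q3 Hab nza u0a).
  set A := a ^+ m; have z3 := prim_expr_order zetaP.
  have zz : zeta + zeta ^+ 2 = -1.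
    by apply/eqP; rewrite -addr_eq0 addrC addrA (zeta_sum zetaP).
  transitivity (1 + zeta ^+ 3 - (zeta + zeta ^+ 2) -
    (zeta ^+ 3 * zeta + zeta ^+ 2 - 2%:R * zeta ^+ 3) * (A + A ^+ 2)); first by ring.
  by rewrite z3 mul1r zz; ring.
have : tangent1 q u0 t0 zeta * tangent2 q u0 t0 zeta != 0.
  by rewrite E mulf_neq0 // (natr_3_neq0 hq q3 cardF).
by rewrite mulf_eq0 negb_or => /andP.
Qed.

Let nz1 := proj1 tangent12_neq0.
Let nz2 := proj2 tangent12_neq0.

(** The chosen cube root of x reduces to one of the three cube roots of a. A rotation brings it to
    u0, and u t = y then forces t to reduce to t0. *)
Lemma point_cover : exists (K : fieldType) (e : {rmorphism L -> K}) (u t : K) (A : K -> Prop),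
  [/\ u ^+ 3 = e x, u * t = e y,
   [/\ is_valuation_ring A, forall z, place_ring vP z -> A (e z) &
       forall z, max_ideal (place_ring vP) z -> max_ideal A (e z)] &
   [/\ u - e (emb u0) != 0, max_ideal A (u - e (emb u0)) & max_ideal A (t - e (emb t0))]].
Proof.
have [K [e [u [t [A [ux uty [vA Ae me]]]]]]] := place_cover HX pP.
have sA := proj1 vA.
have AF c : A ((e \o emb) c) by apply: Ae; exact: place_ring_const.
have mx := centred_x HX cP; have my := centred_y cP.
have Ax : A (e x) by apply: Ae; exact: centred_mem pP mx.
have [Au At] := cover_mem q3 HX ux uty vA Ax.
pose z := (e \o emb) zeta.
have z3 : z ^+ 3 = 1 by rewrite -rmorphXn (prim_expr_order zetaP) rmorph1.
have zs : 1 + z + z ^+ 2 = 0.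
  by have := congr1 (e \o emb) (zeta_sum zetaP); rewrite !rmorphD !rmorphXn !rmorph1 !rmorph0.
have Az : A z by exact: AF.
suff [c [Ac c3 mc]] : exists c, [/\ A c, c ^+ 3 = 1 & max_ideal A (c * u - e (emb u0))].
  have [ux' uty' H] := rotate_cover q3 HX ux uty c3.
  exists K, e, (c * u), (c ^+ 2 * t), A; split=> //.
  have xE := cover_x emb u0a ux'; have yE := cover_y emb b nza u0a uty'.
  have Acu : A (c * u) by exact: subr_M.
  have Act : A (c ^+ 2 * t) by apply: subr_M => //; exact: subr_X.
  split=> //.
    apply/eqP => X0; have /eqP : e (x - emb a) = 0 by rewrite xE /= X0 mul0r.
    by rewrite fmorph_eq0 (negPf (x_sub_neq0 HX a)).
  have : max_ideal A (c * u * (c ^+ 2 * t - e (emb t0))).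
    have -> : c * u * (c ^+ 2 * t - e (emb t0)) =
        e (y - emb b) - e (emb t0) * (c * u - e (emb u0)) by rewrite yE addrK.
    by apply: max_idealB; [|exact: me|apply: max_idealMl => //; exact: (AF t0)].
  case/(max_ideal_prime vA Acu) => //; first by apply: subr_B => //; exact: (AF t0).
  move=> mcu; have : max_ideal A ((e \o emb) u0).
    by rewrite -[(e \o emb) u0](subKr (c * u)); exact: max_idealB.
  by move/(const_max_ideal vA AF)/eqP; rewrite (negPf nzu0').
have A1 : A 1 by exact: subr_1.
have Az2 : A (z ^+ 2) by exact: subr_X.
have AX c : A c -> A (c * u - e (emb u0)).
  by move=> Ac; apply: (subr_B sA); [exact: subr_M|exact: (AF u0)].
have E : (1 * u - e (emb u0)) * (z * u - e (emb u0)) * (z ^+ 2 * u - e (emb u0)) = e (x - emb a).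
  transitivity (z ^+ 3 * u ^+ 3 - (1 + z + z ^+ 2) * (z * u ^+ 2 * e (emb u0) - u * e (emb u0) ^+ 2)
     - e (emb u0) ^+ 3); first by ring.
  by rewrite z3 zs mul0r subr0 mul1r ux rmorphB -u0a !rmorphXn.
have := me _ mx; rewrite -E.
case/(max_ideal_prime vA (subr_M sA (AX _ A1) (AX _ Az)) (AX _ Az2)).
  case/(max_ideal_prime vA (AX _ A1) (AX _ Az)) => mc; last by exists z.
  by exists 1; split; rewrite ?expr1n.
by move=> mc; exists (z ^+ 2); split; rewrite // exprAC z3 expr1n.
Qed.

Section Cover.
Variables (K : fieldType) (e : {rmorphism L -> K}) (u t : K) (A : K -> Prop).
Hypotheses (ux : u ^+ 3 = e x) (uty : u * t = e y).
Hypotheses (vA : is_valuation_ring A) (Ae : forall z, place_ring vP z -> A (e z)).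
Hypothesis me : forall z, max_ideal (place_ring vP) z -> max_ideal A (e z).
Local Notation i := (e \o emb).
Local Notation z := (i zeta).
Local Notation X := (u - i u0).
Local Notation tg := (tangent q i u0 t0).
Hypotheses (nzX : X != 0) (mX : max_ideal A X) (mY : max_ideal A (t - i t0)).

Let AF c : A (i c). Proof. by apply: Ae; exact: place_ring_const. Qed.

Lemma order_at_point g n : g != 0 -> same_val A (e g) (X ^+ n) -> vP g = n%:Z.
Proof.
move=> nzg sg; have nzxa := x_sub_neq0 HX a.
have sx : same_val A (e ((x - emb a) ^+ n)) (X ^+ n).
  rewrite rmorphXn; elim: n {sg} => [|n IH]; first exact: (same_val_refl vA).
  rewrite !exprS; apply: (same_valM vA) => //.
  exact: (cover_order hq q3 cardF nza u0a ux vA AF nzX mX).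
rewrite (restrict_same_val pP me nzg (expf_neq0 n nzxa)); last first.
  apply: (same_val_trans vA _ sg); first exact: expf_neq0.
  exact: same_val_sym.
by rewrite (placeX pP) // (centred_uniformizer hq q3 cardF HX Hab nzb cP cP) natz.
Qed.

Lemma tangent_norm_order_cover : N != 0 /\ vP N = q.+1%:Z.
Proof.
have Hut := fermat_cover q3 HX ux uty.
have E := tangent_norm_factor b HX zetaP nza u0a ux uty.
have [nzl sl] := tangent_order hq q3 cardF H0 nzt0' vA AF Hut nzX mX mY.
have [nzl1 sl1 _] := unit_of_congr vA AF nz1 (l1_congr zeta H0 vA AF mX mY).
have [nzl2 sl2 _] := unit_of_congr vA AF nz2 (l2_congr zeta H0 vA AF mX mY).
have nzN : N != 0 by rewrite -(fmorph_eq0 e) E !mulf_neq0.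
split=> //; apply: order_at_point => //; rewrite E -[X ^+ _]mulr1 -[X ^+ _ * 1]mulr1.
by apply: (same_valM vA) => //; apply: (same_valM vA).
Qed.

Lemma contact_form_cover k n : (0 < k)%N ->
  n = (if (- s0) ^+ (3 * k) == 1 then (3 * k)%N else (3 * k).-1) -> (n <= q)%N ->
  exists g, [/\ g != 0, regular k g & vP g = n%:Z].
Proof.
move=> k0 nE nq; have Hut := fermat_cover q3 HX ux uty.
pose k' := (3 * k).-1; have k'E : k'.+1 = (3 * k)%N by rewrite /k'; lia.
(* The only solution of [s1P]; it coincides with s0 exactly when (- s0)^(3k) = 1. *)
pose s1 := - ((- s0) ^+ k')^-1.
have nzs0 : s0 != 0 by rewrite mulf_neq0 ?invr_eq0.
have nzsk : (- s0) ^+ k' != 0 by rewrite expf_neq0 // oppr_eq0.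
have s1P : (- s0) ^+ k' * - s1 = 1 by rewrite /s1 opprK divff.
have {}nE : n = (if s1 == s0 then k'.+1 else k').
  rewrite nE -k'E /=; congr (if _ then _ else _).
  by rewrite exprSr -[X in _ == X]s1P (inj_eq (mulfI nzsk)) eqr_opp eq_sym.
have [nzG sG] := cyclic_form_order hq q3 cardF H0 nzu0' nzt0' zetaP vA AF Hut nzX mX mY
  nz1 nz2 s1P nE nq.
pose z1 := zeta; pose z2 := zeta ^+ 2.
pose T c d (u t : K) := tg (i c * u) (i d * t).
have fT c d : form_fun i 1 (T c d) by exact: form_fun_tangent.
(* One binary form minus one pure power: descent sums the three rotations, which rebuilds
   [cyclic_form]. *)
pose psi (u t : K) := (T z1 z2 u t - i s0 * T z2 z1 u t) ^+ k' *
   (T z1 z2 u t - i s1 * T z2 z1 u t) - T 1 1 u t ^+ k'.+1.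
have fpsi : form_fun i (3 * k) psi.
  have f1 c : form_fun i 1 (fun u t => T z1 z2 u t - i c * T z2 z1 u t).
    by apply: form_funB => //; exact: form_fun_scale.
  apply: form_funB; last by apply: form_funW (form_fun_pow k'.+1 (fT 1 1)); rewrite mul1n k'E.
  apply: form_funW (form_funM (form_fun_pow k' (f1 s0)) (f1 s1)).
  by rewrite mul1n addn1 k'E.
have [g rg gE] := cyclic_descent q3 HX ux uty zetaP fpsi.
have {}gE : e g = cyclic_form q i u0 t0 zeta k' s1 (tg u t) (tg (z * u) (z ^+ 2 * t))
    (tg (z ^+ 2 * u) (z * t)).
  have z3 : z ^+ 3 = 1 by rewrite -rmorphXn (prim_expr_order zetaP) rmorph1.
  have z4 : z ^+ 2 * z ^+ 2 = z by rewrite -exprD exprSr z3 mul1r.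
  have zz2 : z * z ^+ 2 = 1 by rewrite -exprS.
  have z2z : z ^+ 2 * z = 1 by rewrite -exprSr.
  have gE' : e g = psi u t + psi (z * u) (z ^+ 2 * t) + psi (z ^+ 2 * u) (z * t) by exact: gE.
  have iz2 : i (zeta ^+ 2) = z ^+ 2 by rewrite rmorphXn.
  have T0 r s : T 1 1 r s = tg r s by rewrite /T rmorph1 !mul1r.
  have T1 : T z1 z2 (z * u) (z ^+ 2 * t) = tg (z ^+ 2 * u) (z * t).
    by rewrite /T iz2; congr (tg _ _); rewrite mulrA ?z4.
  have T2 : T z2 z1 (z * u) (z ^+ 2 * t) = tg u t.
    by rewrite /T iz2; congr (tg _ _); rewrite mulrA ?z2z ?zz2 mul1r.
  have T3 : T z1 z2 (z ^+ 2 * u) (z * t) = tg u t.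
    by rewrite /T iz2; congr (tg _ _); rewrite mulrA ?z2z ?zz2 mul1r.
  have T4 : T z2 z1 (z ^+ 2 * u) (z * t) = tg (z * u) (z ^+ 2 * t).
    by rewrite /T iz2; congr (tg _ _); rewrite mulrA ?z4.
  have T5 : T z1 z2 u t = tg (z * u) (z ^+ 2 * t) by rewrite /T iz2.
  have T6 : T z2 z1 u t = tg (z ^+ 2 * u) (z * t) by rewrite /T iz2.
  rewrite gE' /psi !T0 T1 T2 T3 T4 T5 T6 /cyclic_form /binary_form.
  by move: (tg _ _) (tg (z * u) _) (tg (z ^+ 2 * u) _) => l0 l1 l2; ring.
exists g; split=> //; first by rewrite -(fmorph_eq0 e) gE.
by apply: order_at_point; rewrite ?gE // -(fmorph_eq0 e) gE.
Qed.

End Cover.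

Lemma tangent_norm_order : N != 0 /\ vP N = q.+1%:Z.
Proof.
have [K [e [u [t [A [ux uty [vA Ae me] [nzX mX mY]]]]]]] := point_cover.
exact: tangent_norm_order_cover ux uty vA Ae me nzX mX mY.
Qed.

Lemma contact_form k n : (0 < k)%N ->
  n = (if (- s0) ^+ (3 * k) == 1 then (3 * k)%N else (3 * k).-1) -> (n <= q)%N ->
  exists g, [/\ g != 0, regular k g & vP g = n%:Z].
Proof.
have [K [e [u [t [A [ux uty [vA Ae me] [nzX mX mY]]]]]]] := point_cover.
move=> k0 nE nq; exact: (contact_form_cover ux uty vA Ae me nzX mX mY k0 nE nq).
Qed.

Lemma tangent_norm_regular : regular 1 N.
Proof.
have r1 : regular 1 (emb 1 * (x ^+ 0 * y ^+ 0 / x ^+ 0)).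
  by apply/regular_formZ/(regular_form_monomial q3 HX).
have r2 : regular 1 (emb (a ^+ q) * (x ^+ 1 * y ^+ 0 / x ^+ 0)).
  by apply/regular_formZ/(regular_form_monomial q3 HX).
have r3 : regular 1 (emb ((b ^+ 3 / a) ^+ q) * (x ^+ 0 * y ^+ 3 / x ^+ 1)).
  by apply/regular_formZ/(regular_form_monomial q3 HX).
have r4 : regular 1 (emb (- 3%:R * b ^+ q) * (x ^+ 0 * y ^+ 1 / x ^+ 0)).
  by apply/regular_formZ/(regular_form_monomial q3 HX).
have := regular_formD (regular_formD (regular_formD r1 r2) r3) r4.
rewrite /tangent_norm !expr0 !expr1 !divr1 !mulr1 !mul1r rmorph1.
by rewrite rmorphM rmorphN rmorph_nat !mulNr.
Qed.

(** Up to the factor x a^q, the norm is compatible with (x, y) -> (1/x, y/x) applied to both the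
    curve and the point. *)
Lemma tangent_norm_inv : N = x * emb (a ^+ q) * tangent_norm q emb x^-1 (y / x) a^-1 (b / a).
Proof.
have nza' : emb (a ^+ q) != 0 by rewrite fmorph_eq0 expf_neq0.
have nzaq : emb a ^+ q != 0 by rewrite -rmorphXn.
rewrite /tangent_norm.
have -> : emb (a^-1 ^+ q) = (emb a ^+ q)^-1 by rewrite exprVn fmorphV rmorphXn.
have -> : emb (((b / a) ^+ 3 / a^-1) ^+ q) = emb ((b ^+ 3 / a) ^+ q) / emb a ^+ q.
  rewrite -rmorphXn -fmorphV -exprVn -rmorphM -exprMn; congr (emb (_ ^+ q)).
  by field; rewrite nza oner_neq0.
have -> : emb ((b / a) ^+ q) = emb (b ^+ q) / emb a ^+ q.
  by rewrite expr_div_n rmorphM fmorphV !rmorphXn.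
rewrite [emb (a ^+ q)]rmorphXn.
move: (emb ((b ^+ 3 / a) ^+ q)) (emb (b ^+ q)) (emb a ^+ q) nzaq => c d f nzf.
by field; rewrite ?nzx ?nzf ?oner_neq0.
Qed.

Lemma inverse_point : (b / a) ^+ q.+1 + a^-1 ^+ (2 * m) + a^-1 ^+ m = 0.
Proof.
have nzam : a ^+ m != 0 by exact: expf_neq0.
have e3 : a ^+ q.+1 = (a ^+ m) ^+ 3 by rewrite -exprM mulnC (m_of3 q3).
have e2 : a ^+ (2 * m) = (a ^+ m) ^+ 2 by rewrite -exprM mulnC.
rewrite expr_div_n !exprVn e3 e2.
have -> : b ^+ q.+1 = - (a ^+ m) ^+ 2 - a ^+ m.
  by apply/eqP; rewrite -subr_eq0 -e2 opprD !opprK addrA Hab.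
by field.
Qed.

Lemma norm_unit_finite w : is_place emb w -> 0 <= w x -> ~ same_place w vP -> w N = 0.
Proof.
move=> pw wx nw; have [nzN _] := tangent_norm_order.
have [rN _] := tangent_norm_regular.
apply/eqP; rewrite eq_le (place_ringE nzN (rN w pw wx)) andbT leNgt.
apply/negP => /(place_max_idealP pw nzN) mN; apply: nw.
apply: (centred_unique hq q3 cardF HX Hab nzb cP).
exact: (tangent_norm_zero hq q3 cardF HX zetaP Hab nza nzb u0a pw wx mN).
Qed.

(** In inverted coordinates a zero of N / x would be centred at (1/a, b/a), whereas 1/x vanishes at
    a pole of x. *)
Lemma norm_unit_infinite w : is_place emb w -> w x < 0 -> w (N / x) = 0.
Proof.
move=> pw wx; have [nzN _] := tangent_norm_order.
have nzNx : N / x != 0 by rewrite mulf_neq0 ?invr_eq0.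
have [_ rN] := tangent_norm_regular.
have := rN w pw (ltW wx); rewrite expr1 => /(place_ringE nzNx) N0.
apply/eqP; rewrite eq_le N0 andbT leNgt; apply/negP => Npos.
have HX' := function_field_inv q3 HX.
have nzV : a^-1 != 0 by rewrite invr_eq0.
have nzba : b / a != 0 by rewrite mulf_neq0.
have u0V : u0^-1 ^+ 3 = a^-1 by rewrite exprVn u0a.
have wV : 0 < w x^-1 by rewrite (placeV pw) // oppr_gt0.
have nzVx : x^-1 != 0 by rewrite invr_eq0.
pose N' := tangent_norm q emb x^-1 (y / x) a^-1 (b / a).
have NE : N / x = emb (a ^+ q) * N' by rewrite tangent_norm_inv -/N'; field.
have nzN' : N' != 0 by apply: contraNneq nzNx => N'0; rewrite NE N'0 mulr0.
have mN' : max_ideal (place_ring w) N'.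
  apply/(place_max_idealP pw nzN'); move: Npos.
  by rewrite NE (placeM pw) ?fmorph_eq0 ?expf_neq0 // (place_const pw) ?expf_neq0 // add0r.
have [_ wxa _] := tangent_norm_zero hq q3 cardF HX' zetaP inverse_point nzV nzba u0V pw (ltW
  wV) mN'.
have vW := place_valuation_ring pw.
have m1 : max_ideal (place_ring w) x^-1 by apply/(place_max_idealP pw nzVx).
have m2 : max_ideal (place_ring w) (x^-1 - emb a^-1).
  by apply/(place_max_idealP pw) => //; exact: (x_sub_neq0 HX' a^-1).
have : max_ideal (place_ring w) (emb a^-1).
  by rewrite -[emb _](subKr x^-1); exact: max_idealB.
by move/(const_max_ideal vW (place_ring_const pw))/eqP; rewrite (negPf nzV).
Qed.

Lemma vP_x : vP x = 0.
Proof.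
have vW := place_valuation_ring pP; have mx := centred_x HX cP.
have [_ s1 _] := unit_of_congr vW (place_ring_const pP) nza mx.
by move/(place_same_val pP nzx (oner_neq0 _)): s1; rewrite (place1 pP).
Qed.

Lemma weierstrass_of_form k g (o : nat) : regular k g -> g != 0 -> vP g = o%:Z ->
  (o <= k * q.+1)%N -> in_weierstrass emb vP (k * q.+1 - o).
Proof.
move=> [g1 g2] nzg vg ok; have [nzN vN] := tangent_norm_order.
have nzNk : N ^+ k != 0 by exact: expf_neq0.
exists (g / N ^+ k); split; first by rewrite mulf_neq0 ?invr_eq0.
  rewrite (place_div pP) // (placeX pP) // vg vN pmulrn mulrzz.
  by rewrite -subzn // opprB PoszM mulrC.
move=> w pw nw; have [wx|wx] := lerP 0 (w x).
  rewrite (place_div pw) // (placeX pw) // (norm_unit_finite pw wx nw) mul0rn subr0.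
  by apply: place_ringE => //; exact: g1.
have -> : g / N ^+ k = (g / x ^+ k) / (N / x) ^+ k.
  by rewrite expr_div_n; field; rewrite !expf_neq0.
have nzgx : g / x ^+ k != 0 by rewrite mulf_neq0 ?invr_eq0 ?expf_neq0.
have nzNx : N / x != 0 by rewrite mulf_neq0 ?invr_eq0.
rewrite (place_div pw) ?expf_neq0 // (placeX pw) // norm_unit_infinite // mul0rn subr0.
by apply: place_ringE => //; apply: g2 => //; exact: ltW.
Qed.

Lemma form_of_weierstrass k n : in_weierstrass emb vP n -> (n <= k * q.+1)%N ->
  exists g, [/\ g != 0, regular k g & vP g = (k * q.+1 - n)%:Z].
Proof.
move=> [f [nzf vf fP]] nk; have [nzN vN] := tangent_norm_order.
have [N1 N2] := tangent_norm_regular.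
have nzNk : N ^+ k != 0 by exact: expf_neq0.
have vg : vP (f * N ^+ k) = (k * q.+1 - n)%:Z.
  rewrite (placeM pP) // (placeX pP) // vf vN pmulrn mulrzz.
  by rewrite -subzn // PoszM mulrC addrC.
exists (f * N ^+ k); split=> //; first exact: mulf_neq0.
split=> w pw wx; have sW := proj1 (place_valuation_ring pw);
  have [sw|nw] := pselect (same_place w vP).
- by right; rewrite sw ?mulf_neq0 // vg.
- by apply: (subr_M sW); [right; exact: fP|apply: (subr_X sW); exact: N1].
- right; rewrite sw ?mulf_neq0 ?invr_eq0 ?expf_neq0 // (place_div pP) ?mulf_neq0 ?expf_neq0 //.
  by rewrite (placeX pP) // vP_x mul0rn subr0 vg.
rewrite -mulrA; apply: (subr_M sW); first by right; exact: fP.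
by rewrite -expr_div_n; apply: (subr_X sW); have := N2 w pw wx; rewrite expr1.
Qed.

End AtPoint.

(** * The numerical semigroup *)

Section NumericalSemigroup.
Variable s : seq nat.

Lemma in_semigroup0 : in_semigroup s 0.
Proof.
exists (nseq (size s) 0); split; first by rewrite size_nseq.
by rewrite big1 // => k _; rewrite nth_nseq if_same.
Qed.

Lemma in_semigroupD n k : in_semigroup s n -> in_semigroup s k -> in_semigroup s (n + k).
Proof.
move=> [c [_ ->]] [d [_ ->]].
exists (mkseq (fun j => nth 0 c j + nth 0 d j)%N (size s)); split; first by rewrite size_mkseq.
by rewrite -big_split; apply: eq_bigr => j _; rewrite nth_mkseq // mulnDl.
Qed.

Lemma in_semigroup_gen g : g \in s -> in_semigroup s g.
Proof.
move=> gs; exists (mkseq (fun j => (j == index g s) : nat) (size s)).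
split; first by rewrite size_mkseq.
have ls : (index g s < size s)%N by rewrite index_mem.
rewrite (bigD1 (Ordinal ls)) //= nth_mkseq // eqxx mul1n nth_index // big1 ?addn0 // => j nj.
by rewrite nth_mkseq // (_ : (j : nat) == index g s = false) //; apply/negbTE.
Qed.

Lemma in_semigroup_mul g k : g \in s -> in_semigroup s (k * g).
Proof.
move=> gs; elim: k => [|k IH]; first exact: in_semigroup0.
by rewrite mulSn; apply: in_semigroupD => //; exact: in_semigroup_gen.
Qed.

Lemma in_semigroup_min (S : nat -> Prop) : S 0%N ->
  (forall n k, S n -> S k -> S (n + k)%N) -> {in s, forall g, S g} ->
  forall n, in_semigroup s n -> S n.
Proof.
move=> S0 SD Sg n [c [_ ->]].
apply: (big_ind S) => // j _.
have : S (nth 0%N s j) by apply/Sg/mem_nth.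
move: (nth _ s j) => g Sg'.
by elim: (nth _ c j) => [|k IH]; [|rewrite mulSn; exact: SD].
Qed.

End NumericalSemigroup.

(** The listed generators are the pole orders of forms of degree k = j + 1 with a zero of order 3k -
    1; the extra one, treated next, comes from degree i + 1 and full contact 3(i + 1). *)
Lemma generator_order q k : (1 < q)%N -> (0 < k)%N ->
  ((q - 1) + k.-1 * (q - 2) = k * q.+1 - (3 * k).-1)%N.
Proof. by case: q => [|[|q]] // _; case: k => // k _ /=; nia. Qed.

Lemma last_generator_order q i : (1 < q)%N ->
  ((q - 1) + i * (q - 2) - 1 = i.+1 * q.+1 - 3 * i.+1)%N.
Proof. by case: q => [|[|q]] // _; nia. Qed.

Section Combinatorics.
Variables (q m i : nat) (S : nat -> Prop).
Hypotheses (q_gt1 : (1 < q)%N) (qm : q.+1 = (3 * m)%N) (i_gt0 : (0 < i)%N).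
Hypotheses (S0 : S 0%N) (SD : forall n k, S n -> S k -> S (n + k)%N).

(* A form of degree [k] with a zero of order [o] at the point, divided by the [k]-th power of
   the tangent, has a pole of order [k * q.+1 - o]. *)
Definition at_order k o := S (k * q.+1 - o).

Hypothesis gen0 : at_order 1 0.
Hypothesis gen1 : at_order 1 1.
Hypothesis gens : forall k, (0 < k <= i)%N -> at_order k (3 * k).-1.
Hypothesis geni : at_order i.+1 (3 * i.+1).

Lemma at_orderD k o k' o' : (o <= 3 * k)%N -> (o' <= 3 * k')%N ->
  at_order k o -> at_order k' o' -> at_order (k + k') (o + o').
Proof.
move=> ok ok' So So'; rewrite /at_order.
have -> : ((k + k') * q.+1 - (o + o') = (k * q.+1 - o) + (k' * q.+1 - o'))%N by nia.
exact: SD.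
Qed.

Lemma at_order_mul c : at_order (c * i.+1) (3 * (c * i.+1)).
Proof.
elim: c => [|c IH]; first by rewrite /at_order mul0n.
rewrite mulSn mulnDr; apply: at_orderD => //; lia.
Qed.

(** Orders add under products. With k = c (i+1) + r, take c full contacts of degree i + 1 and, if r
    > 0, one form of degree r and order 3r - 1. *)
Lemma at_order_top k : (0 < k)%N ->
  if (i.+1 %| k)%N then at_order k (3 * k) else at_order k (3 * k).-1.
Proof.
move=> k0; case: ifPn => [/dvdnP[c ->]|nd]; first exact: at_order_mul.
have kE := divn_eq k i.+1; set c := (k %/ i.+1)%N in kE; set r := (k %% i.+1)%N in kE.
have r0 : (0 < r)%N by rewrite lt0n; apply: contra nd.
have ri : (r < i.+1)%N by rewrite ltn_pmod.
rewrite kE; have -> : ((3 * (c * i.+1 + r)).-1 = 3 * (c * i.+1) + (3 * r).-1)%N.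
  by rewrite mulnDr -subn1 -addnBA ?subn1 // muln_gt0.
apply: at_orderD; [lia|lia|exact: at_order_mul|].
by apply: gens; rewrite r0 -ltnS.
Qed.

Lemma gen2 : at_order 1 2. Proof. exact: (gens (k := 1)). Qed.

(** Orders 0, 1, 2 in degree one extend degree k to degree k + 1. The one delicate order, 3k + 1, is
    3k + 1 or (3k - 1) + 2 as one summand from each degree, according to the top order present in
    degree k. *)
Lemma at_order_below k o : (0 < k)%N -> (o <= 3 * k - 2)%N -> at_order k o.
Proof.
elim: k o => // k IH o _; have [->|k0] := posnP k; first by case: o => [|[|o]].
rewrite -[k.+1]addn1 => ok.
have step o1 o2 : (o2 <= 2)%N -> (o1 <= 3 * k)%N -> at_order k o1 -> o = (o1 + o2)%N ->
    at_order (k + 1) o.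
  move=> o2k o1k So ->; apply: at_orderD => //; first by lia.
  by case: o2 o2k => [|[|[|//]]] _; [exact: gen0|exact: gen1|exact: gen2].
have [lo|] := leqP o (3 * k - 2); first by apply: (step o 0%N); [|lia|exact: IH|lia].
rewrite leq_eqVlt => /predU1P[oE|].
  by apply: (step o.-1 1%N); [|lia|apply: IH; lia|lia].
rewrite leq_eqVlt => /predU1P[oE|ho].
  by apply: (step (o - 2)%N 2%N); [|lia|apply: IH; lia|lia].
have oE : o = (3 * k).+1 by lia.
have := at_order_top k0; case: ifP => _ T; first by apply: (step (3 * k)%N 1%N); [|lia| |lia].
by apply: (step (3 * k).-1 2%N); [|lia| |lia].
Qed.

(** Let k be n/(q+1) rounded up, so that n = k (q+1) - o with o <= q. For k > m this is below 3k -
    2; for k = m the summand 2 in the bound gives o <= q - 1 = 3m - 2. *)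
Lemma large_in_semigroup n : ((m - 1) * q.+1 + 2 <= n)%N -> S n.
Proof.
move=> ln.
have m0 : (0 < m)%N by lia.
pose k := ((n + q) %/ q.+1)%N.
have kE := divn_eq (n + q) q.+1; rewrite -/k in kE.
have rq : ((n + q) %% q.+1 <= q)%N by rewrite -ltnS ltn_pmod.
have mk : (m <= k)%N by rewrite /k leq_divRL //; nia.
have -> : n = (k * q.+1 - (q - (n + q) %% q.+1))%N by lia.
apply: at_order_below; first by lia.
have [km|km] := leqP k m; last by lia.
have kmE : k = m by lia.
have : ((m - 1) * q.+1 = m * q.+1 - q.+1)%N by rewrite mulnBl mul1n.
have : (q.+1 <= m * q.+1)%N by rewrite leq_pmull.
rewrite kmE in kE *; move: (m * q.+1)%N ((m - 1) * q.+1)%N kE ln => P P'; lia.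
Qed.

(** The cap o <= q makes k and o recoverable from k (q+1) - o. At k = m the order 3m is left out, as
    it gives (m-1)(q+1) again, and so is 3m - 1, which is not supplied when i + 1 divides m. *)
Definition orders k := if k == 0%N then [:: 0%N] else if k == m then iota 0 (3 * m).-1
  else if (i.+1 %| k)%N then rcons (iota 0 (3 * k).-1) (3 * k)%N else iota 0 (3 * k).

Definition small_elements := [seq (k * q.+1 - o)%N | k <- iota 0 m.+1, o <- orders k].

Lemma orders_le k o : (k <= m)%N -> o \in orders k -> (o <= q)%N /\ at_order k o.
Proof.
move=> km; rewrite /orders; case: eqP => [->|/eqP k0].
  by rewrite inE => /eqP ->.
have kpos : (0 < k)%N by rewrite lt0n.
case: eqP => [->|/eqP nkm].
  rewrite mem_iota add0n /= => om; split; first by lia.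
  by apply: at_order_below; lia.
have {nkm km}km : (k < m)%N by rewrite ltn_neqAle nkm.
have := at_order_top kpos; case: ifP => _ T.
  rewrite mem_rcons inE mem_iota add0n /= => /predU1P[->|ok]; first by split=> //; lia.
  by split; [lia|apply: at_order_below; lia].
rewrite mem_iota add0n /= => ok; split; first by lia.
have [oE|no] := eqVneq o (3 * k).-1; first by rewrite oE.
by apply: at_order_below => //; lia.
Qed.

Lemma small_elements_mem n : n \in small_elements -> S n /\ (n <= m * q.+1)%N.
Proof.
move=> /allpairsPdep[k [o [km oo ->]]]; move: km; rewrite mem_iota add0n /= ltnS => km.
have [_ Sko] := orders_le km oo; split=> //.
by rewrite (leq_trans (leq_subr _ _)) // leq_mul2r km orbT.
Qed.

Lemma small_elements_uniq : uniq small_elements.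
Proof.
apply: allpairs_uniq_dep; first exact: iota_uniq.
  move=> k _; rewrite /orders; case: ifP => // _; case: ifP => _; first exact: iota_uniq.
  case: ifP => _; last exact: iota_uniq.
  rewrite rcons_uniq iota_uniq mem_iota add0n andbT -leqNgt; lia.
move=> _ _ /allpairsPdep[k [o [km oo ->]]] /allpairsPdep[k' [o' [km' oo' ->]]] /=.
move: km km'; rewrite !mem_iota add0n /= !ltnS => km km'.
have [oq _] := orders_le km oo; have [oq' _] := orders_le km' oo' => E.
have o0 : k = 0%N -> o = 0%N by move=> k0; move: oo; rewrite k0 inE => /eqP.
have o0' : k' = 0%N -> o' = 0%N by move=> k0; move: oo'; rewrite k0 inE => /eqP.
have kk' : k = k'.
  case: (ltngtP k k') => // kl; exfalso.
    have : ((k.+1) * q.+1 <= k' * q.+1)%N by rewrite leq_mul2r kl orbT.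
    by rewrite mulSn; move: (k * _)%N (k' * _)%N E => P P'; lia.
  have : ((k'.+1) * q.+1 <= k * q.+1)%N by rewrite leq_mul2r kl orbT.
  by rewrite mulSn; move: (k * _)%N (k' * _)%N E => P P'; lia.
subst k'; congr (existT _ _ _).
have [k0|k0] := posnP k; first by rewrite o0 // o0'.
have : (q.+1 <= k * q.+1)%N by rewrite leq_pmull.
by move: (k * _)%N E => P; lia.
Qed.

(** The total is 1 + sum of 3k over 0 < k < m, plus 3m - 1. Trading 3k - 1 for 3k when i + 1 divides
    k does not alter the count, so it meets the dimension bound for every [i]. *)
Lemma small_elements_size : (2 * size small_elements = 3 * m * m.+1)%N.
Proof.
have m0 : (0 < m)%N by lia.
rewrite size_allpairs_dep sumnE big_map.
have szO k : (0 < k < m)%N -> size (orders k) = (3 * k)%N.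
  move=> /andP[k0 km]; rewrite /orders gtn_eqF // ltn_eqF //.
  by case: ifP => _; rewrite ?size_rcons size_iota ?prednK // muln_gt0.
have partial n : (n < m)%N -> (2 * \sum_(k <- iota 0 n.+1) size (orders k) = 3 * n * n.+1 + 2)%N.
  elim: n => [|n IH] nm; first by rewrite big_seq1.
  rewrite -[in iota _ _]addn1 iotaD big_cat /= big_seq1 add0n mulnDr (IH (ltnW nm)) szO ?nm //; nia.
rewrite -[in iota _ _]addn1 iotaD big_cat /= big_seq1 add0n.
have := partial m.-1; rewrite (ltn_predL m) prednK // => /(_ m0).
have -> : size (orders m) = (3 * m).-1.
  by rewrite /orders gtn_eqF // eqxx size_iota.
rewrite mulnDr => ->; nia.
Qed.

End Combinatorics.

(** * Rationality of the Fermat point and the polynomials calP *)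

Section RationalParameters.
Variables (q : nat) (F : finFieldType).
Local Notation m := (m_of q).
Hypothesis hq : exists p k : nat, [/\ prime p, (0 < k)%N & q = (p ^ k)%N].
Hypothesis q3 : (q %% 3 = 2)%N.
Hypothesis cardF : #|F| = (q ^ 2)%N.
Variables (a b : F).
Hypothesis Hab : b ^+ q.+1 + a ^+ (2 * m) + a ^+ m = 0.
Hypothesis nza : a != 0.
Local Notation A := (a ^+ m).
Hypothesis nA : A ^+ 2 + A + 1 != 0.

(* [A^2 + A = - b^(q+1)] is fixed by Frobenius, so [A^q] is [A] or [-1 - A]; the latter forces
   [A^2 + A + 1 = 0] or [A = -1 - A]. *)
Lemma frobenius_Am : A ^+ q = A.
Proof.
pose id : {rmorphism F -> F} := idfun.
have AE : A ^+ 2 + A = - b ^+ q.+1.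
  by apply/eqP; rewrite -addr_eq0 addrC addrA -exprM [(m * 2)%N]mulnC Hab.
have fixed : (A ^+ 2 + A) ^+ q = A ^+ 2 + A.
  have m1 : (-1) ^+ q = -1 :> F.
    have q0 : (0 < q)%N by lia.
    apply/eqP; rewrite -addr_eq0 addrC -[X in X + _](expr1n _ q) -(exprDq hq cardF id).
    by rewrite subrr expr0n gtn_eqF.
  by rewrite AE -mulN1r exprMn m1 exprS exprMn (expf_q2 cardF) [b ^+ q * b]mulrC.
have : (A ^+ q - A) * (A ^+ q + A + 1) == 0.
  have : (A ^+ 2) ^+ q + A ^+ q = A ^+ 2 + A by rewrite -(exprDq hq cardF id).
  rewrite [(A ^+ 2) ^+ q]exprAC => E.
  apply/eqP; transitivity ((A ^+ q) ^+ 2 + A ^+ q - (A ^+ 2 + A)); first by ring.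
  by rewrite E subrr.
rewrite mulf_eq0 !subr_eq0 => /orP[/eqP //|/eqP E].
have Aq : A ^+ q = - (1 + A).
  by apply/eqP; rewrite -subr_eq0; apply/eqP; rewrite -[RHS]E; ring.
(* A^3 = a^(q+1) is a norm, hence fixed by Frobenius. *)
have A3 : (A ^+ q) ^+ 3 = A ^+ 3.
  have -> : (A ^+ q) ^+ 3 = a ^+ (m * 3 + (q ^ 2).-1).
    by rewrite -!exprM; congr (_ ^+ _); have := m_of3 q3; nia.
  rewrite exprD exprM -[RHS]mulr1; congr (_ * _); apply: (mulfI nza).
  have q2 : (0 < q ^ 2)%N by rewrite expn_gt0; apply/orP; left; lia.
  by rewrite mulr1 -exprS prednK // -cardF expf_card.
have : (2%:R * A + 1) * (A ^+ 2 + A + 1) == 0.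
  apply/eqP; transitivity (A ^+ 3 - (- (1 + A)) ^+ 3); first by ring.
  by rewrite -Aq A3 subrr.
rewrite mulf_eq0 (negPf nA) orbF => /eqP E2.
by rewrite Aq; apply/eqP; rewrite -subr_eq0; apply/eqP; rewrite -[RHS]oppr0 -E2; ring.
Qed.

(** A^q = A gives a^(m (q-1)) = 1, and m (q-1) = (q^2 - 1)/3, the exponent that detects cubes in the
    cyclic group of nonzero elements. *)
Lemma cube_root : exists u0 : F, u0 ^+ 3 = a.
Proof.
have q0 : (0 < q)%N by lia.
have nzA : A != 0 by rewrite expf_neq0.
have aE : a ^+ (m * q.-1) = 1.
  by apply: (mulfI nzA); rewrite mulr1 exprM -exprS prednK // frobenius_Am.
have a1 : a ^+ (q ^ 2).-1 = 1.
  by apply: (mulfI nza); rewrite mulr1 -exprS prednK ?expn_gt0 ?q0 // -cardF expf_card.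
have [g gP] := primitive_element q3 cardF.
have [[j jq] /= jE] := prim_rootP gP a1.
have qE : ((q ^ 2).-1 = 3 * (m * q.-1))%N by have := m_of3 q3; nia.
have : ((q ^ 2).-1 %| j * (m * q.-1))%N by rewrite (prim_order_dvd gP) exprM -jE aE.
rewrite qE dvdn_pmul2r; last by have := m_of3 q3; nia.
by move=> /dvdnP[l lE]; exists (g ^+ l); rewrite -exprM -lE -jE.
Qed.

Variables (zeta u0 : F).
Hypothesis zetaP : 3.-primitive_root zeta.
Hypothesis nzb : b != 0.
Hypothesis u0a : u0 ^+ 3 = a.
Let t0 := b / u0.
Local Notation s0 := (slope q u0 t0 zeta).
Local Notation al := (A / (1 + A)).

Lemma nz1A : 1 + A != 0.
Proof.
apply/eqP => E; have : b ^+ q.+1 == 0.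
  have -> : b ^+ q.+1 = - (A * (1 + A)).
    by apply/eqP; rewrite -addr_eq0; apply/eqP; rewrite -[RHS]Hab [(2 * m)%N]mulnC exprM; ring.
  by rewrite E mulr0 oppr0.
by rewrite expf_eq0 (negPf nzb) andbF.
Qed.

(** In terms of alpha, [tangent1] is (zeta - 1)(1 + A)(alpha + zeta^2) and [tangent2] is (zeta^2 -
    1)(1 + A)(alpha + zeta). Hence (alpha + zeta^2)/(alpha + zeta) = - s0 zeta^2, and the power 3k
    removes zeta. *)
Lemma slope_calP k :
  ((- s0) ^+ (3 * k) == 1) = (calP zeta k al == 0).
Proof.
have [nz1 nz2] := tangent12_neq0 hq q3 cardF zetaP Hab nza u0a nA.
have n1A := nz1A; have nzA : A != 0 by rewrite expf_neq0.
have z3 := prim_expr_order zetaP.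
have zz : zeta ^+ 2 = - (1 + zeta).
  by apply/eqP; rewrite -addr_eq0 addrC (zeta_sum zetaP).
have nzz : zeta - zeta ^+ 2 != 0.
  by rewrite subr_eq0 -{1}[zeta]expr1 (eq_prim_root_expr zetaP).
have nz_al : al != 0 by rewrite mulf_neq0 ?invr_eq0.
have al1 : al - 1 != 0.
  have -> : al - 1 = - (1 + A)^-1 by field.
  by rewrite oppr_eq0 invr_eq0.
have e2 : tangent2 q u0 t0 zeta = (zeta ^+ 2 - 1) * (1 + A) * (al + zeta).
  rewrite /tangent2 (u0_exp q3 u0a) (t0_exp q3 Hab nza u0a).
  have -> : (zeta ^+ 2 - 1) * (1 + A) * (al + zeta) = (zeta ^+ 2 - 1) * (A + zeta * (1 + A)).
    by field.
  apply/eqP; rewrite -subr_eq0; apply/eqP.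
  transitivity ((1 - zeta ^+ 3) * (1 + A)); first by ring.
  by rewrite z3 subrr mul0r.
have e1 : tangent1 q u0 t0 zeta = (zeta - 1) * (1 + A) * (al + zeta ^+ 2).
  rewrite /tangent1 (u0_exp q3 u0a) (t0_exp q3 Hab nza u0a).
  have -> : (zeta - 1) * (1 + A) * (al + zeta ^+ 2) = (zeta - 1) * (A + zeta ^+ 2 * (1 + A)).
    by field.
  apply/eqP; rewrite -subr_eq0; apply/eqP.
  transitivity ((1 - zeta ^+ 3) * (1 + A)); first by ring.
  by rewrite z3 subrr mul0r.
have nz_alz : al + zeta != 0 by apply: contraNneq nz2 => E; rewrite e2 E mulr0.
have nz_z1 : zeta - 1 != 0 by rewrite subr_eq0 -[zeta]expr1 -(prim_order_dvd zetaP).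
have sE : al + zeta ^+ 2 = - s0 * zeta ^+ 2 * (al + zeta).
  apply: (mulfI (mulf_neq0 nz_z1 n1A)); rewrite -e1.
  have -> : tangent1 q u0 t0 zeta = s0 * tangent2 q u0 t0 zeta by rewrite /slope divfK.
  rewrite e2; move: s0 al => s d; apply/eqP; rewrite -subr_eq0; apply/eqP.
  transitivity ((zeta - 1) * (1 + zeta + zeta ^+ 2) * (s * (1 + A) * (d + zeta))); first by ring.
  by rewrite (zeta_sum zetaP) mulr0 mul0r.
have cubeE : (al + zeta ^+ 2) ^+ (3 * k) = (- s0) ^+ (3 * k) * (al + zeta) ^+ (3 * k).
  have zk : (zeta ^+ 2) ^+ (3 * k) = 1 by rewrite exprM [(zeta ^+ 2) ^+ 3]exprAC z3 !expr1n.
  by rewrite sE; move: (zeta ^+ 2) zk => c zk; rewrite !exprMn zk mulr1.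
have nzd : 3%:R * (zeta - zeta ^+ 2) * al * (al - 1) != 0.
  by do 3!apply: mulf_neq0 => //; exact: (natr_3_neq0 hq q3 cardF).
rewrite /calP mulf_eq0 invr_eq0 (negPf nzd) orbF cubeE subr_eq0.
have nzp : (al + zeta) ^+ (3 * k) != 0 by exact: expf_neq0.
have := inj_eq (mulIf nzp) ((- s0) ^+ (3 * k)) 1; rewrite /= mul1r => <-; exact: eq_sym.
Qed.

(** The first polynomial is the constant 1. This settles index 1, which the minimality in
    [is_calP_order] leaves aside, as it starts with index 2. *)
Lemma calP1_neq0 : calP zeta 1 al != 0.
Proof.
have n1A := nz1A; have nzA : A != 0 by rewrite expf_neq0.
have z3 := prim_expr_order zetaP.
have nzz : zeta - zeta ^+ 2 != 0.
  by rewrite subr_eq0 -{1}[zeta]expr1 (eq_prim_root_expr zetaP).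
have nz_al : al != 0 by rewrite mulf_neq0 ?invr_eq0.
have al1 : al - 1 != 0.
  have -> : al - 1 = - (1 + A)^-1 by field.
  by rewrite oppr_eq0 invr_eq0.
have nzd : 3%:R * (zeta - zeta ^+ 2) * al * (al - 1) != 0.
  by do 3!apply: mulf_neq0 => //; exact: (natr_3_neq0 hq q3 cardF).
rewrite /calP mulf_neq0 ?invr_eq0 // muln1.
have -> : (al + zeta) ^+ 3 - (al + zeta ^+ 2) ^+ 3 =
    3%:R * (zeta - zeta ^+ 2) * al * (al - 1).
  move: al => d; apply/eqP; rewrite -subr_eq0; apply/eqP.
  transitivity ((1 - zeta ^+ 3) * (zeta ^+ 3 + 3%:R * d * zeta)); first by ring.
  by rewrite z3 subrr mul0r.
by [].
Qed.

End RationalParameters.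

(** * The Weierstrass semigroup at P *)

Section WeierstrassMonoid.
Variables (F L : fieldType) (emb : {rmorphism F -> L}) (v : L -> int).
Hypothesis pv : is_place emb v.

Lemma in_weierstrass0 : in_weierstrass emb v 0.
Proof.
exists 1; split; [exact: oner_neq0|by rewrite (place1 pv)|].
by move=> w pw _; rewrite (place1 pw).
Qed.

Lemma in_weierstrassD n k : in_weierstrass emb v n -> in_weierstrass emb v k ->
  in_weierstrass emb v (n + k).
Proof.
move=> [f [nzf vf fP]] [g [nzg vg gP]]; exists (f * g); split; first exact: mulf_neq0.
  by rewrite (placeM pv) // vf vg PoszD opprD.
by move=> w pw nw; rewrite (placeM pw) //; apply: addr_ge0; [exact: fP|exact: gP].
Qed.

End WeierstrassMonoid.

Section WeierstrassSemigroup.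
Variables (q : nat) (F : finFieldType) (L : fieldType) (emb : {rmorphism F -> L}) (x y : L).
Variables (a b u0 zeta : F) (vP : L -> int) (i : nat).
Local Notation m := (m_of q).
Hypothesis hq : exists p k : nat, [/\ prime p, (0 < k)%N & q = (p ^ k)%N].
Hypothesis q3 : (q %% 3 = 2)%N.
Hypothesis cardF : #|F| = (q ^ 2)%N.
Hypothesis HX : is_function_field_X3 emb q x y.
Hypothesis zetaP : 3.-primitive_root zeta.
Hypothesis Hab : b ^+ q.+1 + a ^+ (2 * m) + a ^+ m = 0.
Hypotheses (nza : a != 0) (nzb : b != 0).
Hypothesis u0a : u0 ^+ 3 = a.
Hypothesis cP : centred emb x y a b vP.
Hypothesis nA : (a ^+ m) ^+ 2 + a ^+ m + 1 != 0.
Hypothesis ordi : is_calP_order zeta (a ^+ m / (1 + a ^+ m)) i.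
Hypothesis im : (i < m)%N.
Let pP : is_place emb vP. Proof. by case: cP. Qed.
Let m3 := m_of3 q3.
Local Notation H := (in_weierstrass emb vP).

Lemma weierstrass_contact k n : (0 < k)%N ->
  n = (if calP zeta k (a ^+ m / (1 + a ^+ m)) == 0 then (3 * k)%N else (3 * k).-1) ->
  (n <= q)%N -> (n <= k * q.+1)%N -> H (k * q.+1 - n).
Proof.
rewrite -(slope_calP hq q3 cardF Hab nza nA zetaP nzb u0a) => k0 nE nq nk.
have [g [nzg rg vg]] := contact_form hq q3 cardF HX zetaP Hab nza nzb u0a cP nA k0 nE nq.
exact: (weierstrass_of_form hq q3 cardF HX zetaP Hab nza nzb u0a cP nA rg nzg vg nk).
Qed.

Lemma weierstrass_q1 : H q.+1.
Proof.
have r1 : regular_form emb x 1 1.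
  have := regular_form_monomial (k := 1) (i := 0) (j := 0) (e := 0) q3 HX isT isT.
  by rewrite !expr0 divr1 mulr1.
have := weierstrass_of_form hq q3 cardF HX zetaP Hab nza nzb u0a cP nA (o := 0) r1.
by rewrite oner_neq0 (place1 pP) mul1n subn0; apply.
Qed.

Lemma weierstrass_q : H q.
Proof.
have r1 : regular_form emb x 1 (x - emb a).
  have rx := regular_form_monomial (k := 1) (i := 1) (j := 0) (e := 0) q3 HX isT isT.
  have r0 := regular_form_monomial (k := 1) (i := 0) (j := 0) (e := 0) q3 HX isT isT.
  have := regular_formD rx (regular_formZ (- a) r0).
  by rewrite !expr0 expr1 !divr1 !mulr1 rmorphN.
have nzxa := x_sub_neq0 HX a.
have vxa := centred_uniformizer hq q3 cardF HX Hab nzb cP cP.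
have := weierstrass_of_form hq q3 cardF HX zetaP Hab nza nzb u0a cP nA (o := 1) r1 nzxa vxa.
by rewrite mul1n subn1; apply.
Qed.

Lemma calP_below k : (0 < k <= i)%N -> calP zeta k (a ^+ m / (1 + a ^+ m)) != 0.
Proof.
move=> /andP[k0 ki]; case: k k0 ki => [//|[_ _|k _ ki]].
  exact: (calP1_neq0 hq q3 cardF Hab nza zetaP nzb).
by case: ordi => _ _; apply.
Qed.

(** [S] is kept abstract to serve both lists of generators. A member of H(P) outside [S] would lie
    below 2g; joined to [small_elements] it would give 1 + 3m(m+1)/2 functions of distinct orders at
    P in the Riemann-Roch space of m times the poles of x. *)
Lemma weierstrass_semigroup (S : nat -> Prop) :
  S 0%N -> (forall n k, S n -> S k -> S (n + k)%N) -> (forall n, S n -> H n) ->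
  at_order q S 1 0 -> at_order q S 1 1 ->
  (forall k, (0 < k <= i)%N -> at_order q S k (3 * k).-1) ->
  at_order q S i.+1 (3 * i.+1) ->
  forall n, H n <-> S n.
Proof.
move=> S0 SD SH g0 g1 gk gi n; split; last exact: SH.
have q_gt1 : (1 < q)%N by lia.
have i0 : (0 < i)%N by case: ordi.
have m0 : (0 < m)%N := m_of_gt0 q3.
move=> Hn; have [large|small] := leqP ((m - 1) * q.+1 + 2) n.
  exact: (large_in_semigroup q_gt1 m3 i0 S0 SD g0 g1 gk gi).
apply: contrapT => nSn.
pose E := n :: small_elements q m i.
have nmq : (n <= m * q.+1)%N.
  have : ((m - 1) * q.+1 = m * q.+1 - q.+1)%N by rewrite mulnBl mul1n.
  have : (q.+1 <= m * q.+1)%N by rewrite leq_pmull.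
  by move: (m * q.+1)%N ((m - 1) * q.+1)%N small => P P'; lia.
have memE k : k \in E -> H k /\ (k <= m * q.+1)%N.
  rewrite inE => /predU1P[-> //|].
  by move=> /(small_elements_mem q_gt1 m3 i0 S0 SD g0 g1 gk gi)[/SH].
have uE : uniq E.
  rewrite cons_uniq (small_elements_uniq q_gt1 m3 i0 S0 SD g0 g1 gk gi) andbT.
  by apply/negP => /(small_elements_mem q_gt1 m3 i0 S0 SD g0 g1 gk gi)[].
have /choice[f fP] : forall j, exists g, (j < size E)%N ->
    [/\ g != 0, regular_form emb x m g & vP g = (m * q.+1 - nth 0%N E j)%:Z].
  move=> j; case: (ltnP j (size E)) => jE; last by exists 0.
  have [Hj jm] := memE _ (mem_nth 0%N jE).
  have [g gP] := form_of_weierstrass hq q3 cardF HX zetaP Hab nza nzb u0a cP nA Hj jm.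
  by exists g.
have := @regular_form_orders _ _ _ _ _ _ hq q3 cardF HX vP f (size E) pP.
have -> : (2 * size E = 2 + 3 * m * m.+1)%N.
  by rewrite -(small_elements_size q_gt1 m3 i0) -mulnS.
have absurd P : ((2 + P <= P)%N -> False) by lia.
move=> bound; apply: absurd (bound _ _) => [j jE|j k /andP[jk kE]].
  by have [] := fP j jE.
have jE := ltn_trans jk kE.
have [_ _ ->] := fP j jE; have [_ _ ->] := fP k kE.
have [_ jm] := memE _ (mem_nth 0%N jE); have [_ km] := memE _ (mem_nth 0%N kE).
have : nth 0%N E j != nth 0%N E k by rewrite nth_uniq // ltn_eqF.
move: (nth 0%N E j) (nth 0%N E k) jm km => c d cm dm; apply: contra => /eqP [e].
by apply/eqP; lia.
Qed.

End WeierstrassSemigroup.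

Theorem theorem4p5 (q : nat) (F : finFieldType) (L : fieldType)
  (emb : {rmorphism F -> L}) (x y : L) (zeta a b : F) (vP : L -> int) (i : nat) :
  (5 <= q)%N ->
  (exists p k : nat, [/\ prime p, (0 < k)%N & q = (p ^ k)%N]) ->
  (q %% 3 = 2)%N ->
  #|F| = (q ^ 2)%N ->
  is_function_field_X3 emb q x y ->
  3.-primitive_root zeta ->
  b ^+ q.+1 + a ^+ (2 * m_of q) + a ^+ (m_of q) = 0 ->
  a != 0 ->
  ~ (b = 0 /\ a ^+ (m_of q) + 1 = 0) ->
  is_place emb vP -> 0 < vP (x - emb a) -> 0 < vP (y - emb b) ->
  let al := a ^+ (m_of q) / (1 + a ^+ (m_of q)) in
  al ^+ 2 - al + 1 != 0 ->
  is_calP_order zeta al i ->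
  ((i <= m_of q - 2)%N -> forall n : nat,
     in_weierstrass emb vP n <->
     in_semigroup ([:: q; q.+1; ((q - 1) + i * (q - 2) - 1)%N] ++
                   [seq ((q - 1) + j * (q - 2))%N | j <- iota 0 i]) n) /\
  (i = (m_of q - 1)%N -> forall n : nat,
     in_weierstrass emb vP n <->
     in_semigroup ([:: q; q.+1] ++
                   [seq ((q - 1) + j * (q - 2))%N | j <- iota 0 (m_of q - 1)]) n).
Proof.
move=> q5 hq q3 cardF HX zetaP Hab nza nO pP px py al nal ordi.
set m := m_of q in Hab nO al nal ordi *.
have m3 : q.+1 = (3 * m)%N := m_of3 q3.
have nzA : a ^+ m != 0 by exact: expf_neq0.
have nzb : b != 0.
  apply/eqP => b0; apply: nO; split=> //; apply: (mulfI nzA).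
  by rewrite mulr0 -[RHS]Hab b0 expr0n /= add0r [(2 * m)%N]mulnC exprM; ring.
have n1A := nz1A Hab nzb.
(* With A = a^m and alpha = A/(1 + A), alpha^2 - alpha + 1 = (A^2 + A + 1)/(1 + A)^2. *)
have nA : (a ^+ m) ^+ 2 + a ^+ m + 1 != 0.
  apply: contraNneq nal => E; apply/eqP; rewrite /al.
  transitivity (((a ^+ m) ^+ 2 + a ^+ m + 1) / (1 + a ^+ m) ^+ 2); first by field.
  by rewrite E mul0r.
have [u0 u0a] := cube_root hq q3 cardF Hab nza nA.
have cP : centred emb x y a b vP by [].
have i0 : (0 < i)%N by case: ordi.
have contact := weierstrass_contact hq q3 cardF HX zetaP Hab nza nzb u0a cP nA.
have below := calP_below hq q3 cardF zetaP Hab nza nzb ordi.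
have Hq := weierstrass_q hq q3 cardF HX zetaP Hab nza nzb u0a cP nA.
have Hq1 := weierstrass_q1 hq q3 cardF HX zetaP Hab nza nzb u0a cP nA.
have q_gt1 : (1 < q)%N by exact: leq_trans q5.
have genH k : (0 < k <= i)%N -> (i < m)%N -> in_weierstrass emb vP ((q - 1) + k.-1 * (q - 2)).
  move=> /andP[k0 ki] im; rewrite generator_order //; apply: contact => //; [|lia|nia].
  by rewrite (negPf (below k _)) // k0.
have main s : (i < m)%N -> q \in s -> q.+1 \in s ->
    (forall k, (0 < k <= i)%N -> ((q - 1) + k.-1 * (q - 2))%N \in s) ->
    (forall g, g \in s -> in_weierstrass emb vP g) ->
    in_semigroup s (i.+1 * q.+1 - 3 * i.+1) ->
    forall n, in_weierstrass emb vP n <-> in_semigroup s n.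
  move=> im qs q1s gs sH geni.
  apply: (weierstrass_semigroup hq q3 cardF HX zetaP Hab nza nzb u0a cP nA ordi im) => //.
  - exact: in_semigroup0.
  - exact: in_semigroupD.
  - by apply: in_semigroup_min sH; [exact: in_weierstrass0|exact: in_weierstrassD].
  - by rewrite /at_order mul1n subn0; exact: in_semigroup_gen.
  - by rewrite /at_order mul1n subn1; exact: in_semigroup_gen.
  - move=> k ki; rewrite /at_order -generator_order //; last by case/andP: ki.
    exact/in_semigroup_gen/gs.
have m2 : (2 <= m)%N by lia.
have lastE := last_generator_order i q_gt1.
split=> iE.
  apply: main.
  - lia.
  - by rewrite !inE eqxx.
  - by rewrite !inE eqxx orbT.
  - move=> k /andP[k0 ki]; rewrite mem_cat; apply/orP; right.
    by apply/mapP; exists k.-1 => //; rewrite mem_iota; lia.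
  - have im : (i < m)%N by lia.
    move=> g; rewrite mem_cat !inE -!orbA => /or4P[/eqP ->|/eqP ->|/eqP ->|/mapP[j]] //.
      rewrite lastE; apply: contact => //; [|lia|nia].
      by case: ordi => _ -> _; rewrite eqxx.
    rewrite mem_iota add0n /= => ji ->; apply: (genH j.+1) => //.
  - by rewrite -lastE; apply: in_semigroup_gen; rewrite !inE eqxx !orbT.
apply: main.
- lia.
- by rewrite !inE eqxx.
- by rewrite !inE eqxx orbT.
- move=> k /andP[k0 ki]; rewrite mem_cat; apply/orP; right.
  by apply/mapP; exists k.-1 => //; rewrite mem_iota; lia.
- have im : (i < m)%N by lia.
  move=> g; rewrite mem_cat !inE -!orbA => /or3P[/eqP ->|/eqP ->|/mapP[j]] //.
  rewrite mem_iota add0n /= => ji ->; apply: (genH j.+1) => //; lia.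
(* For i = m - 1 the full contact has pole order (m-1)(q+1), a multiple of q + 1, so it brings no
   new generator. *)
have -> : (i.+1 * q.+1 - 3 * i.+1 = (m - 1) * q.+1)%N.
  have -> : i.+1 = m by lia.
  by rewrite -m3 mulnBl mul1n.
by apply: in_semigroup_mul; rewrite !inE eqxx orbT.
Qed.
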